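(* Let $K$ be a field. (1) Let $n,m\ge1$ and let $a_1,\dots,a_n,b_1,\dots,b_m\ge2$ be integers with $\sum_{i=1}^n a_i-n=\sum_{j=1}^m b_j-m$. The quotient of $K[x_1,\ldots,x_n,y_1,\ldots,y_m]$ by the ideal $$(x_1^{a_1},\ldots,x_n^{a_n},y_1^{b_1},\ldots,y_m^{b_m})+(x_iy_j:1\le i\le n,1\le j\le m)+(x_1^{a_1-1}\cdots x_n^{a_n-1}-y_1^{b_1-1}\cdots y_m^{b_m-1})$$ is a Macaulay ring if and only if any of the following holds: (a) $n=1$, $m=2$ and $\min\{b_1,b_2\}=2$; (b) $n=2$, $m=1$ and $\min\{a_1,a_2\}=2$; (c) $n=m$ and the multisets $\{a_1,\dots,a_n\}$ and $\{b_1,\dots,b_m\}$ are equal. (2) Let $a_1,a_2,b_1,b_2\ge2$ be integers with $a_1\le a_2$ and $b_1\le b_2$. The ring $$\frac{K[x_1,x_2,y_1,y_2]}{(x_1^{a_1},x_2^{a_2},y_1^{b_1},y_2^{b_2},x_1y_1,x_1y_2,x_2y_1,x_2y_2)}$$ is a Macaulay ring if and only if either (a) $a_1\le b_1$ and $a_2\le b_2$, or (b) $b_1\le a_1$ and $b_2\le a_2$. (3) Let $a_0,a_1,b_0,b_1\ge1$ be integers. The ring $$\frac{K[x,y]}{(x^{a_0},y^{a_1})\cap(x^{b_0},y^{b_1})}$$ is a Macaulay ring if and only if any of the following holds: (i) $a_0\le b_0$ and $a_1\le b_1$; (ii) $b_0\le a_0$ and $b_1\le a_1$; (iii) $b_0<a_0$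 and $a_1<b_1$ and at least one of: $a_0=b_1$; or $b_1<a_0$ and $b_1+b_0\le a_0+a_1$; or $a_0<b_1$ and $a_0+a_1\le b_0+b_1$; (iv) $a_0<b_0$ and $b_1<a_1$ and at least one of: $b_0=a_1$; or $a_1<b_0$ and $a_1+a_0\le b_0+b_1$; or $b_0<a_1$ and $b_0+b_1\le a_0+a_1$.
   Context: Let $S=R/I$ with $R$ a polynomial ring over $K$ and $I$ a homogeneous ideal. A monomial of $S$ is the coset $\overline\mu$ of a monomial $\mu\in R$ with $\mu\notin I$. The monomial poset of $S$ is the set of monomials of $S$ ordered by divisibility: $\overline\mu\mid\overline\nu$ iff $\overline\nu=\overline\mu\cdot\overline\theta$ for some monomial $\overline\theta$ of $S$. It is ranked by degree. $S$ is a Macaulay ring if its monomial poset is a Macaulay poset. For a ranked poset $\mathcal R$, $\mathcal R_{[d]}$ is the set of elements of rank $d$; for $A\subseteq\mathcal R$ the upper shadow is $\nabla A=\{b: b\text{ covers some }a\in A\}$. Given an additional total order on $\mathcal R$ (not required to be related to the partial order), $\mathrm{Seg}_d\,q$ denotes the set of the $q$ largest elements of $\mathcal R_{[d]}$ in the total order. $\mathcal R$ is Macaulay if there is a total order on $\mathcal R$ such that for every $d$ and every $A\subseteq\mathcal R_{[d]}$: (i) $|\nabla\mathrm{Seg}_d|A||\le|\nabla A|$, and (ii) $\nabla\mathrm{Seg}_d|A|=\mathrm{Seg}_{d+1}|\nabla\mathrm{Seg}_d|A||$. *)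

(* Defs.v *)
From HB Require Import structures.
From mathcomp Require Import all_boot all_order all_algebra.
From mathcomp Require Import finmap boolp classical_sets functions cardinality.
From mathcomp Require Import mpoly.

Set Implicit Arguments.
Unset Strict Implicit.
Unset Printing Implicit Defensive.

Import GRing.Theory.
Local Open Scope classical_set_scope.
Local Open Scope ring_scope.
Local Open Scope quotient_scope.

(* A ranked poset is given by its carrier T, its order le and its rank levels
   (level d is the set of elements of rank d).  The levels are meant to be
   finite: ncard is the number of elements of a finite set, and 0 on infinite
   sets. *)
Section RankedPoset.
Variables (T : choiceType) (le : T -> T -> Prop) (level : nat -> set T).

Definition ncard (A : set T) : nat := #|` fset_set A|.

Definition covers (b a : T) : Prop :=
  [/\ le a b, a <> b & forall c, le a c -> le c b -> c = a \/ c = b].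

Definition upper_shadow (A : set T) : set T :=
  [set b | exists2 a, A a & covers b a].

(* x is among the q largest elements of its level iff fewer than q elements of
   that level are strictly larger. *)
Definition segment (ord : rel T) (d q : nat) : set T :=
  [set x | level d x /\
           (ncard [set y | [/\ level d y, ord x y & y <> x]] < q)%N].

Definition macaulay_poset : Prop :=
  exists ord : rel T,
    [/\ total ord, antisymmetric ord, transitive ord
      & forall (d : nat) (A : set T), A `<=` level d ->
          let S := upper_shadow (segment ord d (ncard A)) in
          (ncard S <= ncard (upper_shadow A))%N /\
          S = segment ord d.+1 (ncard S)].

End RankedPoset.

Section MonomialPoset.
Variables (n : nat) (K : fieldType) (I : idealr {mpoly K[n]}).

Definition monomial : set {ideal_quot I} :=
  [set s | exists2 m : 'X_{1..n}, 'X_[m] \notin I & s = \pi_{ideal_quot I} 'X_[m]].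

Definition monomial_dvd (u v : monomial) : Prop :=
  exists t : monomial, val v = val u * val t.

(* For homogeneous I all monomials representing a given coset outside I have
   the same degree. *)
Definition monomial_level (d : nat) : set monomial :=
  [set u | exists2 m : 'X_{1..n}, mdeg m = d & val u = \pi_{ideal_quot I} 'X_[m]].

Definition macaulay_ring : Prop := macaulay_poset monomial_dvd monomial_level.

End MonomialPoset.

Definition ideal_gen (R : comNzRingType) (gs : seq R) : set R :=
  [set p | exists c : 'I_(size gs) -> R, p = \sum_i c i * gs`_i].

Lemma idealr_exists (R : comNzRingType) (A : set R) :
  A 0 -> ~ A 1 -> (forall a u v, A u -> A v -> A (a * u + v)) ->
  exists I : idealr R, [set` I] = A.
Proof.
move=> A0 A1 AD; pose P : R -> bool := fun p => `[< A p >].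
have PP : idealr_closed (P : {pred R}).
  split; first exact/asboolP.
    by apply/negP => /asboolP.
  by move=> a u v /asboolP Au /asboolP Av; apply/asboolP/AD.
pose B := isIdealr.Build R P PP.
pose J : idealr R := HB.pack P B.
by exists J; apply/seteqP; split=> p /=; [move/asboolP | move=> ?; apply/asboolP].
Qed.

Lemma ideal_gen0 (R : comNzRingType) (gs : seq R) : ideal_gen gs 0.
Proof. by exists (fun=> 0); rewrite big1// => i _; rewrite mul0r. Qed.

Lemma ideal_genD (R : comNzRingType) (gs : seq R) (a u v : R) :
  ideal_gen gs u -> ideal_gen gs v -> ideal_gen gs (a * u + v).
Proof.
move=> [c ->] [e ->]; exists (fun i => a * c i + e i).
rewrite mulr_sumr -big_split; apply: eq_bigr => i _ /=.
by rewrite mulrDl mulrA.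
Qed.

Lemma ideal_gen_proper (n : nat) (K : fieldType) (gs : seq {mpoly K[n]}) :
  (forall g, g \in gs -> g@_0%MM = 0) -> ~ ideal_gen gs 1.
Proof.
move=> gs0 [c /(congr1 (mcoeff 0%MM))].
rewrite mcoeff1 eqxx raddf_sum big1 => [|i _].
  by move/eqP; rewrite oner_eq0.
rewrite /= (rmorphM (mcoeff 0%MM : {mpoly K[n]} -> K)) /=.
by rewrite (gs0 gs`_i) ?mulr0 // mem_nth.
Qed.

(* Ideals generated by polynomials without constant term are proper, so they
   and their intersections are carriers of idealr structures. *)
Lemma ideal_gen_idealr (n : nat) (K : fieldType) (gs : seq {mpoly K[n]}) :
  (forall g, g \in gs -> g@_0%MM = 0) ->
  exists I : idealr {mpoly K[n]}, [set` I] = ideal_gen gs.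
Proof.
move=> gs0; apply: idealr_exists; first exact: ideal_gen0.
  exact: ideal_gen_proper.
by move=> a u v; apply: ideal_genD.
Qed.

Lemma ideal_genI_idealr (n : nat) (K : fieldType) (gs hs : seq {mpoly K[n]}) :
  (forall g, g \in gs -> g@_0%MM = 0) ->
  exists I : idealr {mpoly K[n]}, [set` I] = ideal_gen gs `&` ideal_gen hs.
Proof.
move=> gs0; apply: idealr_exists; first by split; apply: ideal_gen0.
  by case=> /(ideal_gen_proper gs0).
by move=> a u v [u1 u2] [v1 v2]; split; apply: ideal_genD.
Qed.

(* Main.v *)
Require Import Defs.
From HB Require Import structures.
From mathcomp Require Import all_boot all_order all_algebra.
From mathcomp Require Import finmap boolp classical_sets functions cardinality.
From mathcomp Require Import mpoly zify.

Set Implicit Arguments.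
Unset Strict Implicit.
Unset Printing Implicit Defensive.

(* The nonzero cosets of monomials form two boxes of exponent vectors with a
   common least element (and, in the first case, a common top), or an L-shaped
   set of exponent pairs.

   Two equal boxes: a pair [(U, V)] of sets of monomials becomes the ideal
   generated by [st] and [sU + tV] in two more variables with [s^2 = t^2 = 0],
   and the theorem of Clements and Lindstrom applies.  It is proved by
   induction on the number of variables, after compressing the two-variable
   fibres.  In two variables and in the L-shape the levels are unions of at most
   two intervals, whose shadows are counted directly.

   Conversely, in a Macaulay connected sum, optimality in degree 1 and
   codegree 2 either makes the variables of one side an initial segment, or
   leaves only small cases.  That side then is an initial segment in every
   degree; comparing it with the other side in degree [d] and codegree [d]
   gives equal Hilbert functions, and the series [prod (1 - X^a_i)] determines
   the exponents.  For wedges and L-shapes, optimality forces one part to be an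
   initial segment in a low degree, hence in all higher ones, where it is no
   longer optimal. *)

(** * Macaulay orders on levels *)

(** No condition compares elements of different degrees, so an order is only examined inside each
    level, and a segment becomes an upward closed subset of a list of exponent vectors. When one box
    precedes the other, such subsets are pairs [(U, V)] with [V] empty or [U] everything. The two
    extra variables turn them into segments because these variables are compared first. The theorem
    on boxes permits this because 2 is the smallest cap present: caps have to decrease towards the
    variables compared first, as compression moves exponents out of a variable whose cap is the
    largest. In the converse, degree 1 only sees the number of variables and the number of caps
    equal to 2, which does not determine the sides. Complementation in the top monomial turns a box
    upside down, so the same counts can be read in codegree 2, where they bound a set by its shadow;
    the two readings are used together. *)

Section Levels.
Variables (T : eqType) (lev : nat -> seq T) (cov : nat -> rel T).

Definition card d (A : pred T) := count A (lev d).

Definition shadow d (A : pred T) : pred T :=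
  fun b => has (fun a => A a && cov d a b) (lev d).

Definition upset (ord : rel T) d (U : pred T) :=
  forall x y, x \in lev d -> y \in lev d -> U x -> ord x y -> U y.

(** The axioms are asked inside one level; a total order of the whole poset is assembled from those
    of the levels when rings are treated. *)
Definition level_order (ord : rel T) d :=
  [/\ {in lev d &, total ord}, {in lev d &, antisymmetric ord}
    & {in lev d & &, transitive ord}].

(** Segments are replaced by upward closed sets: by [upset_nested] and [exists_upset] there is,
    inside the level, exactly one of each cardinality. *)
Definition macaulay_order (ord : rel T) := forall d, level_order ord d /\
  forall U, upset ord d U -> upset ord d.+1 (shadow d U) /\
    forall A, card d A = card d U ->
      card d.+1 (shadow d U) <= card d.+1 (shadow d A).

Definition macaulay_levels := exists ord : rel T, macaulay_order ord.

Lemma shadowP d (A : pred T) b :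
  reflect (exists a, [/\ a \in lev d, A a & cov d a b]) (shadow d A b).
Proof.
apply: (iffP hasP) => [[a al /andP[Aa ab]]|[a [al Aa ab]]]; exists a => //.
by rewrite Aa.
Qed.

Lemma sub_card d (A B : pred T) :
  {in lev d, forall x, A x -> B x} -> card d A <= card d B.
Proof.
move=> AB; rewrite /card (@eq_in_count _ A (predI A B)); last first.
  by move=> x xl /=; case Ax: (A x) => //=; rewrite (AB x).
by apply: sub_count => x /andP[].
Qed.

Lemma eq_card d (A B : pred T) :
  {in lev d, A =1 B} -> card d A = card d B.
Proof. by move=> AB; apply: eq_in_count. Qed.

Lemma sub_shadow d (A B : pred T) :
  {in lev d, forall x, A x -> B x} -> forall b, shadow d A b -> shadow d B b.
Proof.
move=> AB b /shadowP[a [al Aa ab]]; apply/shadowP; exists a; split=> //.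
exact: AB.
Qed.

Lemma eq_shadow d (A B : pred T) :
  {in lev d, A =1 B} -> shadow d A =1 shadow d B.
Proof. by move=> AB b; apply/idP/idP; apply: sub_shadow => x xl; rewrite AB. Qed.

Lemma card_le_size d (A : pred T) : card d A <= size (lev d).
Proof. exact: count_size. Qed.

Lemma card_pred0 d : card d pred0 = 0.
Proof. exact: count_pred0. Qed.

Lemma card_predT d : card d predT = size (lev d).
Proof. exact: count_predT. Qed.

Lemma card_gt0 d (A : pred T) :
  reflect (exists2 x, x \in lev d & A x) (0 < card d A).
Proof. by rewrite /card -has_count; apply: hasP. Qed.

Lemma card_eq0 d (A : pred T) : card d A = 0 -> {in lev d, forall x, ~~ A x}.
Proof.
move=> A0 x xl; apply/negP => Ax.
by have /card_gt0 : exists2 x, x \in lev d & A x by [exists x]; rewrite A0.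
Qed.

Lemma card_lt_exists d (A B : pred T) : card d A < card d B ->
  exists x, [/\ x \in lev d, B x & ~~ A x].
Proof.
move=> AB; have /hasP[x xl /andP[Bx nAx]] : has (fun x => B x && ~~ A x) (lev d).
  apply: contraLR AB => /hasPn h; rewrite -leqNgt; apply: sub_card => x xl Bx.
  by have := h x xl; rewrite Bx negbK.
by exists x.
Qed.

Lemma sub_card_lt d (A B : pred T) x :
  {in lev d, forall x, A x -> B x} -> x \in lev d -> ~~ A x -> B x ->
  card d A < card d B.
Proof.
move=> AB xl nAx Bx; rewrite /card.
have := count_predUI A (predD B A) (lev d).
rewrite (@eq_in_count _ (predU A (predD B A)) B); last first.
  by move=> y yl /=; case Ay: (A y) => //=; rewrite (AB y).
rewrite (@eq_count _ (predI A (predD B A)) pred0); last first.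
  by move=> y /=; case: (A y).
rewrite count_pred0 addn0 => ->; rewrite -[ltnLHS]addn0 ltn_add2l.
by rewrite -has_count; apply/hasP; exists x; rewrite //= nAx.
Qed.

Lemma sub_card_eq d (A B : pred T) :
  {in lev d, forall x, A x -> B x} -> card d B <= card d A ->
  {in lev d, A =1 B}.
Proof.
move=> AB BA x xl; apply/idP/idP => [|Bx]; first exact: AB.
case Ax: (A x) => //; move: BA; rewrite leqNgt => /negP[].
by apply: (@sub_card_lt _ _ _ x); rewrite ?Ax.
Qed.

Lemma card_full d (A : pred T) : size (lev d) <= card d A -> {in lev d, A =1 predT}.
Proof.
by move=> sA; apply: sub_card_eq => //; apply: leq_trans sA; apply: card_le_size.
Qed.

Lemma eq_upset (ord : rel T) d U V : {in lev d, U =1 V} ->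
  upset ord d U -> upset ord d V.
Proof.
by move=> UV upU x y xl yl Vx xy; rewrite -UV //; apply: (upU x y); rewrite ?UV.
Qed.

Section Upsets.
Variables (ord : rel T) (d : nat).
Hypothesis ord_d : level_order ord d.

(** An element of [U] outside [V] lies below all of [V]; then [V] is strictly contained in [U],
    against the cardinalities. *)
Lemma upset_nested U V : upset ord d U -> upset ord d V ->
  card d U <= card d V -> {in lev d, forall x, U x -> V x}.
Proof.
case: ord_d => tot _ _ upU upV UV x xl Ux; case Vx: (V x) => //.
move: UV; rewrite leqNgt => /negP[]; apply: (@sub_card_lt _ _ _ x); rewrite ?Vx //.
move=> y yl Vy; have /orP[xy|yx] := tot x y xl yl; first exact: upU xl yl Ux xy.
by rewrite (upV y x) in Vx.
Qed.

Hypothesis uniq_lev : uniq (lev d).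

Lemma exists_upset k : k <= size (lev d) ->
  exists2 U, upset ord d U & card d U = k.
Proof.
move=> kd; case: ord_d => tot anti trans.
(* The level is sorted in decreasing order; its first [k] entries form the upward closed set. *)
pose ge x y := ord y x; pose s := sort ge (lev d).
have s_lev : s =i lev d by move=> x; rewrite mem_sort.
have sall : all (mem (lev d)) (lev d) by apply/allP.
have ge_trans : {in lev d & &, transitive ge}.
  by move=> x y z xl yl zl xy yz; apply: (trans x).
have ge_tot : {in lev d &, total ge} by move=> x y xl yl; rewrite /ge tot.
have s_sorted : sorted ge s by apply: sort_sorted_in ge_tot _ sall.
have s_uniq : uniq s by rewrite sort_uniq.
exists (mem (take k s)).
  move=> x y xl yl xU xy.
  have ys : y \in s by rewrite s_lev.
  have ks : k <= size s by rewrite size_sort.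
  have xs : x \in s by rewrite s_lev.
  move: xU; rewrite /= !in_take // => xk; rewrite ltnNge; apply/negP => ky.
  have gexy : ge x y.
    have sl : all (mem (lev d)) s by apply/allP=> z; rewrite s_lev.
    have xy_s : index x s < index y s by apply: leq_trans xk ky.
    have := sorted_ltn_nth_in ge_trans x sl s_sorted.
    by move/(_ (index x s) (index y s)); rewrite !inE !index_mem !nth_index //; apply.
  by move: xk; rewrite (anti x y xl yl _) ?xy // ltnNge ky.
have /permP/(_ (mem (take k s))) lev_s : perm_eq (lev d) s by rewrite perm_sym perm_sort.
rewrite /card lev_s.
rewrite -{2}(cat_take_drop k s) count_cat.
have -> : count (mem (take k s)) (take k s) = size (take k s).
  by apply/eqP; rewrite -all_count; apply/allP.
have /eqP-> : count (mem (take k s)) (drop k s) == 0.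
  rewrite -leqn0 leqNgt -has_count; apply/negP => /hasP[x xd /= xt].
  move: s_uniq; rewrite -{1}(cat_take_drop k s) cat_uniq => /and3P[_ /hasPn h _].
  by move/h: xd; rewrite /= xt.
by rewrite addn0 size_takel // size_sort.
Qed.

(** Ranks are counted from the top, as in [segment]: the largest element has rank 0. *)
Definition rank x := card d (fun y => ord x y && (y != x)).

Lemma rank_upset U x : upset ord d U -> x \in lev d -> (rank x < card d U) = U x.
Proof.
case: ord_d => tot anti _ upU xl; apply/idP/idP => [|Ux].
  apply: contraLR => nUx; rewrite -leqNgt; apply: sub_card => y yl Uy.
  have nyx : y != x by apply: contraNneq nUx => <-.
  rewrite nyx andbT; have /orP[//|yx] := tot x y xl yl.
  by rewrite (upU y x) in nUx.
apply: (@sub_card_lt _ _ _ x) => //; last by rewrite eqxx andbF.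
by move=> y yl /andP[xy _]; apply: upU xl yl Ux xy.
Qed.

Lemma rank_seg k : k <= size (lev d) ->
  upset ord d (fun x => rank x < k) /\ card d (fun x => rank x < k) = k.
Proof.
move=> kd; have [U upU cU] := exists_upset kd.
have UE : {in lev d, U =1 (fun x => rank x < k)}.
  by move=> x xl; rewrite -cU rank_upset.
split; last by rewrite -(eq_card UE).
by move=> x y xl yl; rewrite -(UE x xl) -(UE y yl); apply: upU.
Qed.

End Upsets.

End Levels.

(** * Counting in intervals *)

Section Intervals.

Definition cnt (S : pred nat) x y := \sum_(x <= s < y) (S s : nat).

Lemma count_iota_cnt S x y : count S (index_iota x y) = cnt S x y.
Proof. by rewrite -sum1_count big_mkcond. Qed.

Lemma cnt_cat S x g y : x <= g -> g <= y -> cnt S x y = cnt S x g + cnt S g y.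
Proof. by move=> xg gy; rewrite /cnt (big_cat_nat xg gy). Qed.

Lemma cnt_recr S x y : x <= y -> cnt S x y.+1 = cnt S x y + S y.
Proof. by move=> xy; rewrite /cnt big_nat_recr. Qed.

Lemma cnt_recl S x y : x < y -> cnt S x y = S x + cnt S x.+1 y.
Proof. by move=> xy; rewrite /cnt big_ltn. Qed.

Lemma cnt_le (S S' : pred nat) x y : (forall s, x <= s < y -> S s -> S' s) ->
  cnt S x y <= cnt S' x y.
Proof.
move=> SS'; rewrite /cnt !big_nat; apply: leq_sum => s xsy.
by case Ss: (S s) => //; rewrite SS'.
Qed.

Lemma cnt_eq (S S' : pred nat) x y : (forall s, x <= s < y -> S s = S' s) ->
  cnt S x y = cnt S' x y.
Proof. by move=> SS'; rewrite /cnt !big_nat; apply: eq_bigr => s /SS' ->. Qed.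

Lemma cnt_shift (S S' : pred nat) x y : (forall s, x <= s < y -> S s -> S' s.+1) ->
  cnt S x y <= cnt S' x.+1 y.+1.
Proof.
move=> SS'; rewrite /cnt big_add1 /= !big_nat; apply: leq_sum => s xsy.
by case Ss: (S s) => //; rewrite SS'.
Qed.

Lemma cnt_size S x y : cnt S x y <= y - x.
Proof. by rewrite -count_iota_cnt (leq_trans (count_size _ _)) ?size_iota. Qed.

Lemma cnt_itv l r x y : cnt (fun s => l <= s < r) x y = minn r y - maxn l x.
Proof.
have [xy|yx] := leqP x y; last by rewrite /cnt big_geq; lia.
rewrite -(subnKC xy); elim: (y - x) => [|n IHn].
  by rewrite addn0 /cnt big_geq //; lia.
by rewrite addnS cnt_recr; [rewrite IHn; lia | lia].
Qed.

Lemma cnt_gt0 S x y : 0 < cnt S x y -> exists2 s, x <= s < y & S s.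
Proof.
rewrite -count_iota_cnt -has_count => /hasP[s]; rewrite mem_index_iota.
by exists s.
Qed.

Lemma cnt_gap S x y : cnt S x y < y - x -> exists2 s, x <= s < y & ~~ S s.
Proof.
rewrite -count_iota_cnt -[_ - _](size_iota x) -/(index_iota x y).
rewrite -(count_predC S) -[ltnLHS]addn0 ltn_add2l -has_count => /hasP[s].
by rewrite mem_index_iota => xsy nSs; exists s.
Qed.

Lemma cnt_all S x y : cnt S x y = y - x -> forall s, x <= s < y -> S s.
Proof.
move=> cS s xsy; case Ss: (S s) => //.
have xs : x <= s <= y by lia.
have : cnt S x y <= cnt (fun s' => s' != s) x y.
  by apply: cnt_le => s' _ Ss'; apply: contraTneq Ss' => ->; rewrite Ss.
rewrite cS (@cnt_cat _ _ s) ?(@cnt_recl _ s); [|lia..].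
have := cnt_size (fun s' => s' != s) x s.
have := cnt_size (fun s' => s' != s) s.+1 y; rewrite eqxx /=; lia.
Qed.

(** The shadow of a set of exponent pairs of fixed degree, read on one exponent [s]: raising the
    other exponent keeps [s], raising this one gives [s.+1]. *)
Definition step (S : pred nat) : pred nat := fun s => S s || (0 < s) && S s.-1.

Lemma step_stay S x y : cnt S x y <= cnt (step S) x y.
Proof. by apply: cnt_le => s _ Ss; rewrite /step Ss. Qed.

Lemma step_shift S x y : cnt S x y <= cnt (step S) x.+1 y.+1.
Proof. by apply: cnt_shift => s _ Ss; rewrite /step Ss orbT. Qed.

(** Elements up to some [g] in [S] stay, elements from [g] on shift by one; [g] is used twice, which
    is the gain. *)
Lemma step_free S x y : 0 < cnt S x y -> cnt S x y < cnt (step S) x y.+1.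
Proof.
move=> /cnt_gt0[g xgy Sg].
rewrite (@cnt_cat _ x g.+1) ?(@cnt_recr _ x g) ?Sg; [|lia..].
rewrite (@cnt_cat (step S) x g.+1 y.+1); [|lia..].
have := step_stay S x g.+1; have := step_shift S g y.
rewrite (@cnt_recr S) ?(@cnt_recl S g) ?Sg; lia.
Qed.

(** Around a gap, elements to its left shift right and elements to its right stay, so losing a place
    at either end costs nothing. *)
Lemma step_lossy S x y : cnt S x y < y - x -> cnt S x y <= cnt (step S) x.+1 y.
Proof.
move=> /cnt_gap[g xgy nSg].
rewrite (@cnt_cat _ x g) 1?(@cnt_recl _ g) ?(negPf nSg) /=; [|lia..].
rewrite (@cnt_cat (step S) _ g.+1); [|lia..].
have := step_shift S x g; have := step_stay S g.+1 y; lia.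
Qed.

Lemma step_lossy_full S x y : cnt S x y <= (cnt (step S) x.+1 y).+1.
Proof.
have [xy|yx] := ltnP x y; last by rewrite /cnt big_geq.
have := step_stay S x.+1 y; rewrite (cnt_recl _ xy); case: (S x) => /=; lia.
Qed.

(* A gap to the left of an element of [S] costs one. *)
Lemma step_left_gap S x y g s : x <= g -> g < s -> s < y -> ~~ S g -> S s ->
  cnt S x y < cnt (step S) x.+1 y.+1.
Proof.
move=> xg gs sy nSg Ss.
rewrite (@cnt_cat _ x g) 1?(@cnt_recl _ g) ?(negPf nSg) /=; [|lia..].
rewrite (@cnt_cat (step S) _ g.+1); [|lia..].
have := step_shift S x g.
have : cnt S g.+1 y < cnt (step S) g.+1 y.+1.
  apply: step_free; rewrite -count_iota_cnt -has_count; apply/hasP.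
  by exists s => //; rewrite mem_index_iota gs.
lia.
Qed.

End Intervals.

(** * Boxes of exponent vectors *)

Fixpoint box (a : seq nat) d : seq (seq nat) :=
  if a is c :: a' then
    flatten [seq [seq k :: u | u <- box a' (d - k)] | k <- index_iota 0 (minn c d.+1)]
  else if d == 0 then [:: [::]] else [::].

Fixpoint cov (u v : seq nat) : bool :=
  match u, v with
  | k :: u', l :: v' => (l == k.+1) && (u' == v') || (k == l) && cov u' v'
  | _, _ => false
  end.

(* The tail of the exponent vector is compared first. *)
Fixpoint colt (u v : seq nat) : bool :=
  match u, v with
  | k :: u', l :: v' => colt u' v' || (u' == v') && (k < l)
  | _, _ => false
  end.

Definition cole u v := (u == v) || colt u v.

Lemma mem_box a d u : (u \in box a d) = all2 ltn u a && (sumn u == d).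
Proof.
elim: a d u => [|c a IHa] d [|k u] /=.
- by case: d.
- by case: d.
- by apply/negP => /flattenP[_ /mapP[k _ ->]] /mapP[].
apply/flattenP/idP => [[_ /mapP[k' k'cd ->]] /mapP[u' u'a [-> ->]]|].
  move: u'a k'cd; rewrite IHa mem_index_iota /= leq_min => /andP[-> /eqP ->].
  by move=> /andP[-> /=]; lia.
move=> /andP[/andP[kc ua] /eqP kud].
exists [seq k :: u | u <- box a (d - k)].
  by apply/mapP; exists k; rewrite // mem_index_iota leq_min kc; lia.
by apply/mapP; exists u; rewrite // IHa ua -kud addKn eqxx.
Qed.

Lemma box_sumn a d u : u \in box a d -> sumn u = d.
Proof. by rewrite mem_box => /andP[_ /eqP]. Qed.

Lemma box_ltn a d u : u \in box a d -> all2 ltn u a.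
Proof. by rewrite mem_box => /andP[]. Qed.

Lemma all2_size (u a : seq nat) : all2 ltn u a -> size u = size a.
Proof. by elim: u a => [|k u IHu] [|c a] //= /andP[_ /IHu ->]. Qed.

Lemma box_size a d u : u \in box a d -> size u = size a.
Proof. by move/box_ltn/all2_size. Qed.

Lemma all2_ltnP (u a : seq nat) :
  reflect (size u = size a /\ forall i, i < size a -> nth 0 u i < nth 0 a i)
          (all2 ltn u a).
Proof.
elim: u a => [|k u IHu] [|c a] /=; try by constructor=> // -[].
apply: (iffP andP) => [[kc /IHu[su ua]]|[[su] ua]].
  by split=> [|[|i] ia]; rewrite ?su //=; apply: ua.
split; first exact: (ua 0).
by apply/IHu; split=> // i ia; apply: (ua i.+1).
Qed.

Lemma uniq_box a d : uniq (box a d).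
Proof.
elim: a d => [|c a IHa] d /=; first by case: (d == 0).
rewrite -/(allpairs_dep _ _ _); apply: allpairs_uniq_dep => //.
  exact: iota_uniq.
by move=> [k u] [k' u'] _ _ /= [-> ->].
Qed.

Lemma sum_box_cons (F : seq nat -> nat) c a d :
  \sum_(z <- box (c :: a) d) F z =
  \sum_(0 <= k < minn c d.+1) \sum_(u <- box a (d - k)) F (k :: u).
Proof. by rewrite /= big_flatten big_map; apply: eq_bigr => k _; rewrite big_map. Qed.

Local Notation bcard a := (card (box a)).
Local Notation bshadow a := (shadow (box a) (fun=> cov)).
Local Notation bupset a := (upset (box a) cole).

Lemma card_sum a d A : bcard a d A = \sum_(z <- box a d) A z.
Proof. by rewrite /card -sum1_count big_mkcond. Qed.

Lemma card_cons c a d A :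
  bcard (c :: a) d A =
  \sum_(0 <= k < minn c d.+1) bcard a (d - k) (fun u => A (k :: u)).
Proof. by rewrite card_sum sum_box_cons; apply: eq_bigr => k _; rewrite card_sum. Qed.

Lemma colt_irr u : colt u u = false.
Proof. by elim: u => //= k u ->; rewrite ltnn andbF. Qed.

Lemma colt_trans : transitive colt.
Proof.
elim=> [|l v IHv] [|k u] [|m w] //=.
case/orP=> [uv|/andP[/eqP-> kl]] /orP[vw|/andP[/eqP vw lm]].
- by rewrite (IHv u w).
- by rewrite -vw uv.
- by rewrite vw.
- by rewrite vw eqxx (ltn_trans kl lm) orbT.
Qed.

Lemma colt_total u v : size u = size v -> u != v -> colt u v || colt v u.
Proof.
elim: u v => [|k u IHu] [|l v] //= [suv].
rewrite eqseq_cons negb_and; case: (eqVneq u v) => [-> | uv _] /=.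
  by rewrite orbF colt_irr ?eqxx /= neq_ltn.
by rewrite !orbF IHu.
Qed.

Lemma cole_trans : transitive cole.
Proof.
move=> v u w /orP[/eqP-> //|uv] /orP[/eqP<-|vw]; first by rewrite /cole uv orbT.
by rewrite /cole (colt_trans uv vw) orbT.
Qed.

Lemma coltW u v : colt u v -> cole u v.
Proof. by rewrite /cole => ->; rewrite orbT. Qed.

Lemma cole_cons k u l v : cole (k :: u) (l :: v) = colt u v || (u == v) && (k <= l).
Proof.
rewrite /cole eqseq_cons /= (leq_eqVlt k).
by case: (u == v); case: (k == l); case: (colt u v).
Qed.

Lemma cole_refl u : cole u u.
Proof. by rewrite /cole eqxx. Qed.

Lemma colt_asym u v : colt u v -> colt v u = false.
Proof. by move=> uv; apply/negP => /(colt_trans uv); rewrite colt_irr. Qed.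

Lemma box_order a d : level_order (box a) cole d.
Proof.
split.
- move=> u v ua va; rewrite /cole; have [->|uv] := eqVneq u v; first by [].
  by rewrite /= colt_total // (box_size ua) (box_size va).
- move=> u v _ _; rewrite /cole; have [-> //|uv] := eqVneq u v.
  by rewrite /= => /andP[/colt_asym ->].
- by move=> v u w _ _ _; apply: cole_trans.
Qed.

Lemma cov_incrP u v :
  reflect (exists2 i, i < size u & v = incr_nth u i) (cov u v).
Proof.
elim: u v => [|k u IHu] [|l v] /=; try by constructor=> -[] // [|i].
apply: (iffP orP) => [[/andP[/eqP-> /eqP->]|/andP[/eqP-> /IHu[i iu ->]]]|].
- by exists 0.
- by exists i.+1.
case=> -[|i] iu /= [-> ->]; first by left; rewrite !eqxx.
by right; rewrite eqxx /=; apply/IHu; exists i.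
Qed.

Lemma sumn_incr u i : sumn (incr_nth u i) = (sumn u).+1.
Proof.
elim: u i => [|k u IHu] [|i] //=; last by rewrite IHu addnS.
by elim: i => //= i ->.
Qed.

Lemma cov_sumn u v : cov u v -> sumn v = (sumn u).+1.
Proof. by case/cov_incrP=> i iu ->; rewrite sumn_incr. Qed.

Lemma cov_size u v : cov u v -> size v = size u.
Proof. by case/cov_incrP=> i iu ->; rewrite size_incr_nth iu. Qed.

Lemma cov_ltn u v a : cov u v -> all2 ltn v a -> all2 ltn u a.
Proof.
case/cov_incrP=> i iu -> /all2_ltnP[]; rewrite size_incr_nth iu => su ua.
apply/all2_ltnP; split=> // j ja; apply: leq_ltn_trans (ua j ja).
by rewrite nth_incr_nth leq_addl.
Qed.

Lemma cov_box u v a d : cov u v -> v \in box a d.+1 -> u \in box a d.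
Proof.
rewrite !mem_box => uv /andP[va]; rewrite (cov_sumn uv) eqSS => ->.
by rewrite (cov_ltn uv va).
Qed.

Lemma cov_colt u v : cov u v -> colt u v.
Proof.
elim: u v => [|k u IHu] [|l v] //= /orP[/andP[/eqP-> /eqP->]|].
  by rewrite eqxx ltnSn orbT.
by move=> /andP[_ /IHu ->].
Qed.

Lemma bshadowP a d (A : pred (seq nat)) v : v \in box a d.+1 ->
  reflect (exists2 u, A u & cov u v) (bshadow a d A v).
Proof.
move=> va; apply: (iffP (shadowP _ _ _ _ _)) => [[u [_ Au uv]]|[u Au uv]].
  by exists u.
by exists u; split=> //; apply: cov_box va.
Qed.

Lemma bshadow_cons c a d A l v : (l :: v) \in box (c :: a) d.+1 ->
  bshadow (c :: a) d A (l :: v) =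
  (0 < l) && A (l.-1 :: v) || (l <= d) && bshadow a (d - l) (fun u => A (l :: u)) v.
Proof.
move=> lv; have /= /andP[lc va] := box_ltn lv; have /= lvd := box_sumn lv.
apply/(bshadowP _ lv)/idP => [[[|k u] Aku //= /orP[/andP[/eqP lk /eqP uv]|]]|].
- by rewrite lk -uv Aku.
- case/andP=> /eqP kl uv; have svu := cov_sumn uv; subst l.
  have kd : k <= d by lia.
  have -> : bshadow a (d - k) (fun u => A (k :: u)) v.
    apply/bshadowP; last by exists u.
    by rewrite mem_box va; apply/eqP; lia.
  by rewrite kd orbT.
case/orP=> [/andP[]|/andP[ld]].
  by case: l {lv lc lvd} => // l _ Alv; exists (l :: v); rewrite //= !eqxx.
case/bshadowP => [|u Alu uv]; first by rewrite mem_box va; apply/eqP; lia.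
by exists (l :: u); rewrite //= eqxx uv orbT.
Qed.

(** * Two variables *)

Section Rectangle.
Variables (c b : nat).
Hypotheses (b_gt0 : 0 < b) (bc : b <= c).

(** Level [e] of the rectangle is parametrised by the exponent [s] of the second variable, the first
    being [e - s]; [lo e <= s < hi e] says that both stay below their caps. *)
Definition lo e := e.+1 - c.
Definition hi e := minn e.+1 b.
Definition rcard e (S : pred nat) := cnt S (lo e) (hi e).
(** [S] is cut down to level [e] first, since it is arbitrary outside and [step] could carry stray
    values into the next level. *)
Definition rshadow e (S : pred nat) : pred nat :=
  step (fun s => (lo e <= s < hi e) && S s).
Definition rtop e K : pred nat := fun s => hi e <= s + K.

(** The least size of a shadow of [K] elements. Towards degree [e.+1] the interval gains a place on
    the right as long as [e.+1 < b], and loses its left place once [c <= e.+1]; in that last range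
    only the full interval shrinks. *)
Definition rgrowth e K :=
  if K == 0 then 0 else if e.+1 < b then K.+1
  else if (e.+1 < c) || (K < hi e - lo e) then K else K.-1.

Lemma rcard_le e S : rcard e S <= hi e - lo e.
Proof. exact: cnt_size. Qed.

Lemma rgrowth_le e S : rgrowth e (rcard e S) <= rcard e.+1 (rshadow e S).
Proof.
have -> : rcard e S = rcard e (fun s => (lo e <= s < hi e) && S s).
  by apply: cnt_eq => s ->.
rewrite /rshadow; move: (fun s => _ && _) => {}S.
rewrite /rgrowth; case: eqP => // /eqP; rewrite -lt0n => K0.
case: ltnP => [eb|be].
  have -> : rcard e.+1 (step S) = cnt (step S) (lo e) (hi e).+1.
    by congr cnt; rewrite /lo /hi; lia.
  exact: step_free.
case: ltnP => [ec|ce] /=.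
  have -> : rcard e.+1 (step S) = cnt (step S) (lo e) (hi e).
    by congr cnt; rewrite /lo /hi; lia.
  exact: step_stay.
have -> : rcard e.+1 (step S) = cnt (step S) (lo e).+1 (hi e).
  by congr cnt; rewrite /lo /hi; lia.
case: ltnP => [Kw|_]; first exact: step_lossy.
by have := step_lossy_full S (lo e) (hi e); rewrite /rcard; lia.
Qed.

Lemma rcard_top e K : K <= hi e - lo e -> rcard e (rtop e K) = K.
Proof.
move=> Kw; rewrite /rcard (@cnt_eq _ (fun s => hi e - K <= s < hi e)).
  by rewrite cnt_itv; lia.
by move=> s; rewrite /rtop; lia.
Qed.

Lemma rshadow_top_mono e K s s' : lo e.+1 <= s -> s <= s' -> s' < hi e.+1 ->
  rshadow e (rtop e K) s -> rshadow e (rtop e K) s'.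
Proof. by rewrite /rshadow /step /rtop /lo /hi; lia. Qed.

Lemma rgrowth_top e K : K <= hi e - lo e ->
  rcard e.+1 (rshadow e (rtop e K)) = rgrowth e K.
Proof.
move=> Kw; rewrite /rgrowth; case: eqP => [->|/eqP]; last rewrite -lt0n => K0.
  rewrite /rcard (@cnt_eq _ (fun s => 0 <= s < 0)) ?cnt_itv; first by lia.
  by move=> s; rewrite /rshadow /step /rtop; lia.
rewrite /rcard (@cnt_eq _ (fun s => hi e - K <= s < (hi e).+1)) ?cnt_itv.
  move: Kw; rewrite /lo /hi; repeat case: ifP; lia.
by move=> s; rewrite /rshadow /step /rtop /lo /hi; move: Kw; rewrite /lo /hi; lia.
Qed.

End Rectangle.

(** * Fibres and compression *)

Section Fibres.
Variables (c : nat) (a : seq nat) (i : nat).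
Hypothesis ia : i < size a.
Let b := nth 0 a i.
Let a1 := set_nth 0 a i 1.

(** A fibre fixes all variables but the head and variable [i]: [x.1] is the joint degree of these
    two, [x.2] holds the other exponents with 0 in place [i] (hence the cap 1 in [a1]), and [s] is
    the exponent of variable [i]. *)
Definition fibre_point (x : nat * seq nat) s := (x.1 - s) :: set_nth 0 x.2 i s.

Definition fibres d : seq (nat * seq nat) :=
  [seq (e, w) | e <- iota 0 d.+1, w <- box a1 (d - e)].

Lemma size_a1 : size a1 = size a.
Proof. by rewrite size_set_nth; apply/maxn_idPr. Qed.

Lemma size_set w s : size w = size a -> size (set_nth 0 w i s) = size a.
Proof. by move=> sw; rewrite size_set_nth sw; apply/maxn_idPr. Qed.

Lemma all2_a1 w s : all2 ltn w a1 -> s < b -> all2 ltn (set_nth 0 w i s) a.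
Proof.
move=> /all2_ltnP[]; rewrite size_a1 => sw wa sb.
apply/all2_ltnP; split=> [|j ja]; first exact: size_set.
rewrite nth_set_nth /=; case: eqP => [-> //|/eqP/negPf ji].
by have := wa j ja; rewrite nth_set_nth /= ji.
Qed.

Lemma all2_a w : all2 ltn w a -> all2 ltn (set_nth 0 w i 0) a1.
Proof.
move=> /all2_ltnP[sw wa].
apply/all2_ltnP; split=> [|j ja]; first by rewrite size_set ?size_a1.
rewrite size_a1 in ja; rewrite !nth_set_nth /=; case: eqP => // _.
exact: wa.
Qed.

Lemma nth_a1 w : all2 ltn w a1 -> nth 0 w i = 0.
Proof.
move=> /all2_ltnP[_ /(_ i)]; rewrite size_a1 nth_set_nth /= eqxx => /(_ ia).
by case: (nth 0 w i).
Qed.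

Lemma set_a1 w : all2 ltn w a1 -> set_nth 0 w i 0 = w.
Proof.
move=> wa; have := all2_size wa; rewrite size_a1 => sw.
apply: (@eq_from_nth _ 0); first by rewrite size_set.
by move=> j _; rewrite nth_set_nth /=; case: eqP => // ->; rewrite nth_a1.
Qed.

Lemma sumn_a1 w s : all2 ltn w a1 -> sumn (set_nth 0 w i s) = sumn w + s.
Proof.
move=> wa; have := all2_size wa; rewrite size_a1 => sw.
by rewrite sumn_set_nth (nth_a1 wa) !mul0n subn0 addn0.
Qed.

Lemma mem_fibres (d : nat) (x : nat * seq nat) :
  (x \in fibres d) = [&& x.1 <= d, all2 ltn x.2 a1 & sumn x.2 == d - x.1].
Proof.
apply/allpairsPdep/and3P => [[e [w [ed wa ->]]]|[xd xa xs]].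
  by move: wa ed; rewrite mem_box mem_iota add0n ltnS => /andP[].
by exists x.1, x.2; rewrite mem_iota mem_box xa xs; case: x xd {xa xs}.
Qed.

Lemma pt_mem d (x : nat * seq nat) s : x \in fibres d -> lo c x.1 <= s < hi b x.1 ->
  fibre_point x s \in box (c :: a) d.
Proof.
rewrite mem_fibres mem_box /lo /hi => /and3P[xd xa /eqP xs] sx.
have sb : s < b by lia.
rewrite /= all2_a1 // sumn_a1 // xs andbT; apply/andP; split.
  by lia.
apply/eqP; lia.
Qed.

Lemma pt_onto d k w : k :: w \in box (c :: a) d ->
  let x := (k + nth 0 w i, set_nth 0 w i 0) in
  [/\ x \in fibres d, lo c x.1 <= nth 0 w i < hi b x.1 & k :: w = fibre_point x (nth 0 w i)].
Proof.
rewrite mem_box /= => /andP[/andP[kc wa] /eqP kwd].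
have /all2_ltnP[sw /(_ i ia) wib] := wa.
have ws : sumn (set_nth 0 w i 0) + nth 0 w i = sumn w.
  rewrite -(sumn_a1 _ (all2_a wa)) set_set_nth eqxx; congr sumn.
  apply: (@eq_from_nth _ 0); first by rewrite size_set.
  by move=> j _; rewrite nth_set_nth /=; case: eqP => // ->.
split.
- by rewrite mem_fibres /= all2_a //=; lia.
- by rewrite /= /lo /hi /b; lia.
rewrite /fibre_point /= addnK set_set_nth eqxx; congr (_ :: _).
apply: (@eq_from_nth _ 0); first by rewrite size_set.
by move=> j _; rewrite nth_set_nth /=; case: eqP => // ->.
Qed.

Lemma pt_inj d d' (x x' : nat * seq nat) s s' : x \in fibres d -> x' \in fibres d' ->
  s <= x.1 -> s' <= x'.1 -> fibre_point x s = fibre_point x' s' -> x = x' /\ s = s'.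
Proof.
rewrite !mem_fibres => /and3P[_ xa _] /and3P[_ xa' _] sx sx' [hd tl].
have ss' : s = s'.
  by move/(congr1 (nth 0 ^~ i)): tl; rewrite !nth_set_nth /= eqxx.
split=> //; move: hd; rewrite ss' => hd.
move/(congr1 (fun w => set_nth 0 w i 0)): tl.
have set2 w t : set_nth 0 (set_nth 0 w i t) i 0 = set_nth 0 w i 0.
  by rewrite set_set_nth eqxx.
rewrite /= !set2 !set_a1 //.
by case: x x' sx sx' hd {xa xa'} => [e w] [e' w'] /= sx sx' hd ->; congr pair; lia.
Qed.

Lemma perm_fibres (d : nat) : perm_eq (box (c :: a) d)
  [seq fibre_point x s | x <- fibres d, s <- index_iota (lo c x.1) (hi b x.1)].
Proof.
apply: uniq_perm; first exact: uniq_box.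
  apply: allpairs_uniq_dep => [|x _|].
  - apply: allpairs_uniq_dep => [|e _|]; rewrite ?iota_uniq ?uniq_box //.
    by move=> [e w] [e' w'] _ _ /= [-> ->].
  - exact: iota_uniq.
  move=> [x s] [x' s'] /allpairsPdep[y [t [yd yt [-> ->]]]].
  move=> /allpairsPdep[y' [t' [yd' yt' [-> ->]]]] /= pp.
  move: yt yt'; rewrite !mem_index_iota /hi => yt yt'.
  have ty : t <= y.1 by case/andP: yt => _; rewrite leq_min => /andP[].
  have ty' : t' <= y'.1 by case/andP: yt' => _; rewrite leq_min => /andP[].
  by have [-> ->] := pt_inj yd yd' ty ty' pp.
move=> z; apply/idP/allpairsPdep => [|[x [s [xd sx ->]]]]; last first.
  by apply: pt_mem; rewrite // -mem_index_iota.
case: z => [|k w kwd]; first by rewrite mem_box.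
have [xd xs E] := pt_onto kwd.
by exists (k + nth 0 w i, set_nth 0 w i 0), (nth 0 w i); rewrite mem_index_iota.
Qed.

Lemma sum_fibres d (F : seq nat -> nat) :
  \sum_(z <- box (c :: a) d) F z =
  \sum_(x <- fibres d) \sum_(lo c x.1 <= s < hi b x.1) F (fibre_point x s).
Proof. by rewrite (perm_big _ (perm_fibres d)) big_allpairs_dep. Qed.

Lemma card_fibres d A :
  bcard (c :: a) d A = \sum_(x <- fibres d) rcard c b x.1 (fun s => A (fibre_point x s)).
Proof. by rewrite card_sum sum_fibres. Qed.

End Fibres.

Section Compression.
Variables (c : nat) (a : seq nat) (i : nat).
Hypothesis ia : i < size a.
Let b := nth 0 a i.
Hypotheses (b_gt0 : 0 < b) (bc : b <= c).
Let a1 := set_nth 0 a i 1.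
Notation pt := (fibre_point i).
Notation fibres := (fibres a i).

Definition fibre_card (A : pred (seq nat)) (x : nat * seq nat) :=
  rcard c b x.1 (fun s => A (pt x s)).

(** Each fibre is pushed towards variable [i]: its elements are replaced by equally many with the
    largest exponents [s], that is, with the smallest heads. *)
Definition compress (A : pred (seq nat)) : pred (seq nat) := fun z =>
  if z is k :: w then
    rtop b (k + nth 0 w i) (fibre_card A (k + nth 0 w i, set_nth 0 w i 0)) (nth 0 w i)
  else false.

Lemma compress_pt (d : nat) A (x : nat * seq nat) s : x \in fibres d -> s <= x.1 ->
  compress A (pt x s) = rtop b x.1 (fibre_card A x) s.
Proof.
rewrite mem_fibres => /and3P[_ xa _] sx.
have -> : compress A (pt x s) =
  rtop b (x.1 - s + s) (fibre_card A (x.1 - s + s, set_nth 0 x.2 i 0)) s.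
  by rewrite /= nth_set_nth /= eqxx set_set_nth eqxx.
by rewrite subnK // (set_a1 ia) //; case: x {xa sx}.
Qed.

Lemma rcard_compress (d : nat) A (x : nat * seq nat) : x \in fibres d ->
  rcard c b x.1 (fun s => compress A (pt x s)) = fibre_card A x.
Proof.
move=> xd; rewrite -[RHS](rcard_top b_gt0 bc (rcard_le _ _ _ _)).
by apply: cnt_eq => s; rewrite /hi => sx; rewrite (compress_pt _ xd) //; lia.
Qed.

Lemma card_compress d A : bcard (c :: a) d (compress A) = bcard (c :: a) d A.
Proof.
rewrite !(card_fibres c ia) !big_seq; apply: eq_bigr => x xd.
exact: rcard_compress xd.
Qed.

Lemma set_nth_ext (w v : seq nat) s : size w = size v -> i < size w ->
  nth 0 v i = s -> (forall j, j != i -> nth 0 w j = nth 0 v j) ->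
  set_nth 0 w i s = v.
Proof.
move=> wv iw vs h; apply: (@eq_from_nth _ 0).
  by rewrite size_set_nth -wv; apply/maxn_idPr.
by move=> j _; rewrite nth_set_nth /=; case: eqP => [->|/eqP/h].
Qed.

(** Lowering one of the two moving variables leads to the fibre of joint degree one less with the
    same fixed exponents; lowering a fixed variable keeps both [s] and the joint degree. *)
Lemma shadow_pt (d : nat) A (x : nat * seq nat) s :
  x \in fibres d.+1 -> lo c x.1 <= s < hi b x.1 ->
  bshadow (c :: a) d A (pt x s) =
  (0 < x.1) && rshadow c b x.1.-1 (fun t => A (pt (x.1.-1, x.2) t)) s ||
  has (fun w => cov w x.2 && A (pt (x.1, w) s)) (box a1 (d - x.1)).
Proof.
move=> xd sx; have xbox := pt_mem ia xd sx.
move: xd sx; rewrite mem_fibres /lo /hi => /and3P[xd xa /eqP xs] sx.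
have sx2 : size x.2 = size a by rewrite (all2_size xa) size_a1.
have ix2 : i < size x.2 by rewrite sx2.
apply/(bshadowP _ xbox)/orP => [[[|k w] Aku //= /orP[/andP[/eqP xk /eqP wx]|]]|].
- left; have x0 : 0 < x.1 by lia.
  rewrite x0 /rshadow /step /lo /hi /=; apply/orP; left.
  have -> : pt (x.1.-1, x.2) s = k :: w by rewrite /fibre_point /= wx; congr (_ :: _); lia.
  by rewrite Aku andbT; lia.
- case/andP=> /eqP kx /cov_incrP[j jw wj].
  have sw : size w = size a.
    by move/(congr1 size): wj; rewrite (size_set ia) // size_incr_nth jw.
  have nthj t : nth 0 (set_nth 0 x.2 i s) t = (j == t) + nth 0 w t.
    by rewrite wj nth_incr_nth.
  have := nthj i; rewrite nth_set_nth /= eqxx.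
  have [ji|ji] := eqVneq j i => /= si.
    left; have x0 : 0 < x.1 by lia.
    rewrite x0 /rshadow /step /lo /hi /=; apply/orP; right.
    have -> : pt (x.1.-1, x.2) s.-1 = k :: w.
      rewrite /fibre_point /= kx; congr (_ :: _); first by lia.
      apply: set_nth_ext; rewrite ?sw //; first by lia.
      move=> t ti; have := nthj t; rewrite nth_set_nth /= (negPf ti) => ->.
      by rewrite ji eq_sym (negPf ti).
    by rewrite Aku andbT; lia.
  right; apply/hasP; pose w1 := set_nth 0 w i 0.
  have w1x : cov w1 x.2.
    apply/cov_incrP; exists j; first by rewrite (size_set ia) // -sw.
    apply: (@eq_from_nth _ 0); first by rewrite size_incr_nth (size_set ia) // -sw jw sw.
    move=> t _; rewrite nth_incr_nth nth_set_nth /=.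
    have [->|ti] := eqVneq t i; first by rewrite (negPf ji) (nth_a1 ia xa).
    by rewrite -nthj nth_set_nth /= (negPf ti).
  exists w1.
    by rewrite mem_box (cov_ltn w1x xa); have := cov_sumn w1x; lia.
  rewrite w1x /=; suff -> : pt (x.1, w1) s = k :: w by [].
  rewrite /fibre_point /= kx; congr (_ :: _); rewrite /w1 set_set_nth eqxx.
  by apply: set_nth_ext; rewrite ?sw.
case=> [/andP[x0 /orP[/andP[sx' As]|/andP[s0 /andP[sx' As]]]]|/hasP[w wa /andP[wx Aw]]].
- exists (pt (x.1.-1, x.2) s) => //=; move: sx'; rewrite /lo /hi => sx'.
  by apply/orP; left; rewrite eqxx andbT; lia.
- exists (pt (x.1.-1, x.2) s.-1) => //=; move: sx'; rewrite /lo /hi => sx'.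
  apply/orP; right; apply/andP; split; first by lia.
  apply/cov_incrP; exists i; first by rewrite (size_set ia).
  apply: set_nth_ext => //.
  + by rewrite size_incr_nth (size_set ia) // ia sx2.
  + by rewrite nth_incr_nth nth_set_nth /= !eqxx; lia.
  + move=> j ji; rewrite nth_incr_nth nth_set_nth /= (negPf ji).
    by rewrite eq_sym (negPf ji).
exists (pt (x.1, w) s) => //=; apply/orP; right; rewrite eqxx /=.
have wa1 := cov_ltn wx xa.
have sw : size w = size a by rewrite -sx2 (cov_size wx).
case/cov_incrP: wx => j jw xj; apply/cov_incrP; exists j; first by rewrite (size_set ia) // -sw.
have ji : j != i.
  apply: contra_eq_neq (nth_a1 ia xa) => ji.
  by rewrite xj nth_incr_nth ji eqxx.
apply: set_nth_ext => //.
- by rewrite size_incr_nth (size_set ia) // -sw jw sw.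
- by rewrite nth_incr_nth nth_set_nth /= eqxx (negPf ji).
move=> t ti; rewrite nth_incr_nth nth_set_nth /= (negPf ti).
by rewrite xj nth_incr_nth.
Qed.

(** On one fibre every contribution to the compressed shadow is a final interval, so the one
    reaching the least point [s0] contains the others. It alone is compared with the original
    shadow, either by the minimal growth of a rectangle or by its mere size. *)
Lemma rcard_shadow_compress (d : nat) A (x : nat * seq nat) : x \in fibres d.+1 ->
  rcard c b x.1 (fun s => bshadow (c :: a) d (compress A) (pt x s)) <=
  rcard c b x.1 (fun s => bshadow (c :: a) d A (pt x s)).
Proof.
move=> xd.
set Q : pred nat := fun s => bshadow _ _ (compress A) _.
set R : pred nat := fun s => bshadow _ _ A _.
case: (posnP (rcard c b x.1 Q)) => [-> //|/cnt_gt0[s sx Qs]].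
have exQ : exists s, (lo c x.1 <= s < hi b x.1) && Q s by exists s; rewrite sx.
case: (ex_minnP exQ) => s0 /andP[s0x Qs0] s0_min {s sx Qs exQ}.
have QE s : lo c x.1 <= s < hi b x.1 -> Q s -> s0 <= s.
  by move=> sx Qs; apply: s0_min; rewrite sx.
have RE s : lo c x.1 <= s < hi b x.1 -> R s = _ := @shadow_pt d A x s xd.
move: Qs0; rewrite /Q (shadow_pt _ xd s0x) => /orP[/andP[x0 Qs0]|].
  pose y := (x.1.-1, x.2).
  have yd : y \in fibres d.
    by move: xd; rewrite !mem_fibres /= => /and3P[xd -> /eqP->]; lia.
  have yE s : lo c y.1 <= s < hi b y.1 ->
    compress A (pt y s) = rtop b y.1 (fibre_card A y) s.
    by rewrite {1}/hi => sy; rewrite (compress_pt _ yd) //; lia.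
  have shE : rshadow c b y.1 (fun t => compress A (pt y t)) =1
             rshadow c b y.1 (rtop b y.1 (fibre_card A y)).
    move=> s; rewrite /rshadow /step; congr (_ || _).
      by apply: andb_id2l => /yE.
    by congr (_ && _); apply: andb_id2l => /yE.
  have xy : x.1 = y.1.+1 by rewrite prednK.
  rewrite shE in Qs0; 
  apply: (@leq_trans (rcard c b x.1 (rshadow c b y.1 (rtop b y.1 (fibre_card A y))))).
    apply: cnt_le => s sx Qs; move: (sx) (s0x); rewrite xy => sx' s0x'.
    apply: (rshadow_top_mono b_gt0 bc) Qs0; [by lia| |by lia].
    exact: QE.
  rewrite xy (rgrowth_top b_gt0 bc (rcard_le _ _ _ _)).
  apply: leq_trans (rgrowth_le b_gt0 bc _ _) _; rewrite -xy.
  by apply: cnt_le => s sx Rs; rewrite RE // x0 Rs.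
case/hasP => w wa /andP[wx Aw].
have yd : (x.1, w) \in fibres d.
  move: xd wa; rewrite !mem_fibres mem_box /= => /and3P[_ _ /eqP xs] /andP[-> ws].
  by rewrite ws andbT; have := cov_sumn wx; lia.
move: Aw; rewrite (compress_pt _ yd) /=; last by move: s0x; rewrite /hi; lia.
rewrite /rtop => hK; apply: (@leq_trans (fibre_card A (x.1, w))).
  apply: (@leq_trans (cnt (fun s => s0 <= s < hi b x.1) (lo c x.1) (hi b x.1))).
    by apply: cnt_le => s sx Qs; rewrite (QE s) //; case/andP: sx.
  by rewrite cnt_itv minnn leq_subLR; apply: leq_trans hK _; rewrite leq_add2r leq_maxl.
apply: cnt_le => s sx As; rewrite RE //; apply/orP; right.
by apply/hasP; exists w; rewrite // wx.
Qed.

Lemma card_shadow_compress (d : nat) A :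
  bcard (c :: a) d.+1 (bshadow (c :: a) d (compress A)) <=
  bcard (c :: a) d.+1 (bshadow (c :: a) d A).
Proof.
rewrite !(card_fibres c ia) !big_seq; apply: leq_sum => x.
exact: rcard_shadow_compress.
Qed.

End Compression.

Lemma ltn_sum_seq (I : eqType) (r : seq I) (F G : I -> nat) x :
  {in r, forall y, F y <= G y} -> x \in r -> F x < G x ->
  \sum_(y <- r) F y < \sum_(y <- r) G y.
Proof.
move=> FG xr Fx; rewrite !(big_rem x xr) /= -addSn leq_add // !big_seq.
by apply: leq_sum => y yr; apply/FG/(mem_rem yr).
Qed.

Lemma top_weight b e (S : pred nat) l (K := cnt S l (hi b e)) :
  let W (S' : pred nat) := \sum_(l <= s < hi b e) S' s * (e - s) in
  W (rtop b e K) <= W S /\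
  forall s, l <= s -> s.+1 < hi b e -> S s -> ~~ S s.+1 -> W (rtop b e K) < W S.
Proof.
move=> W; have Kh : K <= hi b e - l by apply: cnt_size.
have cT : cnt (rtop b e K) l (hi b e) = K.
  rewrite (@cnt_eq _ (fun s => hi b e - K <= s < hi b e)) ?cnt_itv; first by lia.
  by move=> s; rewrite /rtop; lia.
(* [t] is one more than the largest head exponent in the top set. As both sets have [K] elements,
   adding [t] for each element of the opposite set shifts both sums equally and makes the comparison
   pointwise. *)
pose t := e.+1 - hi b e + K.
have sumE (S' S'' : pred nat) : cnt S'' l (hi b e) = K ->
  \sum_(l <= s < hi b e) (S' s * (e - s) + S'' s * t) = W S' + K * t.
  by move=> cS; rewrite big_split /= -big_distrl /= -/(cnt _ _ _) cS.
have le_pt s : s \in index_iota l (hi b e) ->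
  rtop b e K s * (e - s) + S s * t <= S s * (e - s) + rtop b e K s * t.
  rewrite mem_index_iota /rtop /t => sh; have he : hi b e <= e.+1 by rewrite geq_minl.
  by case: (S s); case: leqP => /=; lia.
split.
  rewrite -(leq_add2r (K * t)) -(sumE _ S) // -(sumE _ (rtop b e K)) //.
  by rewrite !big_seq; apply: leq_sum.
move=> s ls sh Ss nSs.
(* A top element missing from [S] makes one pointwise inequality strict. If [s.+1] is not one, then
   [s] lies outside the top set, and equal cardinalities provide another. *)
have [u [lu uh Tu nSu]] : exists u, [/\ l <= u, u < hi b e, rtop b e K u & ~~ S u].
  case Ts: (rtop b e K s.+1); first by exists s.+1; split=> //; lia.
  have : cnt (predD S (rtop b e K)) l (hi b e) + cnt (predI S (rtop b e K)) l (hi b e) = K.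
    rewrite /cnt -big_split /=; apply: eq_bigr => i _ /=.
    by case: (S i); case: (rtop b e K i).
  have : cnt (predD (rtop b e K) S) l (hi b e) + cnt (predI S (rtop b e K)) l (hi b e) = K.
    rewrite -[RHS]cT /cnt -big_split /=; apply: eq_bigr => i _ /=.
    by case: (S i); case: (rtop b e K i).
  have : 0 < cnt (predD S (rtop b e K)) l (hi b e).
    rewrite -count_iota_cnt -has_count; apply/hasP; exists s.
      by rewrite mem_index_iota; lia.
    by rewrite /= Ss andbT; move: Ts; rewrite /rtop; lia.
  move=> D0 D1 D2; have /cnt_gt0[u ulh /= /andP[nSu Tu]] :
      0 < cnt (predD (rtop b e K) S) l (hi b e) by lia.
  by exists u; split=> //; case/andP: ulh.
rewrite -(ltn_add2r (K * t)) -(sumE _ S) // -(sumE _ (rtop b e K)) //.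
apply: (@ltn_sum_seq _ _ _ _ u) => //; first by rewrite mem_index_iota lu.
rewrite Tu (negPf nSu) /= /t; move: Tu; rewrite /rtop.
by have : hi b e <= e.+1 by [rewrite geq_minl]; lia.
Qed.

(** The analogue of a strongly stable ideal: trading one unit of the head for one unit of any other
    variable, inside the box, does not leave [A]. *)
Definition tail_stable c a d (A : pred (seq nat)) :=
  all (fun z => if z is k.+1 :: u
    then A z ==> all (fun v => cov u v ==> A (k :: v)) (box a (d - k)) else true)
    (box (c :: a) d).

Definition head_sum c a d (A : pred (seq nat)) := \sum_(z <- box (c :: a) d) A z * head 0 z.

(* Among the sets with a given cardinality and a shadow as small as possible,
   one minimising the total exponent of the head variable is stable. *)
Lemma exists_tail_stable c a d (A : pred (seq nat)) :
  all (fun b => 0 < b <= c) a ->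
  exists A', [/\ tail_stable c a d A', bcard (c :: a) d A' = bcard (c :: a) d A &
    bcard (c :: a) d.+1 (bshadow (c :: a) d A') <=
    bcard (c :: a) d.+1 (bshadow (c :: a) d A)].
Proof.
move=> /allP ac; have [n] := ubnP (head_sum c a d A).
elim: n A => // n IHn A; rewrite ltnS => hA.
have [stA|] := boolP (tail_stable c a d A); first by exists A.
case/allPn => -[|[|k] u] // kud; rewrite negb_imply => /andP[Aku /allPn[v vd]].
rewrite negb_imply => /andP[/cov_incrP[i iu vE] nAkv].
have su : size u = size a by have := box_size kud; case.
have ia : i < size a by rewrite -su.
have /andP[b0 bc] := ac _ (mem_nth 0 ia).
have [|A' [stA' cA' sA']] := IHn (compress c a i A); last first.
- exists A'; split=> //; first by rewrite cA' card_compress.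
  by apply: leq_trans sA' _; apply: card_shadow_compress.
(* A failure of stability along variable [i] is an [s] in some fibre of [A] whose successor is
   missing, so by [top_weight] the compression strictly lowers the total head exponent. *)
apply: leq_trans hA; rewrite /head_sum !(sum_fibres c ia).
pose x := (k.+1 + nth 0 u i, set_nth 0 u i 0).
have [xd xs zx] := pt_onto ia kud; rewrite -/x in xd xs zx.
have wE (y : nat * seq nat) : y \in fibres a i d ->
  \sum_(lo c y.1 <= s < hi (nth 0 a i) y.1) 
    compress c a i A (fibre_point i y s) * head 0 (fibre_point i y s)
  = \sum_(lo c y.1 <= s < hi (nth 0 a i) y.1) 
    rtop (nth 0 a i) y.1 (fibre_card c a i A y) s * (y.1 - s).
  move=> yd; rewrite !big_nat; apply: eq_bigr => s sy.
  by rewrite (compress_pt _ ia _ yd) //; move: sy; rewrite /hi; lia.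
apply: (@ltn_sum_seq _ _ _ _ x) => // [y yd|]; rewrite wE //.
  by have [] := top_weight (nth 0 a i) y.1 (fun s => A (fibre_point i y s)) (lo c y.1).
have [_ /(_ (nth 0 u i))] := top_weight (nth 0 a i) x.1 (fun s => A (fibre_point i x s)) (lo c x.1).
rewrite -zx; apply => //; last 1 first.
- apply: contra nAkv; congr A; rewrite /fibre_point vE; congr (_ :: _); first by rewrite /=; lia.
  rewrite set_set_nth eqxx; apply: set_nth_ext => //.
  + by rewrite size_incr_nth iu.
  + by rewrite nth_incr_nth eqxx.
  + by move=> j ji; rewrite nth_incr_nth eq_sym (negPf ji).
- by case/andP: xs.
have vb : nth 0 v i < nth 0 a i by have /all2_ltnP[_] := box_ltn vd; apply.
by move: vb; rewrite vE nth_incr_nth eqxx /hi /=; lia.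
Qed.

(** * The Clements-Lindstrom theorem *)

Definition Clements_Lindstrom a := forall d U, bupset a d U ->
  bupset a d.+1 (bshadow a d U) /\
  forall A, bcard a d A = bcard a d U ->
    bcard a d.+1 (bshadow a d U) <= bcard a d.+1 (bshadow a d A).

Lemma bupset_slice c a d U k : bupset (c :: a) d U -> k < minn c d.+1 ->
  bupset a (d - k) (fun u => U (k :: u)).
Proof.
rewrite leq_min ltnS => upU /andP[kc kd] u v ua va Uku /orP[/eqP<-//|uv].
have mem_k w : w \in box a (d - k) -> k :: w \in box (c :: a) d.
  by rewrite !mem_box /= kc => /andP[-> /eqP->]; rewrite subnKC ?eqxx.
by apply: (upU _ _ _ _ Uku); rewrite ?mem_k //; apply: coltW; rewrite /= uv.
Qed.

Lemma bupset_tail_stable c a d U : bupset (c :: a) d U -> tail_stable c a d U.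
Proof.
move=> upU; apply/allP=> -[|[|k] u] // kud; apply/implyP => Uku.
apply/allP => v vd; apply/implyP => uv; apply: upU Uku _ => //.
  move: vd kud; rewrite !mem_box /= => /andP[-> /eqP->] /andP[/andP[kc _] /eqP].
  by rewrite (ltnW kc) /=; lia.
by apply: coltW; rewrite /= (cov_colt uv).
Qed.

(** Raising a tail variable over a positive head gives, by stability, something also obtained by
    raising the head. So the slice of the shadow over head [k.+1] is the slice of [A] over [k], and
    only head 0 requires a shadow in fewer variables. *)
Lemma card_shadow_tail_stable c a d A : 0 < c -> tail_stable c a d A ->
  bcard (c :: a) d.+1 (bshadow (c :: a) d A) =
  bcard a d.+1 (bshadow a d (fun u => A (0 :: u))) +
  \sum_(0 <= k < minn c.-1 d.+1) bcard a (d - k) (fun u => A (k :: u)).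
Proof.
move=> c0 stA; rewrite card_cons big_ltn; last by rewrite leq_min c0.
congr (_ + _).
  rewrite subn0; apply: eq_card => v vd; rewrite bshadow_cons ?subn0 //.
  by move: vd; rewrite !mem_box /= c0.
have -> : minn c d.+2 = (minn c.-1 d.+1).+1 by lia.
rewrite big_add1 /= !big_nat; apply: eq_bigr => k /andP[_]; rewrite leq_min => /andP[kc kd].
rewrite subSS; apply: eq_card => v vd.
have kv : k.+1 :: v \in box (c :: a) d.+1.
  by move: vd; rewrite !mem_box /= => /andP[-> /eqP->]; lia.
rewrite bshadow_cons //=; case Akv: (A (k :: v)) => //=; apply/negbTE.
apply/negP => /andP[kd' /bshadowP[|u Aku uv]].
  by move: vd; rewrite !mem_box => /andP[-> /eqP->]; apply/eqP; lia.
have kud : k.+1 :: u \in box (c :: a) d.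
  have := cov_ltn uv (box_ltn vd); have := cov_sumn uv; rewrite (box_sumn vd).
  by rewrite mem_box /= => ? ->; lia.
have := allP stA _ kud; rewrite /= Aku => /allP/(_ v vd).
by rewrite uv Akv.
Qed.

(** Slices over different heads live in different degrees. This and [colt_pred] let one walk from
    one degree to another without crossing a given vector in the order. *)
Lemma colt_fill a u u' : all2 ltn u a -> all2 ltn u' a -> colt u u' ->
  sumn u < sumn u' -> exists z, [/\ cov u z, all2 ltn z a & cole z u'].
Proof.
elim: a u u' => [|c a IHa] [|k u] [|k' u'] //= /andP[kc ua] /andP[kc' ua'].
case/orP=> [uu'|/andP[/eqP<- kk'] _]; last first.
  exists (k.+1 :: u); rewrite /= !eqxx ua (leq_trans _ kc') //; split=> //.
  by rewrite cole_cons eqxx kk' orbT.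
move=> suu'; case: (ltnP k.+1 c) => [kc1|ck].
  exists (k.+1 :: u); rewrite /= !eqxx ua kc1; split=> //.
  by apply: coltW; rewrite /= uu'.
have [|z [uz za /orP[/eqP zu'|zu']]] := IHa u u' ua ua' uu'; first by lia.
  exists (k :: z); rewrite /= eqxx uz za kc orbT; split=> //.
  have := cov_sumn uz; rewrite zu' => su'.
  by rewrite cole_cons eqxx; apply/orP; right; lia.
exists (k :: z); rewrite /= eqxx uz za kc orbT; split=> //.
by apply: coltW; rewrite /= zu'.
Qed.

(** Dual to [colt_fill]: the larger vector is lowered. It serves to pass from a positive head to
    head 0 in the shadow of a segment. *)
Lemma colt_pred w1 w2 : colt w1 w2 -> sumn w1 < sumn w2 ->
  exists2 z, cov z w2 & cole w1 z.
Proof.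
elim: w1 w2 => [|k1 u1 IHu] [|k2 u2] //= /orP[u12|/andP[/eqP<- k12] _]; last first.
  case: k2 k12 => // k2 k12; exists (k2 :: u1); first by rewrite /= !eqxx.
  by rewrite cole_cons eqxx -ltnS k12 orbT.
case: k2 => [|k2] s12; last first.
  by exists (k2 :: u2); rewrite /= ?eqxx //; apply: coltW; rewrite /= u12.
have [|z zu /orP[/eqP u1z|u1z]] := IHu u2 u12; first by lia.
  exists (0 :: z); rewrite /= ?zu //; suff -> : k1 = 0 by rewrite u1z cole_refl.
  by have := cov_sumn zu; rewrite -u1z; lia.
by exists (0 :: z); rewrite /= ?zu //; apply: coltW; rewrite /= u1z.
Qed.

Lemma ltn_sum_exists (x y : nat) (F G : nat -> nat) :
  \sum_(x <= k < y) F k < \sum_(x <= k < y) G k -> exists2 k, x <= k < y & F k < G k.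
Proof.
move=> FG; have /hasP[k] : has (fun k => F k < G k) (index_iota x y).
  apply: contraTT FG => /hasPn h; rewrite -leqNgt !big_seq.
  by apply: leq_sum => k /h; rewrite -leqNgt.
by rewrite mem_index_iota; exists k.
Qed.

Section InductionStep.
Variables (c : nat) (a : seq nat).
Hypotheses (c0 : 0 < c) (ac : all (fun b => 0 < b <= c) a).
Hypothesis CLa : Clements_Lindstrom a.

Lemma bupset_head d U : bupset (c :: a) d U -> bupset a d (fun u => U (0 :: u)).
Proof.
by move=> upU; rewrite -{1}[d]subn0; apply: bupset_slice upU _; rewrite leq_min c0.
Qed.

Lemma bupset_shadow_cons d U : bupset (c :: a) d U ->
  bupset (c :: a) d.+1 (bshadow (c :: a) d U).
Proof.
move=> upU x y xd yd; have /allP stU := bupset_tail_stable upU.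
move=> Ux /orP[/eqP<-//|xy]; move: Ux.
case: x y xd yd xy => [|l1 w1] [|l2 w2]; rewrite ?mem_box //.
rewrite -!mem_box => xd yd; have sx := box_sumn xd; have sy := box_sumn yd.
have w12 : colt (l1 :: w1) (l2 :: w2) -> colt w1 w2.
  by case/orP=> // /andP[/eqP w12 l12]; move: sx sy => /=; rewrite w12; lia.
move=> /w12 {}w12.
have /= /andP[l1c w1a] := box_ltn xd; have /= /andP[l2c w2a] := box_ltn yd.
(* Segments are stable, so a shadow element with positive head already comes from lowering its
   head. *)
have U_pred l w : l.+1 :: w \in box (c :: a) d.+1 ->
    bshadow (c :: a) d U (l.+1 :: w) = U (l :: w).
  move=> lw; have lw' : all2 ltn w a && (sumn w == d - l).
    by move: lw; rewrite mem_box /= => /andP[/andP[_ ->] /=]; lia.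
  rewrite bshadow_cons //=; case Ulw: (U (l :: w)) => //=; apply/negbTE/negP.
  case/andP=> ld /bshadowP[|u Ulu uw].
    by rewrite mem_box; case/andP: lw' => ->; lia.
  have lu : l.+1 :: u \in box (c :: a) d.
    have su := cov_sumn uw; move: lw; rewrite !mem_box /= su => /andP[/andP[-> h]].
    by rewrite (cov_ltn uw h); lia.
  by have := stU _ lu; rewrite /= Ulu => /allP/(_ w); rewrite mem_box lw' Ulw uw => /(_ isT).
have mem_pred l w : l.+1 :: w \in box (c :: a) d.+1 -> l :: w \in box (c :: a) d.
  by rewrite !mem_box /= => /andP[/andP[/ltnW -> ->]]; lia.
have zmem z w : cov z w -> 0 :: w \in box (c :: a) d.+1 -> 0 :: z \in box (c :: a) d.
  by move=> zw; apply: cov_box; rewrite /= zw.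
case: l1 l2 xd yd sx sy l1c l2c => [|l1] [|l2] xd yd sx sy l1c l2c.
- rewrite !bshadow_cons //= subn0 => Ux.
  have [upS _] := CLa (bupset_head upU); apply: upS Ux (coltW w12).
    by rewrite mem_box w1a -sx /= eqxx.
  by rewrite mem_box w2a -sy /= eqxx.
- rewrite U_pred // bshadow_cons //= subn0 => /bshadowP[|z Uz zw].
    by rewrite mem_box w1a -sx eqxx.
  apply: (upU _ _ _ _ Uz); [exact: zmem xd|exact: mem_pred|].
  by apply: coltW => /=; rewrite (colt_trans (cov_colt zw) w12).
- rewrite U_pred // bshadow_cons //= subn0 => Ulw.
  have [|z zw w1z] := colt_pred w12; first by move: sx sy => /=; lia.
  apply/bshadowP; first by rewrite mem_box w2a -sy /= eqxx.
  exists z => //; apply: (upU _ _ _ _ Ulw); [exact: mem_pred|exact: zmem yd|].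
  case/orP: w1z => [/eqP w1z|w1z]; last by apply: coltW; rewrite /= w1z.
  have := cov_sumn zw; rewrite -w1z; move: sx sy => /= sx sy sz.
  by have -> : l1 = 0; [lia | apply: cole_refl].
rewrite !U_pred // => Ulw; apply: (upU _ _ _ _ Ulw); [exact: mem_pred..|].
by apply: coltW; rewrite /= w12.
Qed.

(** After reduction to a stable [A], its slices are compared with segments [B k] of the same sizes,
    which the induction hypothesis makes compatible from one head to the next. It follows that the
    partial sums of the slice sizes of [U] never exceed those of [A], and by
    [card_shadow_tail_stable] a shadow is measured by such a sum and by slice 0. *)
Lemma card_shadow_cons d U A : bupset (c :: a) d U ->
  bcard (c :: a) d A = bcard (c :: a) d U ->
  bcard (c :: a) d.+1 (bshadow (c :: a) d U) <=
  bcard (c :: a) d.+1 (bshadow (c :: a) d A).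
Proof.
move=> upU; have [A' [stA' <- sA']] := exists_tail_stable d A ac.
move=> AU; apply: leq_trans sA'; move: A' stA' AU => {}A stA AU.
rewrite !card_shadow_tail_stable //; last exact: bupset_tail_stable.
pose Ak k := bcard a (d - k) (fun u => A (k :: u)).
pose Uk k := bcard a (d - k) (fun u => U (k :: u)).
pose B k u := rank (box a) cole (d - k) u < Ak k.
have segB k := rank_seg (box_order a (d - k)) (uniq_box _ _)
  (card_le_size _ _ (fun u => A (k :: u))).
(* Stability puts the shadow of slice [k.+1] inside slice [k]; the shadow of [B k.+1] is no larger,
   and two segments of one level are nested by size. *)
have B_shadow k u : k.+1 < minn c d.+1 -> u \in box a (d - k) ->
    bshadow a (d - k.+1) (B k.+1) u -> B k u.
  rewrite leq_min ltnS => /andP[kc kd] ud; have [upBk cBk] := segB k.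
  have [upBk1 cBk1] := segB k.+1; have dk : (d - k.+1).+1 = d - k by lia.
  have [upS /(_ _ (esym cBk1)) cS] := CLa upBk1; rewrite dk in upS cS.
  move: u ud; apply: (upset_nested (box_order a _) upS upBk).
  apply: leq_trans cS _; rewrite cBk; apply: sub_card => v vd.
  case/bshadowP=> [|u Au uv]; first by rewrite dk.
  have ku : k.+1 :: u \in box (c :: a) d.
    have := cov_sumn uv; have := cov_ltn uv (box_ltn vd); rewrite (box_sumn vd) mem_box /=.
    by move=> -> su; lia.
  by have := allP stA _ ku; rewrite /= Au => /allP/(_ v vd); rewrite uv.
(* The climb from degree [d - (k + t)] to [d - k] goes one unit at a time, staying at or below [u']
   by [colt_fill]. *)
have B_chain t k u u' : k + t < minn c d.+1 -> u \in box a (d - (k + t)) ->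
    u' \in box a (d - k) -> B (k + t) u -> cole u u' -> B k u'.
  elim: t k u u' => [|t IHt] k u u'; rewrite ?addn0 ?addnS => ktc ud ud' Bu uu'.
    by have [upB _] := segB k; apply: (upB _ _ ud ud' Bu) uu'.
  have ktcd : k + t < c /\ k + t < d by lia.
  have su := box_sumn ud; have su' := box_sumn ud'.
  case/orP: uu' => [/eqP uu'|uu']; first by move: su'; rewrite -uu'; lia.
  have [|z [uz za zu']] := colt_fill (box_ltn ud) (box_ltn ud') uu'; first by lia.
  have zd : z \in box a (d - (k + t)) by rewrite mem_box za (cov_sumn uz); lia.
  apply: (IHt k z) => //; first by lia.
  apply: B_shadow => //; apply/bshadowP; last by exists u.
  by rewrite mem_box za (cov_sumn uz); lia.
(* Otherwise [U] is too large in an early slice [k'] and too small in a late slice [k]. An element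
   of [B k] outside [U] and one of [U] outside [B k'] then contradict each other, whichever is
   larger. *)
have key j : j <= minn c d.+1 -> \sum_(0 <= k < j) Uk k <= \sum_(0 <= k < j) Ak k.
  move=> jm; rewrite leqNgt; apply/negP => lt_j.
  have [k' k'j lt_k'] := ltn_sum_exists lt_j.
  have [k kj lt_k] : exists2 k, j <= k < minn c d.+1 & Uk k < Ak k.
    have AkUk : \sum_(0 <= k < minn c d.+1) Ak k = \sum_(0 <= k < minn c d.+1) Uk k.
      by rewrite -!card_cons.
    move: AkUk; rewrite !(big_cat_nat (leq0n j) jm) /= => AkUk.
    by apply: ltn_sum_exists; lia.
  have [upBk cBk] := segB k; have [upBk' cBk'] := segB k'.
  have upUk : bupset a (d - k) (fun u => U (k :: u)) by apply: bupset_slice upU _; lia.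
  have upUk' : bupset a (d - k') (fun u => U (k' :: u)) by apply: bupset_slice upU _; lia.
  have [u [ud Bu nUu]] : exists u, [/\ u \in box a (d - k), B k u & ~~ U (k :: u)].
    by apply: card_lt_exists; rewrite cBk.
  have [u' [ud' Uu' nBu']] : exists u, [/\ u \in box a (d - k'), U (k' :: u) & ~~ B k' u].
    by apply: card_lt_exists; rewrite cBk'.
  have kc : k < c /\ k <= d by lia.
  have su := box_sumn ud; have su' := box_sumn ud'.
  have kud : k :: u \in box (c :: a) d.
    by move: ud; rewrite !mem_box /= => /andP[-> _]; lia.
  have kud' : k' :: u' \in box (c :: a) d.
    by move: ud'; rewrite !mem_box /= => /andP[-> _]; lia.
  have [tot _ _] := box_order (c :: a) d.
  have /orP[le1|le2] := tot _ _ kud kud'; last by rewrite (upU _ _ kud' kud Uu' le2) in nUu.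
  case/negP: nBu'; have kE : k' + (k - k') = k by lia.
  apply: (B_chain (k - k') k' u u'); rewrite ?kE //; first by lia.
  apply: coltW; case/orP: le1 => [/eqP[kk' _]|/orP[//|/andP[/eqP uu' _]]]; first by lia.
  by move: su'; rewrite -uu' su; lia.
apply: leq_add; last by apply: key; lia.
have upU0 := bupset_head upU.
have [upB0 cB0] := segB 0; rewrite subn0 in upB0 cB0.
have [upS /(_ _ (esym cB0)) cS] := CLa upB0; apply: leq_trans cS.
apply: sub_card => v vd; apply: sub_shadow.
apply: (upset_nested (box_order a d) upU0 upB0); rewrite cB0.
by have := key 1; rewrite !big_nat1 /Uk /Ak subn0; apply; lia.
Qed.

End InductionStep.

(* The caps decrease, so that the tail of the list, which is compared first,
   holds the smallest ones. *)
Theorem Clements_Lindstrom_sorted a : all (leq 1) a -> sorted geq a ->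
  Clements_Lindstrom a.
Proof.
elim: a => [|c a IHa] /=.
  move=> _ _ d U _; split; first by move=> x; rewrite mem_box; case: x.
  by move=> A _; rewrite /card.
move=> /andP[c0 a0] ca; have sa := path_sorted ca.
have ac : all (fun b => 0 < b <= c) a.
  have geq_trans : transitive geq by move=> x y z xy yz; apply: leq_trans yz xy.
  apply/allP => b ba; rewrite (allP a0) //=.
  exact: (allP (order_path_min geq_trans ca)).
move=> d U upU; split; first exact: bupset_shadow_cons (IHa a0 sa) _ _ upU.
by move=> A; apply: card_shadow_cons (IHa a0 sa) _ _ _ upU.
Qed.

(** * Wedges and connected sums of boxes *)

Lemma exists_cov v : 0 < sumn v -> exists u, cov u v.
Proof.
elim: v => [|[|l] v IHv] //=; last by exists (l :: v); rewrite /= !eqxx.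
by rewrite add0n => /IHv[u uv]; exists (0 :: u); rewrite /= uv.
Qed.

Lemma bshadow_full a d (A : pred (seq nat)) : {in box a d, forall u, A u} ->
  {in box a d.+1, forall v, bshadow a d A v}.
Proof.
move=> Aall v vd; apply/bshadowP => //.
have [|u uv] := @exists_cov v; first by rewrite (box_sumn vd).
by exists u; first exact: Aall (cov_box uv vd).
Qed.

Section Wedge.
Variables (ab : bool -> seq nat) (glued : bool) (N : nat).

(* The pair [(true, [::])] is the monomial 1, common to both boxes; when the two
   top monomials, of degree [N], are identified, [(false, [::])] is their class. *)
Definition wlev d : seq (bool * seq nat) :=
  if d == 0 then [:: (true, [::])]
  else if glued && (N <= d) then (if d == N then [:: (false, [::])] else [::])
  else [seq (true, u) | u <- box (ab true) d] ++
       [seq (false, u) | u <- box (ab false) d].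

Definition wcov d (x y : bool * seq nat) :=
  [|| d == 0, glued && (d.+1 == N) | (x.1 == y.1) && cov x.2 y.2].

Notation wcard := (card wlev).
Notation wshadow := (shadow wlev wcov).

(** The degrees in which the level is the disjoint union of two box levels: above the common unit
    and below a glued top. *)
Definition regular d := (0 < d) && ~~ (glued && (N <= d)).

Lemma regularW d : regular d.+1 -> 0 < d -> regular d.
Proof. by rewrite /regular => + ->; case: glued => //=; lia. Qed.

Lemma wlevE d : regular d -> wlev d =
  [seq (true, u) | u <- box (ab true) d] ++ [seq (false, u) | u <- box (ab false) d].
Proof. by rewrite /wlev /regular; case: d => // d /= /negPf ->. Qed.

Lemma mem_wlev d s u : regular d -> ((s, u) \in wlev d) = (u \in box (ab s) d).
Proof.
move=> rd; rewrite wlevE // mem_cat.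
apply/orP/idP => [[/mapP[v vd [-> ->]]|/mapP[v vd [-> ->]]] //|ud].
by case: s ud => ud; [left|right]; apply/mapP; exists u.
Qed.

Lemma uniq_wlev d : uniq (wlev d).
Proof.
rewrite /wlev; do 2 case: ifP => // _; first by case: ifP.
have inj s : injective (pair s : seq nat -> bool * seq nat) by move=> u v [].
rewrite cat_uniq !(map_inj_uniq (inj _)) !uniq_box /= andbT.
by apply/hasPn => _ /mapP[u _ ->]; apply/mapP => -[].
Qed.

Lemma wcardE d A s : regular d ->
  wcard d A = bcard (ab s) d (fun u => A (s, u)) +
              bcard (ab (~~ s)) d (fun u => A (~~ s, u)).
Proof.
move=> rd; rewrite /card wlevE // count_cat !count_map.
by case: s; rewrite /= 1?addnC.
Qed.

Lemma wshadowE d A s v : regular d.+1 -> 0 < d -> v \in box (ab s) d.+1 ->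
  wshadow d A (s, v) = bshadow (ab s) d (fun u => A (s, u)) v.
Proof.
move=> rd d0 vd; have rd' := regularW rd d0.
have wE x y : wcov d x y = (x.1 == y.1) && cov x.2 y.2.
  rewrite /wcov -[d == 0]negbK -lt0n d0 /=; move: rd; rewrite /regular /=.
  by case: glued => //=; rewrite -ltnNge => dN; rewrite ltn_eqF // ltnW.
apply/shadowP/bshadowP => // [[[s' u] [ud Au]]|[u Au uv]].
  by rewrite wE /= => /andP[/eqP<- uv]; exists u.
by exists (s, u); rewrite mem_wlev // wE eqxx uv (cov_box uv vd).
Qed.

(** Just above the unit and just below the glued top every element is covered by every element of
    the next level, so a shadow only records whether the set is empty. *)
Lemma wshadow_complete d A y : (d == 0) || glued && (d.+1 == N) ->
  wshadow d A y = (0 < wcard d A).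
Proof.
move=> dN; apply/shadowP/card_gt0 => [[x [xd Ax _]]|[x xd Ax]]; exists x => //.
by split=> //; rewrite /wcov orbA dN.
Qed.

Variable first : bool.

Definition wle (x y : bool * seq nat) :=
  if x.1 == y.1 then cole x.2 y.2 else y.1 == first.

Lemma wle_order d : level_order wlev wle d.
Proof.
have [rd|nrd] := boolP (regular d); last first.
  have sub1 x y : x \in wlev d -> y \in wlev d -> x = y.
    move: nrd; rewrite /regular /wlev; case: d => [|d] /=; first by rewrite !inE => _ /eqP-> /eqP->.
    by rewrite negbK => ->; case: eqP => // _; rewrite !inE => /eqP-> /eqP->.
  have wlexx x : wle x x by rewrite /wle eqxx cole_refl.
  split=> [x y xd yd|x y xd yd _|y x z yd xd zd _ _].
  - by rewrite (sub1 x y) // wlexx.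
  - exact: sub1.
  - by rewrite (sub1 x z) ?wlexx.
split.
- move=> [s u] [t v]; rewrite !mem_wlev // /wle /= [t == s]eq_sym => ud vd.
  case: eqP => [st|{ud vd}]; last by case: s t first => [] [] [].
  by subst t; have [tot _ _] := box_order (ab s) d; apply: tot.
- move=> [s u] [t v]; rewrite !mem_wlev // /wle /= [t == s]eq_sym => ud vd.
  case: eqP => [st|{ud vd}]; last by case: s t first => [] [] [].
  by subst t; have [_ anti _] := box_order (ab s) d; move=> /anti ->.
- move=> [t v] [s u] [r w] _ _ _; rewrite /wle /=.
  case: s t r first => [] [] [] [] //=; exact: cole_trans.
Qed.

Lemma wupset_slice d U s : regular d -> upset wlev wle d U ->
  bupset (ab s) d (fun u => U (s, u)).
Proof.
move=> rd upU u v ud vd Usu uv.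
by apply: (upU (s, u)); rewrite ?mem_wlev // /wle eqxx.
Qed.

Lemma wupset_first d U : regular d -> upset wlev wle d U ->
  0 < bcard (ab (~~ first)) d (fun u => U (~~ first, u)) ->
  {in box (ab first) d, forall u, U (first, u)}.
Proof.
move=> rd upU /card_gt0[v vd Uv] u ud.
by apply: (upU _ _ _ _ Uv); rewrite ?mem_wlev // /wle /= eqxx; case: first.
Qed.

(** Putting side [first] ahead leaves one inequality to check, between pairs of sets, one in each
    box; a segment is a pair whose second member is nonempty only when the first one is full. *)
Lemma wedge_macaulay :
  (forall s, Clements_Lindstrom (ab s)) ->
  (forall d (U V A B : pred (seq nat)), 0 < d -> regular d.+1 ->
     bupset (ab first) d U -> bupset (ab (~~ first)) d V ->
     (0 < bcard (ab (~~ first)) d V -> {in box (ab first) d, forall u, U u}) ->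
     bcard (ab first) d A + bcard (ab (~~ first)) d B =
     bcard (ab first) d U + bcard (ab (~~ first)) d V ->
     bcard (ab first) d.+1 (bshadow (ab first) d U) +
     bcard (ab (~~ first)) d.+1 (bshadow (ab (~~ first)) d V) <=
     bcard (ab first) d.+1 (bshadow (ab first) d A) +
     bcard (ab (~~ first)) d.+1 (bshadow (ab (~~ first)) d B)) ->
  macaulay_levels wlev wcov.
Proof.
move=> CLs cond; exists wle => d; split=> [|U upU]; first exact: wle_order.
have [dN|] := boolP ((d == 0) || glued && (d.+1 == N)).
  split=> [x y _ _|A AU]; first by rewrite !wshadow_complete.
  by apply/eq_leq/eq_card => y _; rewrite !wshadow_complete // AU.
rewrite negb_or -lt0n => /andP[d0 dN].
have [rd|nrd] := boolP (regular d.+1); last first.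
  have w0 : wlev d.+1 = [::].
    move: nrd dN; rewrite /regular /wlev /= negbK; case: glued => //=.
    by move=> -> /negPf ->.
  by split=> [x y|A _]; rewrite ?w0 // /card w0.
have rd' := regularW rd d0.
split=> [[s u] [t v]|A AU].
  rewrite !mem_wlev // => ud vd; rewrite !wshadowE // /wle /=.
  case: eqP => [st|st Uu /eqP tf].
    subst t; have [upS _] := CLs s d _ (wupset_slice (s := s) rd' upU).
    exact: upS.
  subst t; apply: (bshadow_full (wupset_first rd' upU _) vd).
  have {}st : s = ~~ first by case: s first st {ud vd Uu} => [] [].
  subst s; move: Uu => /bshadowP[//|u' Uu' uu']; apply/card_gt0.
  by exists u'; first exact: cov_box uu' ud.
have shE B s : bcard (ab s) d.+1 (fun u => wshadow d B (s, u)) =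
    bcard (ab s) d.+1 (bshadow (ab s) d (fun u => B (s, u))).
  by apply: eq_card => u ud; rewrite wshadowE.
rewrite !(wcardE _ first rd) !shE; move: AU; rewrite !(wcardE _ first rd') => AU.
apply: cond => //; [exact: wupset_slice..|].
exact: wupset_first.
Qed.

End Wedge.

Lemma all2_rcons u a k c :
  all2 ltn (rcons u k) (rcons a c) = all2 ltn u a && (k < c).
Proof.
elim: u a => [|l u IHu] [|b a] //=; rewrite ?andbT //.
- by case: a => [|? ?]; rewrite /= andbF.
- by case: u {IHu} => [|? ?]; rewrite /= andbF.
by rewrite IHu andbA.
Qed.

Lemma mem_box_rcons a c d u k :
  (rcons u k \in box (rcons a c) d) = [&& k < c, k <= d & u \in box a (d - k)].
Proof.
rewrite !mem_box all2_rcons sumn_rcons andbC.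
case: (all2 _ _ _); rewrite ?andbF //=; by lia.
Qed.

Lemma colt_rcons u v k l : size u = size v ->
  colt (rcons u k) (rcons v l) = (k < l) || (k == l) && colt u v.
Proof.
elim: u v => [|m u IHu] [|n v] //= suv; first by rewrite andbF orbF.
case: suv => suv; rewrite IHu // eqseq_rcons.
by case: (k < l); case: (k == l); case: (u == v); case: (colt u v).
Qed.

Lemma cov_rcons u v k l : size u = size v ->
  cov (rcons u k) (rcons v l) = (l == k.+1) && (u == v) || (k == l) && cov u v.
Proof.
elim: u v => [|m u IHu] [|n v] //= -[suv].
rewrite IHu // eqseq_rcons eqseq_cons.
by case: (u == v); case: (m == n); case: (n == m.+1); case: (k == l);
  case: (l == k.+1); case: (cov u v).
Qed.

Lemma card_rcons a c d A :
  bcard (rcons a c) d A =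
  \sum_(0 <= k < minn c d.+1) bcard a (d - k) (fun u => A (rcons u k)).
Proof.
have /permP/(_ A) : perm_eq (box (rcons a c) d)
    [seq rcons u k | k <- index_iota 0 (minn c d.+1), u <- box a (d - k)].
  apply: uniq_perm; first exact: uniq_box.
    apply: allpairs_uniq_dep; [exact: iota_uniq|by move=> k _; apply: uniq_box|].
    by move=> [k u] [k' u'] _ _ /= /rcons_inj[-> ->].
  move=> z; apply/idP/allpairsPdep => [zd|[k [u [kd ud ->]]]].
    case/lastP: z zd => [|u k]; first by move/box_size; rewrite size_rcons.
    rewrite mem_box_rcons => /and3P[kc kd ud]; exists k, u; split=> //.
    by rewrite mem_index_iota; lia.
  by move: kd; rewrite mem_box_rcons mem_index_iota ud; lia.
rewrite /card => ->; rewrite count_flatten sumnE !big_map.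
by apply: eq_bigr => k _; rewrite count_map.
Qed.

Lemma bshadow_rcons a c d A v l : rcons v l \in box (rcons a c) d.+1 ->
  bshadow (rcons a c) d A (rcons v l) =
  (0 < l) && A (rcons v l.-1) ||
  (l <= d) && bshadow a (d - l) (fun u => A (rcons u l)) v.
Proof.
move=> lv; move: (lv); rewrite mem_box_rcons => /and3P[lc ld vd].
apply/(bshadowP _ lv)/idP => [[z]|/orP[/andP[]|/andP[ld']]].
- case/lastP: z => [|u k] Auk.
    by case: (v) {lv vd} => //.
  move=> ukvl; have su : size u = size v.
    by have := cov_size ukvl; rewrite !size_rcons => -[].
  move: ukvl; rewrite cov_rcons // => /orP[/andP[/eqP-> /eqP<-]|].
    by rewrite Auk.
  case/andP=> /eqP kl uv; subst k.
  have svu := cov_sumn uv; have sv := box_sumn vd; have ld' : l <= d by lia.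
  apply/orP; right; rewrite ld' /=; apply/bshadowP; last by exists u.
  by rewrite -subSn.
- case: l lv lc ld vd => // l lv _ _ _ _ Alv; exists (rcons v l) => //.
  by rewrite cov_rcons // !eqxx.
case/bshadowP => [|u Aul uv]; first by rewrite -subSn.
by exists (rcons u l) => //; rewrite cov_rcons ?(cov_size uv) // eqxx uv orbT.
Qed.

Lemma sorted_geq_rcons a c : all (leq c) a -> sorted geq a -> sorted geq (rcons a c).
Proof.
have geq_trans : transitive geq by move=> x y z xy yz; apply: leq_trans yz xy.
rewrite !(sorted_pairwise geq_trans) pairwise_rcons => ca ->.
by rewrite andbT; apply: sub_all ca.
Qed.

(** * Two equal boxes *)

Section Twins.
Variable a : seq nat.
Hypotheses (a2 : all (leq 2) a) (a_sorted : sorted geq a).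
Let a' := rcons (rcons a 2) 2.

(* With [s^2 = t^2 = 0], the ideal generated by [st] and [sU + tV] turns a pair
   of sets of monomials into a set of monomials in two more variables. *)
Definition twin (U V : pred (seq nat)) : pred (seq nat) := fun z =>
  if rev z is [:: k, l & r] then
    match k, l with
    | 1, 1 => true
    | 1, 0 => U (rev r)
    | 0, 1 => V (rev r)
    | _, _ => false
    end
  else false.

Lemma twin_rcons U V u k l : twin U V (rcons (rcons u l) k) =
  match k, l with 1, 1 => true | 1, 0 => U u | 0, 1 => V u | _, _ => false end.
Proof. by rewrite /twin !rev_rcons revK. Qed.

Lemma card_twins d A : 0 < d -> bcard a' d.+1 A =
  bcard a d.+1 (fun u => A (rcons (rcons u 0) 0)) +
  bcard a d (fun u => A (rcons (rcons u 1) 0)) +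
  (bcard a d (fun u => A (rcons (rcons u 0) 1)) +
   bcard a d.-1 (fun u => A (rcons (rcons u 1) 1))).
Proof.
move=> d0; rewrite /a' card_rcons (minn_idPl (_ : 2 <= d.+2)) //.
rewrite big_ltn // big_nat1 !card_rcons subn0 subn1 /=.
rewrite (minn_idPl (_ : 2 <= d.+2)) // (minn_idPl (_ : 2 <= d.+1)) //.
by rewrite ![\sum_(0 <= k < 2) _]big_ltn // !big_nat1 !subn0 !subn1.
Qed.

(** The last summand counts the multiples of [st], all of which belong to a twin; being the same for
    every pair, it cancels when two pairs are compared. *)
Lemma card_twin d U V : 0 < d ->
  bcard a' d.+1 (twin U V) = bcard a d U + bcard a d V + size (box a d.-1).
Proof.
move=> d0; rewrite card_twins //.
rewrite (@eq_card _ _ d.+1 _ pred0) => [|u _]; last by rewrite /= twin_rcons.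
rewrite (@eq_card _ _ d (fun u => twin U V (rcons (rcons u 1) 0)) V)
  => [|u _]; last by rewrite /= twin_rcons.
rewrite (@eq_card _ _ d (fun u => twin U V (rcons (rcons u 0) 1)) U)
  => [|u _]; last by rewrite /= twin_rcons.
rewrite (@eq_card _ _ d.-1 _ predT) => [|u _]; last by rewrite /= twin_rcons.
by rewrite card_pred0 card_predT add0n addnCA addnA.
Qed.

Lemma card_shadow_twin d U V : 0 < d ->
  bcard a' d.+2 (bshadow a' d.+1 (twin U V)) =
  bcard a d.+1 (bshadow a d U) + bcard a d.+1 (bshadow a d V) + size (box a d).
Proof.
move=> d0; rewrite card_twins //= /a'.
have mem k l u : k < 2 -> l < 2 -> u \in box a (d.+2 - k - l) ->
    rcons (rcons u l) k \in box a' d.+2.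
  by move=> k2 l2 ud; rewrite !mem_box_rcons k2 l2 ud andbT; lia.
have mem' k l u : k < 2 -> l < 2 -> u \in box a (d.+2 - k - l) ->
    rcons u l \in box (rcons a 2) (d.+2 - k).
  by move=> k2 l2 ud; rewrite !mem_box_rcons l2 ud andbT; lia.
have shE k l u : k < 2 -> l < 2 -> u \in box a (d.+2 - k - l) ->
    bshadow a' d.+1 (twin U V) (rcons (rcons u l) k) =
    [|| (0 < k) && twin U V (rcons (rcons u l) k.-1),
        (0 < l) && twin U V (rcons (rcons u l.-1) k)
      | bshadow a (d.+1 - k - l) (fun w => twin U V (rcons (rcons w l) k)) u].
  move=> k2 l2 ud; have := mem' k l u k2 l2 ud.
  rewrite /a' bshadow_rcons; last exact: mem.
  have kd : k <= d.+1 by lia. have ld : l <= d.+1 - k by lia.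
  by rewrite kd /= subSn // => ud'; rewrite bshadow_rcons // ld.
have sh_eq B B' n u : B =1 B' -> bshadow a n B u = bshadow a n B' u.
  by move=> BB'; apply: eq_shadow => ? _; apply: BB'.
rewrite (@eq_card _ _ d.+2 _ pred0) => [|u ud]; last first.
  rewrite shE ?subn0 //= (sh_eq _ pred0) => [|w]; last by rewrite /= twin_rcons.
  by apply/negP => /shadowP[? []].
rewrite (@eq_card _ _ d.+1 (fun u => bshadow _ d.+1 _ (rcons (rcons u 1) 0))
  (bshadow a d V)) => [|u ud]; last first.
  rewrite shE ?subn0 ?subn1 //= twin_rcons /=.
  by apply: sh_eq => w; rewrite twin_rcons.
rewrite (@eq_card _ _ d.+1 (fun u => bshadow _ d.+1 _ (rcons (rcons u 0) 1))
  (bshadow a d U)) => [|u ud]; last first.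
  rewrite shE ?subn0 ?subn1 //= twin_rcons /=.
  by apply: sh_eq => w; rewrite twin_rcons.
rewrite (@eq_card _ _ d _ predT) => [|u ud]; last first.
  rewrite shE ?subn1 //= !twin_rcons (sh_eq _ predT) => [|w]; last by rewrite /= twin_rcons.
  case: d d0 ud {mem mem' shE} => // d _ ud.
  by rewrite (bshadow_full (fun _ _ => isT) ud) !orbT.
by rewrite card_pred0 card_predT add0n addnCA addnA.
Qed.

(** The two new exponents are compared first, so multiples of [st] come on top, then those of [s],
    then those of [t]. The condition linking [V] to [U] is closure on passing from the [t] part to
    the [s] part. *)
Lemma twin_upset d U V : 0 < d -> bupset a d U -> bupset a d V ->
  (0 < bcard a d V -> {in box a d, forall u, U u}) ->
  bupset a' d.+1 (twin U V).
Proof.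
move=> d0 upU upV VU z z' zd zd' + /orP[/eqP<-//|].
case/lastP: z zd => [|z k]; first by move/box_size; rewrite /a' !size_rcons.
case/lastP: z => [|u l]; first by move/box_size; rewrite /a' !size_rcons.
case/lastP: z' zd' => [|z' k']; first by move/box_size; rewrite /a' !size_rcons.
case/lastP: z' => [|u' l']; first by move/box_size; rewrite /a' !size_rcons.
rewrite !mem_box_rcons => /and5P[k2' _ l2' _ ud'] /and5P[k2 _ l2 _ ud].
have su : size u = size u' by rewrite (box_size ud) (box_size ud').
rewrite !colt_rcons ?size_rcons ?su // !twin_rcons.
case: k k' l l' k2 k2' l2 l2' ud ud' => [|[|//]] [|[|//]] [|[|//]] [|[|//]] _ _ _ _;
  rewrite ?subn0 ?subn1 //= => ud ud' Uu uu'.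
- exact: upV ud ud' Uu (coltW uu').
- by apply: VU ud'; apply/card_gt0; exists u.
- exact: upU ud ud' Uu (coltW uu').
Qed.

Lemma twin_shadow d U V A B : 0 < d -> bupset a d U -> bupset a d V ->
  (0 < bcard a d V -> {in box a d, forall u, U u}) ->
  bcard a d A + bcard a d B = bcard a d U + bcard a d V ->
  bcard a d.+1 (bshadow a d U) + bcard a d.+1 (bshadow a d V) <=
  bcard a d.+1 (bshadow a d A) + bcard a d.+1 (bshadow a d B).
Proof.
move=> d0 upU upV VU AB; have [||_ /(_ (twin A B))] :=
  Clements_Lindstrom_sorted _ _ (twin_upset d0 upU upV VU).
- rewrite /a' !all_rcons /=; apply: sub_all a2 => c; exact: ltnW.
- apply: sorted_geq_rcons; first by rewrite all_rcons.
  exact: sorted_geq_rcons.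
by rewrite !card_twin // !card_shadow_twin // AB !leq_add2r; apply.
Qed.

End Twins.

Lemma all_leq2 a : all (leq 2) a -> all (leq 1) a.
Proof. by apply: sub_all => c; apply: ltnW. Qed.

Theorem twins_macaulay a N : all (leq 2) a -> sorted geq a ->
  macaulay_levels (wlev (fun=> a) true N) (wcov true N).
Proof.
move=> a2 sa; apply: (@wedge_macaulay _ _ _ true) => /= [s|d U V A B d0 _].
  exact: Clements_Lindstrom_sorted (all_leq2 a2) sa.
exact: twin_shadow.
Qed.

(** * Boxes in at most two variables *)

Section RectangleBox.
Variables (c b : nat).
Hypotheses (b0 : 0 < b) (bc : b <= c).

Lemma mem_rect d s : ([:: d - s; s] \in box [:: c; b] d) = (lo c d <= s < hi b d).
Proof. by rewrite mem_box /= /lo /hi andbT addn0; lia. Qed.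

Lemma perm_rect d : perm_eq (box [:: c; b] d)
  [seq [:: d - s; s] | s <- index_iota (lo c d) (hi b d)].
Proof.
apply: uniq_perm; first exact: uniq_box.
  by rewrite map_inj_uniq ?iota_uniq // => s t [].
move=> z; apply/idP/mapP => [zd|[s sd ->]]; last by rewrite mem_rect -mem_index_iota.
case: z zd => [|k [|s [|? ?]]]; rewrite ?mem_box //= ?andbF // => zd.
have ks : k = d - s by lia.
exists s; last by rewrite ks.
by rewrite mem_index_iota -mem_rect -ks mem_box /=.
Qed.

Lemma rect_card d A : bcard [:: c; b] d A = rcard c b d (fun s => A [:: d - s; s]).
Proof. by rewrite /card (permP (perm_rect d)) count_map count_iota_cnt. Qed.

Lemma rect_shadow d A s : lo c d.+1 <= s < hi b d.+1 ->
  bshadow [:: c; b] d A [:: d.+1 - s; s] =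
  rshadow c b d (fun t => A [:: d - t; t]) s.
Proof.
move=> sd; have := sd; rewrite -mem_rect => zd; move: sd; rewrite /lo /hi => sd.
rewrite /rshadow /step /lo /hi.
apply/(bshadowP _ zd)/orP => [[[|k [|t u]]] //= Aktu|].
- by rewrite andbF orbF => /andP[_].
- case/orP=> [/andP[/eqP kE /eqP[ts u0]]|/andP[/eqP kE /orP[/andP[/eqP st /eqP u0]|]]].
  + left; subst t u; have kE' : k = d - s by lia.
    by rewrite -kE' Aktu andbT; lia.
  + right; subst u s; have kE' : k = d - t by lia.
    by rewrite /= -kE' Aktu andbT; lia.
  + by case: u {Aktu} => [|? ?]; rewrite andbF.
case=> [/andP[sd' As]|/andP[s0 /andP[sd' As]]].
  exists [:: d - s; s] => //=; rewrite eqxx andbT; apply/orP; left; lia.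
exists [:: d - s.-1; s.-1] => //=; rewrite andbF orbF prednK // !eqxx andbT.
by apply/orP; right; lia.
Qed.

Lemma rect_card_shadow d A : bcard [:: c; b] d.+1 (bshadow [:: c; b] d A) =
  rcard c b d.+1 (rshadow c b d (fun t => A [:: d - t; t])).
Proof. by rewrite rect_card; apply: cnt_eq => s sd; rewrite rect_shadow. Qed.

Lemma rect_growth_le d A :
  rgrowth c b d (bcard [:: c; b] d A) <= bcard [:: c; b] d.+1 (bshadow [:: c; b] d A).
Proof. by rewrite rect_card rect_card_shadow; apply: rgrowth_le. Qed.

Lemma upset_itv (S : pred nat) x y :
  (forall s t, x <= s -> s <= t -> t < y -> S s -> S t) ->
  forall s, x <= s < y -> S s = (y <= s + cnt S x y).
Proof.
move=> upS s sxy; apply/idP/idP => [Ss|].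
  have : y - s <= cnt S s y.
    rewrite (@cnt_eq _ (fun t => s <= t < y)) ?cnt_itv; first by lia.
    by move=> t st; rewrite st (upS s t); lia.
  have [xs sy] : x <= s /\ s <= y by lia.
  by rewrite (cnt_cat _ xs sy); lia.
apply: contraLR => nSs; rewrite -ltnNge.
have [xs sy] : x <= s.+1 /\ s.+1 <= y by lia.
rewrite (cnt_cat _ xs sy).
have -> : cnt S x s.+1 = 0.
  rewrite (@cnt_eq _ (fun t => 0 <= t < 0)) ?cnt_itv; first by lia.
  by move=> t xt; apply: contraNF nSs => St; apply: upS St; lia.
by have := cnt_size S s.+1 y; lia.
Qed.

Lemma rect_growth_upset d U : bupset [:: c; b] d U ->
  bcard [:: c; b] d.+1 (bshadow [:: c; b] d U) = rgrowth c b d (bcard [:: c; b] d U).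
Proof.
move=> upU; rewrite rect_card_shadow rect_card; set S : pred nat := fun s => U _.
rewrite -(rgrowth_top b0 bc (rcard_le _ _ _ _)); apply: cnt_eq => s _.
have SE t : lo c d <= t < hi b d -> S t = rtop b d (rcard c b d S) t.
  move: t; apply: upset_itv => t t' ct tt' tb St.
  apply: (upU [:: d - t; t]); rewrite ?mem_rect //; [lia..|].
  by rewrite cole_cons /=; case: ltngtP tt' => // ->; rewrite eqxx leqnn.
rewrite /rshadow /step; congr (_ || _); first by apply: andb_id2l => /SE.
by congr (_ && _); apply: andb_id2l => /SE.
Qed.

Lemma size_rect d : size (box [:: c; b] d) = hi b d - lo c d.
Proof. by rewrite (perm_size (perm_rect d)) size_map size_iota. Qed.

End RectangleBox.

Lemma CL_rect c b : 0 < b -> b <= c -> Clements_Lindstrom [:: c; b].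
Proof.
by move=> b0 bc; apply: Clements_Lindstrom_sorted; rewrite /= ?b0 ?bc ?(leq_trans b0 bc).
Qed.

(** The smaller rectangle goes first: its intervals stop growing and start shrinking no later than
    those of the other, and are no longer. Filling it first is therefore cheapest in every degree,
    by comparing the two growth functions. *)
Theorem rectangles_macaulay (ab : bool -> seq nat) f c b c' b' N :
  ab f = [:: c; b] -> ab (~~ f) = [:: c'; b'] -> 0 < b ->
  b <= c -> b' <= c' -> b <= b' -> c <= c' ->
  macaulay_levels (wlev ab false N) (wcov false N).
Proof.
move=> abf abf' b0 bc bc' bb' cc'; have b0' : 0 < b' by apply: leq_trans bb'.
apply: (@wedge_macaulay _ _ _ f) => [s|d U V A B d0 _].
  have [->|sf] := eqVneq s f; first by rewrite abf; apply: CL_rect.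
  have -> : s = ~~ f by case: s f sf {abf abf'} => [] [].
  by rewrite abf'; apply: CL_rect.
rewrite abf abf' => upU upV VU AB.
have := rect_growth_le b0 bc d A; have := rect_growth_le b0' bc' d B.
rewrite (rect_growth_upset b0 bc upU) (rect_growth_upset b0' bc' upV).
have := card_le_size (box [:: c; b]) d U; have := card_le_size (box [:: c; b]) d A.
have := card_le_size (box [:: c'; b']) d V; have := card_le_size (box [:: c'; b']) d B.
have : 0 < bcard [:: c'; b'] d V -> bcard [:: c; b] d U = size (box [:: c; b] d).
  by move=> /VU Uall; rewrite (eq_card Uall) /card count_predT.
rewrite !size_rect // => VU' wB wV wA wU gB gA.
apply: leq_trans (leq_add gA gB).
move: (bcard _ _ A) (bcard _ _ B) (bcard _ _ U) (bcard _ _ V) AB VU' wB wV wA wU {gA gB}.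
move=> p q u v; rewrite /rgrowth /lo /hi => AB VU' wB wV wA wU.
by repeat case: ifP => ?; lia.
Qed.

Lemma all2_1 u c : all2 ltn u [:: c] -> exists2 k, u = [:: k] & k < c.
Proof. by case: u => [|k [|? ?]] //=; rewrite ?andbF // andbT; exists k. Qed.

Lemma chain_card_shadow c d A : d.+1 < c ->
  bcard [:: c] d.+1 (bshadow [:: c] d A) = bcard [:: c] d A.
Proof.
move=> dc; have boxE e : e < c -> perm_eq (box [:: c] e) [:: [:: e]].
  move=> ec; apply: uniq_perm => //; first exact: uniq_box.
  move=> z; rewrite inE; apply/idP/eqP => [|->]; last by rewrite mem_box /= ec addn0 eqxx.
  by rewrite mem_box => /andP[/all2_1[k -> _] /eqP <-]; rewrite /= addn0.
rewrite /card !(permP (boxE _ _)) ?(ltnW dc) //= !addn0; congr nat_of_bool.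
have dd : [:: d.+1] \in box [:: c] d.+1 by rewrite (perm_mem (boxE _ dc)) inE.
apply/(bshadowP _ dd)/idP => [[u Au /[dup] ud /(fun h => cov_box h dd)]|Ad].
  by rewrite (perm_mem (boxE _ (ltnW dc))) inE => /eqP uE; rewrite -uE.
by exists [:: d]; rewrite //= !eqxx.
Qed.

(** Between the unit and the glued top both sides are neutral: the shadow has the size of the set in
    a chain, and at least that size in a rectangle with a cap 2, with equality for segments. *)
Theorem chain_rectangle_macaulay (ab : bool -> seq nat) f c c' N :
  ab f = [:: c] -> ab (~~ f) = [:: c'; 2] -> 1 < c' -> N < c -> N <= c' ->
  macaulay_levels (wlev ab true N) (wcov true N).
Proof.
move=> abf abf' c2 Nc Nc'.
apply: (@wedge_macaulay _ _ _ f) => [s|d U V A B d0 rd].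
  have [->|sf] := eqVneq s f.
    by rewrite abf; apply: Clements_Lindstrom_sorted; rewrite //= andbT; lia.
  have -> : s = ~~ f by case: s f sf {abf abf'} => [] [].
  by rewrite abf'; apply: CL_rect.
have dN : d.+1 < N by move: rd; rewrite /regular /=; lia.
rewrite abf abf' => upU upV _ AB.
rewrite !chain_card_shadow; [|lia..].
have := rect_growth_le (isT : 0 < 2) c2 d B; rewrite (rect_growth_upset _ c2 upV) //.
have gE q : rgrowth c' 2 d q = q by rewrite /rgrowth; repeat case: ifP => ?; lia.
by rewrite !gE => gB; rewrite -AB leq_add2l.
Qed.

(** * Degree two and codegree two *)

Section LowDegree.

Lemma size_box_cons c a d :
  size (box (c :: a) d) = \sum_(0 <= k < minn c d.+1) size (box a (d - k)).
Proof. by rewrite -card_predT card_cons; apply: eq_bigr => k _; rewrite card_predT. Qed.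

Lemma size_box0 a : all (leq 1) a -> size (box a 0) = 1.
Proof.
elim: a => //= c a IHa /andP[c0 /IHa a0]; rewrite -/(box (c :: a) 0) size_box_cons.
by rewrite (minn_idPr c0) big_nat1 subn0.
Qed.

Lemma size_box1 a : all (leq 1) a -> size (box a 1) = count (leq 2) a.
Proof.
elim: a => //= c a IHa /andP[c0 a0]; rewrite -/(box (c :: a) 1) size_box_cons.
case: c c0 => [|[|c]] // _; rewrite /minn /=; last first.
  by rewrite big_ltn // big_nat1 subn0 subnn IHa // size_box0 // addnC.
by rewrite big_nat1 subn0 IHa.
Qed.

(** All quadratic monomials in the variables present, except the squares of those with cap 2. *)
Lemma size_box2 a : all (leq 1) a ->
  size (box a 2) + count_mem 2 a = 'C((count (leq 2) a).+1, 2).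
Proof.
elim: a => //= c a IHa /andP[c0 a0]; rewrite -/(box (c :: a) 2) size_box_cons.
have {}IHa := IHa a0.
case: c c0 => [|[|[|c]]] // _; rewrite /minn /=.
- by rewrite big_nat1 subn0 IHa.
- rewrite big_ltn // big_nat1 subn0 size_box1 // !add1n [RHS]binS bin1; lia.
rewrite 3?big_ltn // big_geq // subn0 subn1 subnn size_box1 // size_box0 //.
by rewrite !add1n [RHS]binS bin1; lia.
Qed.

Definition unit_vec n i := incr_nth (nseq n 0) i.

Lemma sumn0_nseq u : sumn u = 0 -> u = nseq (size u) 0.
Proof. by elim: u => //= k u IHu ku; rewrite -IHu; [congr (_ :: _)|]; lia. Qed.

Lemma sumn1_unit u : sumn u = 1 -> exists2 i, i < size u & u = unit_vec (size u) i.
Proof.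
elim: u => //= -[|k] u IHu ku; last first.
  exists 0 => //; rewrite /unit_vec /= -sumn0_nseq; last by lia.
  by congr (_ :: _); lia.
by have [i iu ui] := IHu ku; exists i.+1; rewrite // {1}ui.
Qed.

Lemma nth_unit n i j : nth 0 (unit_vec n i) j = (i == j).
Proof. by rewrite nth_incr_nth nth_nseq if_same addn0. Qed.

Lemma size_unit n i : i < n -> size (unit_vec n i) = n.
Proof. by move=> i_n; rewrite size_incr_nth size_nseq i_n. Qed.

Lemma sumn_unit n i : sumn (unit_vec n i) = 1.
Proof. by rewrite sumn_incr sumn_nseq mul0n. Qed.

Lemma perm_box1 a : all (leq 2) a ->
  perm_eq (box a 1) [seq unit_vec (size a) i | i <- iota 0 (size a)].
Proof.
move=> /allP a2; apply: uniq_perm; first exact: uniq_box.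
  rewrite map_inj_in_uniq ?iota_uniq // => i j; rewrite !mem_iota => ia ja ij.
  have := nth_unit (size a) i j; rewrite ij nth_unit eqxx.
  by case: eqP.
move=> u; apply/idP/mapP => [ua|[i]]; last first.
  rewrite mem_iota add0n => /andP[_ ia] ->.
  rewrite mem_box sumn_unit eqxx andbT; apply/all2_ltnP; rewrite size_unit //.
  split=> // j ja; rewrite nth_unit; apply: (@leq_ltn_trans 1); first by case: (i == j).
  by apply/a2/mem_nth.
have [i iu ->] := sumn1_unit (box_sumn ua); rewrite (box_size ua) in iu *.
by exists i; rewrite // mem_iota.
Qed.

Lemma card1_count a A : all (leq 2) a ->
  bcard a 1 A = count (fun i => A (unit_vec (size a) i)) (iota 0 (size a)).
Proof. by move=> a2; rewrite /card (permP (perm_box1 a2)) count_map. Qed.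

Lemma unit_cov u i : sumn u = 2 -> 0 < nth 0 u i -> cov (unit_vec (size u) i) u.
Proof.
move=> u2 ui; have iu : i < size u.
  by rewrite ltnNge; apply: contraL ui => /(nth_default 0) ->.
pose v := set_nth 0 u i (nth 0 u i).-1.
have sv : size v = size u by rewrite size_set_nth; apply/maxn_idPr.
have uv : u = incr_nth v i.
  apply: (@eq_from_nth _ 0); first by rewrite size_incr_nth sv iu.
  move=> j _; rewrite nth_incr_nth nth_set_nth /=.
  by case: (eqVneq i j) => [<-|_] /=; rewrite ?add1n ?prednK.
have v1 : sumn v = 1 by move: u2; rewrite uv sumn_incr => -[].
have [j jv vj] := sumn1_unit v1; apply/cov_incrP; exists j; first by rewrite size_unit // -sv.
by rewrite {1}uv {1}vj sv /unit_vec incr_nthC.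
Qed.

(** A cap 1 deletes a variable while keeping the length of the vectors. *)
Definition restrict a (X : pred nat) :=
  mkseq (fun i => if X i then nth 0 a i else 1) (size a).

Lemma mem_restrict a X d u : all (leq 1) a ->
  (u \in box (restrict a X) d) =
  (u \in box a d) && all (fun i => X i || (nth 0 u i == 0)) (iota 0 (size a)).
Proof.
move=> /allP a1; rewrite !mem_box andbAC; congr (_ && _).
have nthr i : i < size a -> nth 0 (restrict a X) i = if X i then nth 0 a i else 1.
  by move=> ia; rewrite nth_mkseq.
apply/all2_ltnP/andP => [[]|[/all2_ltnP[su ua] /allP uX]]; rewrite size_mkseq.
  move=> su ur; split; last first.
    apply/allP => i; rewrite mem_iota add0n => /andP[_ ia].
    by have := ur i ia; rewrite nthr //; case: (X i) => //; rewrite ltnS leqn0.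
  apply/all2_ltnP; split=> // i ia; apply: leq_trans (ur i ia) _; rewrite nthr //.
  by case: (X i) => //; apply/a1/mem_nth.
split=> // i ia; rewrite nthr //; case Xi: (X i); first exact: ua.
by have := uX i; rewrite mem_iota ia Xi /= => /(_ isT)/eqP ->.
Qed.

Lemma restrict_ge1 a X : all (leq 1) a -> all (leq 1) (restrict a X).
Proof.
move=> /allP a1; apply/allP => x /mapP[i]; rewrite mem_iota add0n => /andP[_ ia] ->.
by case: ifP => // _; apply/a1/mem_nth.
Qed.

Lemma count_restrict a X : all (leq 2) a ->
  count (leq 2) (restrict a X) = count X (iota 0 (size a)).
Proof.
move=> /allP a2; rewrite count_map; apply: eq_in_count => i; rewrite mem_iota add0n.
by move=> /andP[_ ia] /=; case: (X i) => //; apply/a2/mem_nth.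
Qed.

Lemma count_mem_restrict a X :
  count_mem 2 (restrict a X) =
  count (fun i => X i && (nth 0 a i == 2)) (iota 0 (size a)).
Proof. by rewrite count_map; apply: eq_in_count => i _ /=; case: (X i). Qed.

Lemma count_mem_iota a :
  count_mem 2 a = count (fun i => nth 0 a i == 2) (iota 0 (size a)).
Proof. by rewrite -{1}(mkseq_nth 0 a) count_map. Qed.

(** [t] is the number of caps 2 among the variables in [X]. Only bounds on it are exported, as later
    only the number of chosen variables is known. *)
Lemma size_restrict2 a X : all (leq 2) a ->
  let p := count X (iota 0 (size a)) in
  exists t, [/\ size (box (restrict a X) 2) + t = 'C(p.+1, 2), t <= p, t <= count_mem 2 a
    & count_mem 2 a <= t + (size a - p)].
Proof.
move=> a2 p; exists (count_mem 2 (restrict a X)).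
rewrite size_box2; last exact/restrict_ge1/(all_leq2 a2).
rewrite count_restrict // count_mem_restrict count_mem_iota /p.
have H s : let e i := nth 0 a i == 2 in
    [/\ count (fun i => X i && e i) s <= count X s,
        count (fun i => X i && e i) s <= count e s
      & count e s <= count (fun i => X i && e i) s + (size s - count X s)].
  elim: s => //= i s [h1 h2 h3]; have := count_size X s.
  by split=> //; case: (X i); case: (nth 0 a i == 2); rewrite /=; lia.
by have [h1 h2] := H (iota 0 (size a)); rewrite size_iota.
Qed.

(** A quadratic monomial escapes the shadow of a set of variables exactly when it involves only the
    remaining ones; [t] counts the caps 2 among these. *)
Lemma card_shadow1 a A : all (leq 2) a -> let p := bcard a 1 A in
  exists t, [/\ bcard a 2 (bshadow a 1 A) + count_mem 2 a + 'C((size a - p).+1, 2) =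
                'C((size a).+1, 2) + t,
    t <= size a - p, t <= count_mem 2 a & count_mem 2 a <= t + p].
Proof.
move=> a2 p; pose X i := ~~ A (unit_vec (size a) i).
have a1 := all_leq2 a2.
have pX : p + count X (iota 0 (size a)) = size a.
  by rewrite /p card1_count // count_predC size_iota.
have {}pX : count X (iota 0 (size a)) = size a - p by lia.
have [t] := size_restrict2 X a2; rewrite pX => -[h1 h2 h3 h4]; exists t; split=> //; last by lia.
have h0 := size_box2 a1.
have ca : count (leq 2) a = size a by apply/eqP; rewrite -all_count.
rewrite -h1 -ca -h0; suff <- :
  bcard a 2 (bshadow a 1 A) + size (box (restrict a X) 2) = size (box a 2) by lia.
have -> : size (box (restrict a X) 2) = bcard a 2 (predC (bshadow a 1 A)).
  rewrite /card -size_filter; apply/perm_size/uniq_perm; rewrite ?filter_uniq ?uniq_box //.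
  move=> v; rewrite mem_restrict // mem_filter /= andbC; apply: andb_id2r => vd.
  apply/allP/negP => [vX /(bshadowP _ vd)[u Au uv]|nA].
    have u1 : sumn u = 1.
      by have := cov_sumn uv; rewrite (box_sumn vd) => -[].
    have [i iu ui] := sumn1_unit u1; have su : size u = size a.
      by rewrite -(cov_size uv) (box_size vd).
    have := vX i; rewrite mem_iota -su iu /X -su -ui Au /= => /(_ isT).
    by case/cov_incrP: uv => j _ ->; rewrite nth_incr_nth ui nth_unit eqxx addn1.
  move=> i; rewrite mem_iota add0n => /andP[_ ia]; rewrite /X.
  case Ai: (A _) => //=; rewrite -leqn0 leqNgt; apply/negP => vi.
  case: nA; apply/(bshadowP _ vd).
  exists (unit_vec (size a) i) => //; rewrite -(box_size vd).
  by apply: unit_cov; rewrite // (box_sumn vd).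
exact: count_predC.
Qed.

End LowDegree.

(** * Duality in a box *)

Section Complement.

Fixpoint co (a u : seq nat) :=
  match a, u with c :: a', k :: u' => c.-1 - k :: co a' u' | _, _ => [::] end.

Definition top_rank a := sumn [seq c.-1 | c <- a].

Lemma co_ltn a u : all2 ltn u a -> all2 ltn (co a u) a.
Proof. by elim: a u => [|c a IHa] [|k u] //= /andP[kc /IHa ->]; rewrite andbT; lia. Qed.

Lemma coK a u : all2 ltn u a -> co a (co a u) = u.
Proof. by elim: a u => [|c a IHa] [|k u] //= /andP[kc /IHa ->]; congr (_ :: _); lia. Qed.

Lemma sumn_co a u : all2 ltn u a -> sumn (co a u) + sumn u = top_rank a.
Proof.
rewrite /top_rank; elim: a u => [|c a IHa] [|k u] //= /andP[kc /IHa <-]; lia.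
Qed.

Lemma cov_co a u v : all2 ltn v a -> cov u v -> cov (co a v) (co a u).
Proof.
elim: a u v => [|c a IHa] [|k u] [|l v] //= /andP[lc va].
case/orP=> [/andP[/eqP lk /eqP->]|/andP[/eqP-> uv]]; last by rewrite eqxx IHa ?orbT.
by rewrite eqxx andbT; apply/orP; left; lia.
Qed.

Lemma co_box a d u : d <= top_rank a -> u \in box a d -> co a u \in box a (top_rank a - d).
Proof.
move=> da; rewrite !mem_box => /andP[ua /eqP ud]; rewrite co_ltn //=.
by have := sumn_co ua; lia.
Qed.

Lemma perm_co a d : d <= top_rank a ->
  perm_eq (box a (top_rank a - d)) [seq co a u | u <- box a d].
Proof.
move=> da; apply: uniq_perm; first exact: uniq_box.
  rewrite map_inj_in_uniq ?uniq_box // => u v /box_ltn ua /box_ltn va uv.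
  by rewrite -(coK ua) uv coK.
move=> u; apply/idP/mapP => [ua|[v vd ->]]; last exact: co_box.
exists (co a u); last by rewrite coK // (box_ltn ua).
by have := co_box (leq_subr d _) ua; rewrite subKn.
Qed.

Lemma card_co a d A : d <= top_rank a ->
  bcard a (top_rank a - d) A = bcard a d (fun u => A (co a u)).
Proof. by move=> da; rewrite /card (permP (perm_co da)) count_map. Qed.

Lemma size_box_co a d : d <= top_rank a ->
  size (box a (top_rank a - d)) = size (box a d).
Proof. by move=> da; rewrite (perm_size (perm_co da)) size_map. Qed.

Lemma size_box_top a : all (leq 1) a -> size (box a (top_rank a)) = 1.
Proof. by move=> a1; rewrite -[top_rank a]subn0 size_box_co // size_box0. Qed.

Lemma box_gt_top a d : top_rank a < d -> box a d = [::].
Proof.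
move=> da; case E: (box a d) => [//|u s].
have : u \in box a d by rewrite E mem_head.
by rewrite mem_box => /andP[ua /eqP ud]; have := sumn_co ua; lia.
Qed.

Lemma exists_cov_up a d u : d < top_rank a -> u \in box a d ->
  exists2 v, v \in box a d.+1 & cov u v.
Proof.
move=> da ud; have ua := box_ltn ud.
have [|v vu] := @exists_cov (co a u).
  by have := sumn_co ua; rewrite (box_sumn ud); lia.
have va := cov_ltn vu (co_ltn ua); exists (co a v).
  rewrite mem_box co_ltn //=; have := sumn_co va; have := sumn_co ua.
  by rewrite (box_sumn ud) (cov_sumn vu); lia.
by have := cov_co (co_ltn ua) vu; rewrite coK.
Qed.

Lemma card_shadow_gt0 a d A : d < top_rank a -> 0 < bcard a d A ->
  0 < bcard a d.+1 (bshadow a d A).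
Proof.
move=> da /card_gt0[u ud Au]; have [v vd uv] := exists_cov_up da ud.
by apply/card_gt0; exists v => //; apply/bshadowP => //; exists u.
Qed.

(** Complements of elements of [B] are quadratic, and every variable dividing one of them is the
    complement of an element of the shadow. So they are quadratic monomials in [r] variables. *)
Lemma card_shadow_corank2 a B : all (leq 2) a -> 1 < top_rank a ->
  let r := bcard a (top_rank a).-1 (bshadow a (top_rank a - 2) B) in
  exists t, [/\ bcard a (top_rank a - 2) B + t <= 'C(r.+1, 2), r <= size a
    & count_mem 2 a <= t + (size a - r)].
Proof.
move=> a2 aN r; pose X i := bshadow a (top_rank a - 2) B (co a (unit_vec (size a) i)).
have rX : r = count X (iota 0 (size a)).
  by rewrite /r -subn1 card_co ?card1_count //; apply: ltnW.
have [t [h1 h2 h3 h4]] := size_restrict2 X a2; exists t; rewrite -rX in h1 h4.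
split=> //; last by rewrite rX (leq_trans (count_size _ _)) ?size_iota.
rewrite -h1 leq_add2r card_co // /card -size_filter.
apply: uniq_leq_size; first by rewrite filter_uniq ?uniq_box.
move=> v; rewrite mem_filter mem_restrict ?all_leq2 // => /andP[Bv vd]; rewrite vd /=.
apply/allP => i; rewrite mem_iota add0n => /andP[_ ia].
rewrite -[_ == 0]negbK -lt0n orbC -implybE; apply/implyP => vi.
have iv : cov (unit_vec (size a) i) v.
  by rewrite -(box_size vd); apply: unit_cov; rewrite // (box_sumn vd).
have iN : co a (unit_vec (size a) i) \in box a (top_rank a - 2).+1.
  have -> : (top_rank a - 2).+1 = top_rank a - 1 by lia.
  by apply: co_box; [lia | apply: cov_box iv vd].
by apply/(bshadowP _ iN); exists (co a v) => //; apply: cov_co iv; apply: box_ltn vd.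
Qed.

End Complement.

(** * Obstructions *)

Section MacaulayWedge.
Variables (ab : bool -> seq nat) (glued : bool) (N : nat).
Notation wlev := (wlev ab glued N).
Notation wcov := (wcov glued N).
Notation wcard := (card wlev).
Notation wshadow := (shadow wlev wcov).
Notation regular := (regular glued N).
Variable ord : rel (bool * seq nat).
Hypothesis ord_mac : macaulay_order wlev wcov ord.

Definition side (s : bool) : pred (bool * seq nat) := fun x => x.1 == s.

Lemma wcard_shadow d A s : regular d.+1 -> 0 < d ->
  wcard d.+1 (wshadow d A) =
  bcard (ab s) d.+1 (bshadow (ab s) d (fun u => A (s, u))) +
  bcard (ab (~~ s)) d.+1 (bshadow (ab (~~ s)) d (fun u => A (~~ s, u))).
Proof.
move=> rd d0; rewrite (wcardE _ _ s) //.
by congr (_ + _); apply: eq_card => u ud; rewrite wshadowE.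
Qed.

Lemma wcard_side d s : regular d -> wcard d (side s) = size (box (ab s) d).
Proof.
move=> rd; rewrite (wcardE _ _ s) // /side /= eqxx.
have -> : (~~ s == s) = false by case: s.
by rewrite [X in _ + X]card_pred0 addn0 card_predT.
Qed.

Lemma wshadow_side d s : regular d.+1 -> 0 < d ->
  {in wlev d.+1, wshadow d (side s) =1 side s}.
Proof.
move=> rd d0 [t v]; rewrite mem_wlev // => vd; rewrite wshadowE // /side /=.
case: eqP => _; last by apply/negbTE/negP => /shadowP[? []].
exact: bshadow_full vd.
Qed.

Lemma wcard_shadow_side d s : regular d.+1 -> 0 < d ->
  wcard d.+1 (wshadow d (side s)) = size (box (ab s) d.+1).
Proof. by move=> rd d0; rewrite (eq_card (wshadow_side s rd d0)) wcard_side. Qed.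

(** The shadow of a whole side is that side one degree higher, so being a segment propagates
    upwards. *)
Lemma upset_side_mono d e s : 0 < d -> d <= e -> regular e ->
  upset wlev ord d (side s) -> upset wlev ord e (side s).
Proof.
move=> d0 de re up_d; elim: e de re => [|e IHe]; first by lia.
rewrite leq_eqVlt => /orP[/eqP<- //|]; rewrite ltnS => de re.
have e0 : 0 < e by apply: leq_trans de.
have [_ mac_e] := ord_mac e; have [up_e _] := mac_e _ (IHe de (regularW re e0)).
exact: eq_upset (wshadow_side s re e0) up_e.
Qed.

Lemma upset_exists d q : q <= size (wlev d) ->
  exists2 U, upset wlev ord d U & wcard d U = q.
Proof. by case: (ord_mac d) => od _; apply: exists_upset od (uniq_wlev _ _ _ _) _. Qed.

Lemma upset_optimal d U A : upset wlev ord d U -> wcard d A = wcard d U ->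
  wcard d.+1 (wshadow d U) <= wcard d.+1 (wshadow d A).
Proof. by case: (ord_mac d) => _ mac_d upU; apply: (mac_d U upU).2. Qed.

Lemma size_wlev d s : regular d ->
  size (wlev d) = size (box (ab s) d) + size (box (ab (~~ s)) d).
Proof. by move=> rd; rewrite -card_predT (wcardE _ _ s) // !card_predT. Qed.

Lemma upset_side_sub d s U : regular d -> upset wlev ord d (side s) ->
  upset wlev ord d U -> size (box (ab s) d) <= wcard d U ->
  bcard (ab s) d (fun u => U (s, u)) = size (box (ab s) d).
Proof.
move=> rd up_s upU sU; case: (ord_mac d) => od _.
have sub := upset_nested od up_s upU; rewrite wcard_side // in sub.
rewrite -card_predT; apply: eq_card => u ud; apply: sub => //; first by rewrite mem_wlev.
by rewrite /side /=.
Qed.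

Lemma upset_side_eq d s U : regular d -> upset wlev ord d U ->
  bcard (ab s) d (fun u => U (s, u)) = size (box (ab s) d) ->
  bcard (ab (~~ s)) d (fun u => U (~~ s, u)) = 0 -> upset wlev ord d (side s).
Proof.
move=> rd upU full empty; apply: eq_upset upU => -[t u]; rewrite mem_wlev // => ud.
have [tE|ts] := eqVneq t s.
  subst t; rewrite /side /= eqxx.
  exact: (card_full (eq_leq (esym full)) ud).
have {}ts : t = ~~ s by case: t s ts {ud full empty} => [] [].
subst t; rewrite /side /=; have := card_eq0 empty ud => /= /negbTE ->.
by case: (s).
Qed.

End MacaulayWedge.

(** From degree [b - 1] to [b] side [s] keeps its [b] elements, whereas any nonempty set on the
    other side still grows; so side [s] is a segment there, hence in all higher degrees. In degree
    [c' - 1] the other side is full with [b'] elements and is about to lose one. The segment of size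
    [b'] has all [b] elements of side [s] and an incomplete part of the other side, so it loses
    none. *)
Theorem rectangles_not_macaulay (ab : bool -> seq nat) s c b c' b' N :
  ab s = [:: c; b] -> ab (~~ s) = [:: c'; b'] ->
  1 < b -> b < b' -> b' <= c' -> c' < c ->
  ~ macaulay_levels (wlev ab false N) (wcov false N).
Proof.
move=> abs abs' b1 bb' bc' cc' [ord mac].
have bc : b <= c by lia. have b0 : 0 < b by lia. have b0' : 0 < b' by lia.
have rd d : 0 < d -> regular false N d by rewrite /regular /= => ->.
have growth d A := rect_growth_le b0 bc d A.
have growth' d A := rect_growth_le b0' bc' d A.
have up_side : upset (wlev ab false N) ord b.-1 (side s).
  have [|U upU cU] := upset_exists mac (q := b) (d := b.-1).
    by rewrite (size_wlev _ s) ?rd ?abs ?size_rect // /lo /hi; lia.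
  have rb : regular false N b.-1 by apply: rd; lia.
  have rb1 : regular false N b.-1.+1 by apply: rd.
  have bp : 0 < b.-1 by lia.
  have sb : size (box [:: c; b] b.-1) = b by rewrite size_rect // /lo /hi; lia.
  have sb1 : size (box [:: c; b] b.-1.+1) = b by rewrite size_rect // /lo /hi; lia.
  have := upset_optimal mac (A := side s) upU.
  rewrite wcard_side // cU abs sb => /(_ erefl).
  rewrite wcard_shadow_side // (wcard_shadow _ _ s) //.
  move: cU; rewrite (wcardE _ _ s) //.
  have := upset_side_eq (s := s) rb upU; rewrite abs abs' sb sb1.
  have := growth b.-1 (fun u => U (s, u)); have := growth' b.-1 (fun u => U (~~ s, u)).
  set p := bcard [:: c; b] _ (fun u => U (s, u)).
  set q := bcard [:: c'; b'] _ (fun u => U (~~ s, u)).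
  set x := bcard [:: c; b] _ _; set y := bcard [:: c'; b'] _ _.
  move: p q x y => p q x y g' g up_s pq xy.
  have q0 : q = 0 by move: g g'; rewrite /rgrowth /lo /hi; repeat case: ifP => ?; lia.
  by apply: up_s; lia.
have c0' : 0 < c'.-1 by lia.
have rc : regular false N c'.-1 by apply: rd.
have rc1 : regular false N c'.-1.+1 by apply: rd.
have up_side' : upset (wlev ab false N) ord c'.-1 (side s).
  by apply: upset_side_mono up_side => //; lia.
have sa : size (box [:: c; b] c'.-1) = b by rewrite size_rect // /lo /hi; lia.
have sb : size (box [:: c'; b'] c'.-1) = b' by rewrite size_rect // /lo /hi; lia.
have sb1 : size (box [:: c'; b'] c'.-1.+1) = b'.-1 by rewrite size_rect // /lo /hi; lia.
have [|V upV cV] := upset_exists mac (q := b') (d := c'.-1).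
  by rewrite (size_wlev _ s) // abs abs' sa sb; lia.
have := upset_optimal mac (A := side (~~ s)) upV.
rewrite wcard_side // cV abs' sb => /(_ erefl).
rewrite wcard_shadow_side // abs' sb1 (wcard_shadow _ _ s) //.
have := upset_side_sub mac rc up_side' upV; rewrite cV abs sa => /(_ (ltnW bb')) Vs.
move: cV; rewrite (wcardE _ _ s) // abs abs' Vs.
have := growth c'.-1 (fun u => V (s, u)); have := growth' c'.-1 (fun u => V (~~ s, u)).
rewrite Vs; set q := bcard [:: c'; b'] _ (fun u => V (~~ s, u)).
set x := bcard [:: c; b] _ _; set y := bcard [:: c'; b'] _ _.
move: q x y => q x y; rewrite /rgrowth /lo /hi.
by repeat case: ifP => ?; lia.
Qed.

(** Quadratic monomials in two groups of variables; the product counts the mixed ones. *)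
Lemma tri_add x y : 'C((x + y).+1, 2) = 'C(x.+1, 2) + 'C(y.+1, 2) + x * y.
Proof.
elim: x => [|x IHx]; first by rewrite add0n mul0n addn0.
by rewrite addSn binS IHx bin1 [in RHS]binS bin1 mulSn; lia.
Qed.

(** * Necessary conditions for connected sums *)

Section MacaulayConnectedSum.
Variables (ab : bool -> seq nat) (N : nat).
Hypotheses (ab2 : forall s, all (leq 2) (ab s)) (abN : forall s, top_rank (ab s) = N).
Hypothesis N3 : 2 < N.
Notation wlev := (wlev ab true N).
Notation wcov := (wcov true N).
Notation wcard := (card wlev).
Notation wshadow := (shadow wlev wcov).
Notation regular := (regular true N).
Variable ord : rel (bool * seq nat).
Hypothesis ord_mac : macaulay_order wlev wcov ord.

Notation w s d := (size (box (ab s) d)).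
Notation n s := (size (ab s)).
Notation t s := (count_mem 2 (ab s)).

Lemma regularE d : 0 < d -> d < N -> regular d.
Proof. by rewrite /regular /= => -> dN; rewrite -ltnNge. Qed.

Lemma count_ab s : count (leq 2) (ab s) = n s.
Proof. by apply/eqP; rewrite -all_count. Qed.

Lemma w1 s : w s 1 = n s.
Proof. by rewrite size_box1 ?all_leq2 // count_ab. Qed.

Lemma w2 s : w s 2 + t s = 'C((n s).+1, 2).
Proof. by rewrite size_box2 ?all_leq2 // count_ab. Qed.

Lemma w_co s d : d <= N -> w s (N - d) = w s d.
Proof. by move=> dN; rewrite -(abN s) size_box_co // abN. Qed.

Lemma t_le s : t s <= n s.
Proof. exact: count_size. Qed.

Definition level1_count s A := bcard (ab s) 1 (fun u => A (s, u)).

(** [card_shadow1] on both sides at once: [x] and [y] are the two parts of the shadow, and [z]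
    stands for the numbers of caps 2 among the variables left out on each side. *)
Lemma shadow1 s A : exists x y (z : nat * nat),
  [/\ wcard 1 A = level1_count s A + level1_count (~~ s) A,
      wcard 2 (wshadow 1 A) = x + y,
      [/\ x + t s + 'C((n s - level1_count s A).+1, 2) = 'C((n s).+1, 2) + z.1,
        z.1 <= n s - level1_count s A & t s <= z.1 + level1_count s A]
    & [/\ y + t (~~ s) + 'C((n (~~ s) - level1_count (~~ s) A).+1, 2) =
          'C((n (~~ s)).+1, 2) + z.2,
        z.2 <= n (~~ s) - level1_count (~~ s) A
      & t (~~ s) <= z.2 + level1_count (~~ s) A]].
Proof.
have [z1 [hz1 hz1' _ hz1'']] := card_shadow1 (fun u => A (s, u)) (ab2 s).
have [z2 [hz2 hz2' _ hz2'']] := card_shadow1 (fun u => A (~~ s, u)) (ab2 (~~ s)).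
exists (bcard (ab s) 2 (bshadow (ab s) 1 (fun u => A (s, u)))).
exists (bcard (ab (~~ s)) 2 (bshadow (ab (~~ s)) 1 (fun u => A (~~ s, u)))).
exists (z1, z2); split=> //.
  by rewrite (wcardE _ _ s) // regularE //; lia.
by rewrite (wcard_shadow _ _ s) // regularE.
Qed.

Lemma level1_le s A : level1_count s A <= n s.
Proof. by rewrite -w1 card_le_size. Qed.

Lemma upset1_exists s q : q <= n s + n (~~ s) ->
  exists2 U, upset wlev ord 1 U & wcard 1 U = q.
Proof.
move=> qn; apply: upset_exists ord_mac _ _ _.
by rewrite (size_wlev _ s) ?w1 // regularE //; lia.
Qed.

Lemma upset1_side s U : upset wlev ord 1 U -> level1_count s U = n s ->
  level1_count (~~ s) U = 0 -> upset wlev ord 1 (side s).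
Proof.
by move=> upU Us Us'; apply: (upset_side_eq _ upU); rewrite ?w1 // regularE //; lia.
Qed.

Lemma shadow1_side_le U q : upset wlev ord 1 U -> wcard 1 U = n q ->
  wcard 2 (wshadow 1 U) + t q <= 'C((n q).+1, 2).
Proof.
move=> upU cU; rewrite -w2 leq_add2r.
have r1 : regular 1 by apply: regularE => //; apply: ltnW.
have := upset_optimal ord_mac (A := side q) upU.
by rewrite wcard_side // w1 cU wcard_shadow_side ?regularE //; apply.
Qed.

(** The first [n s] variables take [p] from side [s] and [r] from the other side. Compared with the
    shadow of side [s] itself, mixed products make up the excess [r * (p + (n (~~ s) - n s))], which
    only caps 2 of the other side can compensate. *)
Lemma first_atoms s : n s <= n (~~ s) -> exists U (x : nat * nat),
  let p := level1_count s U in let r := level1_count (~~ s) U in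
  [/\ upset wlev ord 1 U, p + r = n s,
      x.1 + x.2 + r * (p + (n (~~ s) - n s)) <= t (~~ s),
      t s <= x.1 + p & t (~~ s) <= x.2 + r].
Proof.
move=> nm; have [|U upU cU] := @upset1_exists s (n s); first by lia.
have [x [y [z [cUE sUE [hx1 hx2 hx3] [hy1 hy2 hy3]]]]] := shadow1 s U.
exists U, z => p r; rewrite -/p -/r in cUE hx1 hx2 hx3 hy1 hy2 hy3.
have pr : p + r = n s by rewrite -cUE.
split=> //; have := shadow1_side_le upU cU; rewrite sUE.
have rE : n s - p = r by lia.
have pE : n (~~ s) - r = p + (n (~~ s) - n s) by lia.
have mE : n (~~ s) = r + (p + (n (~~ s) - n s)) by lia.
rewrite rE in hx1; rewrite pE [in RHS]mE (tri_add r) in hy1; lia.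
Qed.

Lemma corank2_bound s B : exists z,
  let r := bcard (ab s) N.-1 (bshadow (ab s) (N - 2) B) in
  [/\ bcard (ab s) (N - 2) B + z <= 'C(r.+1, 2), r <= n s & t s <= z + (n s - r)].
Proof.
have := card_shadow_corank2 B (ab2 s); rewrite abN => /(_ (ltnW N3))[z hz].
by exists z.
Qed.

Lemma wN1 s : w s N.-1 = n s.
Proof. by rewrite -subn1 w_co ?w1 //; lia. Qed.

Lemma corank2_shadow s A : wcard N.-1 (wshadow (N - 2) A) =
  bcard (ab s) N.-1 (bshadow (ab s) (N - 2) (fun u => A (s, u))) +
  bcard (ab (~~ s)) N.-1 (bshadow (ab (~~ s)) (N - 2) (fun u => A (~~ s, u))).
Proof.
have E : N.-1 = (N - 2).+1 by lia.
by rewrite E (wcard_shadow _ _ s) //; [apply: regularE; lia | lia].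
Qed.

Lemma corank2_side s : wcard N.-1 (wshadow (N - 2) (side s)) = n s.
Proof.
have E : N.-1 = (N - 2).+1 by lia.
by rewrite E wcard_shadow_side -?E ?wN1 //; [apply: regularE; lia | lia].
Qed.

Lemma corank2_exists s q : q <= w s 2 + w (~~ s) 2 ->
  exists2 U, upset wlev ord (N - 2) U & wcard (N - 2) U = q.
Proof.
move=> qw; apply: upset_exists ord_mac _ _ _.
by rewrite (size_wlev _ s) ?w_co //; [lia.. | apply: regularE; lia].
Qed.

Lemma side_up s d : upset wlev ord 1 (side s) -> 0 < d -> d < N ->
  upset wlev ord d (side s).
Proof. by move=> up1 d0 dN; apply: (upset_side_mono ord_mac _ d0 _ up1); rewrite ?regularE. Qed.

(** In codegree 2, a segment as large as the other side contains side [s]. Its shadow contains all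
    [n s] coatoms of side [s], hence at most [n (~~ s) - n s] of the other, which is very few for
    the number of elements below them. *)
Lemma side_first_neq s : 0 < n s -> n s < n (~~ s) -> upset wlev ord 1 (side s) ->
  [/\ n s = 1, n (~~ s) = 2 & 0 < t (~~ s)].
Proof.
move=> n0 nm up1; have up2 := side_up up1 (_ : 0 < N - 2) (_ : N - 2 < N).
have r2 : regular (N - 2) by apply: regularE; lia.
have {}up2 : upset wlev ord (N - 2) (side s) by apply: up2; lia.
have [|V upV cV] := @corank2_exists s (w (~~ s) 2); first by lia.
have N2 : 2 <= N by lia.
have tri_nm : 'C((n (~~ s)).+1, 2) =
    'C((n s).+1, 2) + 'C((n (~~ s) - n s).+1, 2) + n s * (n (~~ s) - n s).
  by rewrite -tri_add; congr ('C(_.+1, 2)); lia.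
have nmd : n s + (n (~~ s) - n s) <= n s * (n (~~ s) - n s) + 1 by nia.
have dtri : n (~~ s) - n s <= 'C((n (~~ s) - n s).+1, 2) by rewrite binS bin1; lia.
have := w2 s; have := w2 (~~ s); have := t_le (~~ s); have := t_le s => ts ts' w2s' w2s.
have Vs := upset_side_sub ord_mac r2 up2 upV.
rewrite w_co // cV in Vs; have {}Vs := Vs (_ : w s 2 <= w (~~ s) 2).
have {}Vs : bcard (ab s) (N - 2) (fun u => V (s, u)) = w s 2 by apply: Vs; lia.
have := upset_optimal ord_mac (A := side (~~ s)) upV.
rewrite wcard_side // w_co // cV => /(_ erefl).
have -> : (N - 2).+1 = N.-1 by lia.
rewrite corank2_side (corank2_shadow s).
have -> : bcard (ab s) N.-1 (bshadow (ab s) (N - 2) (fun u => V (s, u))) = n s.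
  rewrite -wN1 -card_predT; have E : N.-1 = (N - 2).+1 by lia.
  rewrite E; apply/eq_card/bshadow_full/card_full; rewrite Vs w_co //.
have [z [h1 h2 h3]] := corank2_bound (~~ s) (fun u => V (~~ s, u)).
move: cV; rewrite (wcardE _ _ s) // Vs => cV.
move: h1 h2 h3; set r := bcard _ N.-1 _ => h1 h2 h3 rle.
have rd : r <= n (~~ s) - n s by lia.
have tri_r : 'C(r.+1, 2) + (n (~~ s) - n s) <= 'C((n (~~ s) - n s).+1, 2) + r.
  rewrite !binS !bin1; have := @leq_bin2l r (n (~~ s) - n s) 2 rd; lia.
(* [h1] bounds the rest of the segment by binomials in [r]; [h3] trades the caps 2 for at most
   [n (~~ s) - r], and the quadratic terms cancel. What survives forces a difference of 1 and no cap
   2 on side [s]. *)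
have nd : n s * (n (~~ s) - n s) + t s <= n s by lia.
have d1 : n (~~ s) - n s = 1 by nia.
have t0 : t s = 0 by move: nd; rewrite d1 muln1; lia.
have tn : n s <= t (~~ s).
  by move: h1 h3 tri_nm tri_r rd; rewrite d1 muln1 (_ : 'C(2, 2) = 1) //; lia.
(* In degree 1 the segment [W] is side [s] and one more variable. Its optimality against the other
   side leaves that side at most one cap 2, while [tn] demands at least [n s]. *)
have [|W upW cW] := @upset1_exists s (n (~~ s)); first by lia.
have [x [y [z' [cWE sWE [hx1 hx2 hx3] [hy1 hy2 hy3]]]]] := shadow1 s W.
have Ws : level1_count s W = n s.
  rewrite /level1_count -w1.
  by apply: (upset_side_sub ord_mac _ up1 upW); rewrite ?w1 ?regularE //; lia.
have Ws' : level1_count (~~ s) W = 1 by lia.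
have := shadow1_side_le upW cW; rewrite sWE.
rewrite Ws subnn in hx1; rewrite Ws' (_ : n (~~ s) - 1 = n s) in hy1 hy2; last by lia.
rewrite Ws' in hy3; rewrite (_ : 'C(1, 2) = 0) // in hx1.
by move=> h; split; lia.
Qed.

(** In codegree 2 a segment as large as side [s] lies inside the other side, and its shadow has at
    most [n s] elements. The bound by quadratic monomials is then tight, which leaves at most one
    cap 2 on the larger side. *)
Lemma side_second_neq s : n (~~ s) = (n s).+1 -> 1 < n s -> t s = 0 ->
  n s <= t (~~ s) -> upset wlev ord 1 (side (~~ s)) -> False.
Proof.
move=> nm n1 t0 tn up1.
have r2 : regular (N - 2) by apply: regularE; lia.
have N2 : 2 <= N by lia.
have up2 : upset wlev ord (N - 2) (side (~~ s)) by apply: side_up => //; lia.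
have := w2 s; have := w2 (~~ s); have := t_le (~~ s); rewrite nm binS bin1 t0 => ts' w2s' w2s.
have [|V upV cV] := @corank2_exists s (w s 2); first by lia.
have sub : {in wlev (N - 2), forall x, V x -> side (~~ s) x}.
  case: (ord_mac (N - 2)) => od _; apply: (upset_nested od upV up2).
  by rewrite wcard_side // w_co // cV; lia.
have Vs : bcard (ab s) (N - 2) (fun u => V (s, u)) = 0.
  rewrite -[RHS](card_pred0 (box (ab s)) (N - 2)); apply: eq_card => u ud.
  apply/negP => /sub; rewrite mem_wlev // /side /= => /(_ ud).
  by case: (s).
have := upset_optimal ord_mac (A := side s) upV.
rewrite wcard_side // w_co // cV => /(_ erefl).
have -> : (N - 2).+1 = N.-1 by lia.
rewrite corank2_side (corank2_shadow s).
have [z [h1 h2 h3]] := corank2_bound (~~ s) (fun u => V (~~ s, u)).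
move: cV; rewrite (wcardE _ _ s) // Vs => cV.
move: h1 h2 h3; set r := bcard (ab (~~ s)) N.-1 _ => h1 h2 h3 rle.
have rn : r <= n s by lia.
have := @leq_bin2l r.+1 (n s).+1 2 rn => rtri.
have [rs|rs|rs] := ltngtP r (n s); [|by lia|by move: h1 h3; rewrite rs nm; lia].
have := @leq_bin2l r.+1 (n s) 2 rs; move: w2s; rewrite binS bin1; lia.
Qed.

Lemma size_neq s : 0 < n s -> n s < n (~~ s) ->
  [/\ n s = 1, n (~~ s) = 2 & 0 < t (~~ s)].
Proof.
move=> n0 nm; have [U [x [upU pr h1 h2 h3]]] := first_atoms (ltnW nm).
move: pr h1 h2 h3; set p := level1_count s U; set r := level1_count (~~ s) U.
move=> pr h1 h2 h3; have [r0|r0] := posnP r.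
  by apply: side_first_neq => //; apply: (upset1_side upU) => //; rewrite -/p; lia.
have hr : r * (p + (n (~~ s) - n s)) <= r by lia.
have pd : p + (n (~~ s) - n s) <= 1 by nia.
have p0 : p = 0 by lia.
have nmS : n (~~ s) = (n s).+1 by lia.
have rn : r = n s by lia.
move: h1 h2 h3; rewrite p0 rn nmS subSn // subnn muln1 => h1 h2 h3.
have [n1|n1] := leqP (n s) 1; first by split; lia.
case: (@side_second_neq s) => //; [lia..|].
(* [V] contains the previous segment, so it is the whole larger side or misses just one of its
   variables; in the latter case its shadow is too large. *)
have [|V upV cV] := @upset1_exists s (n (~~ s)); first by lia.
have [x' [y [z [cVE sVE [hx1 hx2 hx3] [hy1 hy2 hy3]]]]] := shadow1 s V.
have Vr : n s <= level1_count (~~ s) V.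
  rewrite -rn; apply: sub_card => u ud; case: (ord_mac 1) => od _.
  apply: (upset_nested od upU upV); last by rewrite mem_wlev ?regularE //; lia.
  by rewrite cV; have [? [? [? [-> _ _ _]]]] := shadow1 s U; lia.
have := level1_le (~~ s) V; rewrite nmS leq_eqVlt ltnS => /orP[/eqP Vn|Vn].
  by apply: (upset1_side upV); rewrite ?negbK ?nmS //; lia.
have := shadow1_side_le upV cV; rewrite sVE.
have Vs : level1_count s V = 1 by lia.
have Vs' : level1_count (~~ s) V = n s by lia.
rewrite Vs in hx1; rewrite Vs' nmS (_ : (n s).+1 - n s = 1) in hy1; last by lia.
have nE : 'C((n s).+1, 2) = 'C((n s - 1).+1, 2) + n s.
  have -> : (n s - 1).+1 = n s by lia.
  by rewrite binS bin1.
by rewrite nE in hx1; rewrite nmS (_ : 'C(2, 2) = 1) // in hy1 *; lia.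
Qed.

(** Comparison with both sides bounds the number [p * r] of mixed products by [p] and by [r]. So the
    first variables all lie on one side, or there is one from each. *)
Lemma first_atoms_eq s : n s = n (~~ s) ->
  (exists q, upset wlev ord 1 (side q)) \/ [/\ n s = 2, t s = 1 & t (~~ s) = 1].
Proof.
move=> nm; have [|U upU cU] := @upset1_exists s (n s); first by lia.
have [x [y [z [cUE sUE [hx1 hx2 hx3] [hy1 hy2 hy3]]]]] := shadow1 s U.
move: cUE hx1 hx2 hx3 hy1 hy2 hy3.
have := shadow1_side_le upU cU.
have := shadow1_side_le (q := ~~ s) upU; rewrite -nm => /(_ cU); rewrite sUE.
have pside := upset1_side (s := s) upU; have := upset1_side (s := ~~ s) upU.
rewrite negbK -nm => rside.
set p := level1_count s U in pside rside *; set r := level1_count (~~ s) U in pside rside *.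
move=> opt1 opt2 cUE; have pr : p + r = n s by rewrite -cUE.
have [-> ->] : n s - p = r /\ n s - r = p by lia.
have tpr := tri_add p r; rewrite pr in tpr; move=> hx1 hx2 hx3 hy1 hy2 hy3.
have [r0|r0] := posnP r; first by left; exists s; apply: pside => //; lia.
have [p0|p0] := posnP p; first by left; exists (~~ s); apply: rside => //; lia.
right; have h1 : p * r <= p by lia.
have h2 : p * r <= r by lia.
have r1 : r = 1 by nia.
have p1 : p = 1 by nia.
by rewrite r1 p1 in pr tpr hx1 hx2 hx3 hy1 hy2 hy3 h1 *; split; lia.
Qed.

(** Suppose equality in degree [d - 1]. Optimality of side [q] there gives one inequality in degree
    [d]. If it were strict, then in degree [N - d] a segment as large as the other side would
    contain side [q] and something more; its shadow would contain all of side [q], which by duality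
    is already as large as the whole other side, and at least one further element. *)
Lemma hilbert_le q : n q = n (~~ q) -> upset wlev ord 1 (side q) ->
  forall d, w q d = w (~~ q) d.
Proof.
move=> nm up1 d.
have rest e : (e == 0) || (N <= e) -> w q e = w (~~ q) e.
  case/orP=> [/eqP->|]; first by rewrite !size_box0 ?all_leq2.
  rewrite leq_eqVlt => /orP[/eqP<-|Ne]; last by rewrite !box_gt_top ?abN.
  by rewrite -{1}(abN q) -(abN (~~ q)) !size_box_top ?all_leq2.
have [m] := ubnP d; elim: m d => // m IHm d; rewrite ltnS => dm.
have [/rest //|] := boolP ((d == 0) || (N <= d)).
rewrite negb_or -lt0n -ltnNge => /andP[d0 dN].
have [->|d1] := eqVneq d 1; first by rewrite !w1.
have wd1 : w q d.-1 = w (~~ q) d.-1 by apply: IHm; lia.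
apply/eqP; rewrite eqn_leq; apply/andP; split.
  have r1 : regular d.-1 by apply: regularE; lia.
  have dE : d = d.-1.+1 by lia.
  have rd : regular d.-1.+1 by apply: regularE; lia.
  have upd : upset wlev ord d.-1 (side q) by apply: side_up => //; lia.
  have := upset_optimal ord_mac (A := side (~~ q)) upd.
  have d1p : 0 < d.-1 by lia.
  by rewrite !wcard_side // wd1 => /(_ erefl); rewrite !wcard_shadow_side // -dE.
rewrite leqNgt; apply/negP => lt_w.
have rN : regular (N - d) by apply: regularE; lia.
have rN1 : regular (N - d).+1 by apply: regularE; lia.
have Nd0 : 0 < N - d by lia.
have upN : upset wlev ord (N - d) (side q) by apply: side_up => //; lia.
have wq s : w s (N - d) = w s d by rewrite w_co // ltnW.
have [|V upV cV] := upset_exists ord_mac (d := N - d) (q := w (~~ q) d).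
  by rewrite (size_wlev _ q) // !wq leq_addl.
have := upset_optimal ord_mac (A := side (~~ q)) upV.
rewrite wcard_side // wq cV => /(_ erefl); rewrite wcard_shadow_side //.
have NdE : (N - d).+1 = N - d.-1 by lia.
have Vq : bcard (ab q) (N - d) (fun u => V (q, u)) = w q d.
  by rewrite -wq; apply: (upset_side_sub ord_mac rN upN upV); rewrite wq cV ltnW.
rewrite (wcard_shadow _ _ q) //; apply/negP; rewrite -ltnNge.
have -> : bcard (ab q) (N - d).+1 (bshadow (ab q) (N - d) (fun u => V (q, u))) =
    w (~~ q) (N - d).+1.
  rewrite NdE w_co -?wd1; last by lia.
  rewrite -[w q _]w_co -?NdE; last by lia.
  by rewrite -card_predT; apply/eq_card/bshadow_full/card_full; rewrite Vq wq.
rewrite -[ltnLHS]addn0 ltn_add2l; apply: card_shadow_gt0; first by rewrite abN; lia.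
by move: cV; rewrite (wcardE _ _ q) // Vq; lia.
Qed.

End MacaulayConnectedSum.

(** * L-shaped posets *)

(* [x], resp. [y], tells whether the left, resp. right, end of an interval of
   length [w] loses a neighbour in the next level. *)
Definition growth (x y : bool) w K :=
  if K == 0 then 0
  else if x && y then (if K < w then K else K.-1)
  else if x || y then K else K.+1.

Lemma growth_le (x y : bool) S l h :
  growth x y (h - l) (cnt S l h) <= cnt (step S) (l + x) (h + ~~ y).
Proof.
rewrite /growth; case: eqP => // /eqP; rewrite -lt0n => K0.
case: x; case: y; rewrite /= ?addn0 ?addn1.
- by case: ltnP => Kw; [exact: step_lossy | have := step_lossy_full S l h; lia].
- exact: step_shift.
- exact: step_stay.
- exact: step_free.
Qed.

Lemma cnt0 S x y : (forall i, x <= i < y -> ~~ S i) -> cnt S x y = 0.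
Proof. by move=> nS; rewrite /cnt big_nat big1 // => i /nS/negPf->. Qed.

Lemma cnt_restrict (S : pred nat) m n l h : m <= l -> h <= n ->
  (forall i, m <= i < n -> S i -> l <= i < h) -> cnt S m n = cnt S l h.
Proof.
move=> ml hn Slh; have out i : m <= i < n -> ~~ (l <= i < h) -> ~~ S i.
  by move=> mi; apply/contra/Slh.
have [hl|lh] := leqP h l.
  by rewrite [RHS]/cnt big_geq // cnt0 // => i mi; apply: out => //; lia.
rewrite (@cnt_cat S m l n); [|lia..]; rewrite (@cnt_cat S l h n); [|lia..].
by rewrite (@cnt0 _ m) ?(@cnt0 _ h) ?addn0 // => i hi; apply: out; lia.
Qed.

(** An interval attains the bound of [growth_le] as soon as it abuts an end where a place is lost,
    if there is such an end. *)
Lemma growth_itv (x y : bool) (S : pred nat) lo hi l h :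
  x || (lo == 0) -> y || ~~ S hi -> lo <= l -> h <= hi ->
  (forall i, lo <= i < hi -> S i = (l <= i < h)) ->
  (h <= l) || (if x then (l == lo) || y && (h == hi) else y ==> (h == hi)) ->
  cnt (step S) (lo + x) (hi + ~~ y) <= growth x y (hi - lo) (cnt S lo hi).
Proof.
move=> x0 y0 lol hhi SE touch.
have -> : cnt S lo hi = h - l by rewrite (cnt_eq SE) cnt_itv; lia.
have SE' i : lo + x <= i.+1 -> i < hi + ~~ y -> S i -> l <= i < h.
  move=> i1 i2 Si; rewrite -SE //; apply/andP; split.
    by move: i1; case: x x0 {touch} => /=; lia.
  rewrite ltnNge; apply/negP => hii; have ihi : i = hi by move: i2; case: (y); lia.
  by move: y0; rewrite -ihi Si orbF => yT; move: i2; rewrite yT; lia.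
apply: (@leq_trans (cnt (fun i => l <= i < if l < h then h.+1 else l) (lo + x) (hi + ~~ y))).
  apply: cnt_le => i ix /orP[Si|/andP[i0 Si]].
    by have := SE' i _ _ Si; case: ifP; lia.
  by have := SE' i.-1 _ _ Si; case: ifP; lia.
rewrite cnt_itv /growth; case: (ltnP l h) => lh; last by lia.
by move: touch; clear -lol hhi lh; case: x; case: y => /=; repeat case: ifP; lia.
Qed.

Lemma cnt_restrict2 (S : pred nat) l h l' h' n : h <= l' -> h <= n -> h' <= n ->
  (forall i, i < n -> S i -> (l <= i < h) || (l' <= i < h')) ->
  cnt S 0 n = cnt S l h + cnt S l' h'.
Proof.
move=> hl' hn hn' Slh; rewrite (@cnt_cat S 0 h n) //.
congr (_ + _); apply: cnt_restrict => // i hi Si; have := Slh i _ Si; lia.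
Qed.

Section LShape.
Variables a0 a1 b0 b1 : nat.

Definition in_L i j := (i < a0) && (j < a1) || (i < b0) && (j < b1).

Definition lshape d := [seq (i, d - i) | i <- iota 0 d.+1 & in_L i (d - i)].

Definition lcov (d : nat) (x y : nat * nat) :=
  (y.1 == x.1.+1) && (y.2 == x.2) || (y.1 == x.1) && (y.2 == x.2.+1).

Local Notation lcard := (card lshape).
Local Notation lshadow := (shadow lshape lcov).

Definition row d i := (i <= d) && in_L i (d - i).

Definition slice d (A : pred (nat * nat)) : pred nat := fun i => row d i && A (i, d - i).

Lemma mem_lshape d i j : ((i, j) \in lshape d) = (i + j == d) && in_L i j.
Proof.
apply/mapP/andP => [[i']|[/eqP <- ij]].
  rewrite mem_filter mem_iota => /andP[h hi] [-> ->]; rewrite h; split=> //.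
  by apply/eqP; lia.
by exists i; rewrite ?addKn // mem_filter mem_iota addKn ij; lia.
Qed.

Lemma uniq_lshape d : uniq (lshape d).
Proof. by rewrite map_inj_uniq ?filter_uniq ?iota_uniq // => i j []. Qed.

Lemma card_lshape d A : lcard d A = cnt (slice d A) 0 d.+1.
Proof.
rewrite -count_iota_cnt /index_iota subn0 /card count_map count_filter.
by apply: eq_in_count => i; rewrite mem_iota add0n ltnS /slice /row /= => ->; rewrite andbC.
Qed.

Lemma row_pred d i : row d.+1 i -> row d i || (0 < i) && row d i.-1.
Proof. by rewrite /row /in_L; lia. Qed.

Lemma shadow_slice d A i : row d.+1 i ->
  lshadow d A (i, d.+1 - i) = step (slice d A) i.
Proof.
move=> ri; have id : i <= d.+1 by case/andP: ri.
apply/shadowP/orP => [[[k l] [kld Akl /=]]|].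
  move: kld; rewrite mem_lshape /lcov /= => /andP[/eqP kl in_kl].
  have [lE rk] : l = d - k /\ row d k.
    by rewrite /row; split; [|move: in_kl; rewrite -kl addKn => ->]; lia.
  case/orP=> /andP[/eqP ik _].
    by right; rewrite ik /slice /= rk -lE.
  by left; rewrite ik /slice rk -lE.
have mem k : row d k -> (k, d - k) \in lshape d.
  by rewrite mem_lshape => /andP[kd ->]; rewrite subnKC ?eqxx.
case=> [/andP[rk Ak]|/andP[i0 /andP[rk Ak]]].
  exists (i, d - i); split; rewrite ?mem //; rewrite /lcov /= eqxx /=.
  by case/andP: rk => ? _; apply/orP; right; lia.
exists (i.-1, d - i.-1); split; rewrite ?mem // /lcov /=.
by case/andP: rk => ? _; apply/orP; left; lia.
Qed.

Hypotheses (a1_gt0 : 0 < a1) (b0_gt0 : 0 < b0) (ba0 : b0 <= a0) (ab1 : a1 <= b1).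

Lemma row_single d i : d < a1 + b0 ->
  row d i = (d.+1 - b1 <= i < minn a0 d.+1).
Proof. by rewrite /row /in_L; lia. Qed.

Lemma row_split d i : a1 + b0 <= d.+1 ->
  row d i = (d.+1 - b1 <= i < b0) || (d.+1 - a1 <= i < minn a0 d.+1).
Proof. by rewrite /row /in_L; lia. Qed.

Lemma card_single d A : d < a1 + b0 ->
  lcard d A = cnt (slice d A) (d.+1 - b1) (minn a0 d.+1).
Proof.
move=> dab; rewrite card_lshape; apply: cnt_restrict; [lia..|].
by move=> i _ /andP[]; rewrite row_single.
Qed.

Lemma card_split d A : a1 + b0 <= d.+1 ->
  lcard d A = cnt (slice d A) (d.+1 - b1) b0 +
                    cnt (slice d A) (d.+1 - a1) (minn a0 d.+1).
Proof.
move=> dab; rewrite card_lshape; apply: cnt_restrict2; [lia..|].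
by move=> i _ /andP[]; rewrite row_split.
Qed.

Lemma card_shadow_single d A : d.+1 < a1 + b0 ->
  lcard d.+1 (lshadow d A) =
  cnt (step (slice d A)) (d.+2 - b1) (minn a0 d.+2).
Proof.
move=> dab; rewrite card_single //; apply: cnt_eq => i; rewrite -row_single // => ri.
by rewrite /slice ri shadow_slice.
Qed.

Lemma card_shadow_split d A : a1 + b0 <= d.+1 ->
  lcard d.+1 (lshadow d A) =
  cnt (step (slice d A)) (d.+2 - b1) b0 +
  cnt (step (slice d A)) (d.+2 - a1) (minn a0 d.+2).
Proof.
move=> dab; rewrite card_split; last by lia.
by congr (_ + _); apply: cnt_eq => i hi;
  have ri : row d.+1 i by [rewrite row_split ?hi ?orbT //; lia];
  rewrite /slice ri shadow_slice.
Qed.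

Lemma growth_single d A : d.+1 < a1 + b0 ->
  growth (b1 <= d.+1) (a0 <= d.+1) (minn a0 d.+1 - (d.+1 - b1)) (lcard d A) <=
  lcard d.+1 (lshadow d A).
Proof.
move=> dab; rewrite card_single ?card_shadow_single //; last by lia.
have := growth_le (b1 <= d.+1) (a0 <= d.+1) (slice d A) (d.+1 - b1) (minn a0 d.+1).
by congr (_ <= cnt _ _ _); lia.
Qed.

Lemma growth_split d A : a1 + b0 <= d.+1 ->
  growth (b1 <= d.+1) true (b0 - (d.+1 - b1)) (cnt (slice d A) (d.+1 - b1) b0) +
  growth true (a0 <= d.+1) (minn a0 d.+1 - (d.+1 - a1))
    (cnt (slice d A) (d.+1 - a1) (minn a0 d.+1)) <=
  lcard d.+1 (lshadow d A).
Proof.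
move=> dab; rewrite card_shadow_split //; apply: leq_add.
  have := growth_le (b1 <= d.+1) true (slice d A) (d.+1 - b1) b0.
  by congr (_ <= cnt _ _ _); lia.
have := growth_le true (a0 <= d.+1) (slice d A) (d.+1 - a1) (minn a0 d.+1).
by congr (_ <= cnt _ _ _); lia.
Qed.

Section Order.
Hypotheses (b1a0 : b1 <= a0) (b_le_a : b0 + b1 <= a0 + a1).

(* Where the initial segments of the level [d] start: they first grow to the
   left of [start d], then to the right. *)
Definition start d := if a1 + b0 < b1 then minn (d - a1) b0.-1 else 0.
Definition key d i := if i <= start d then start d - i else i.
(** Small keys are large in the order, since segments consist of the largest elements. *)
Definition lord (x y : nat * nat) := key (x.1 + x.2) y.1 <= key (x.1 + x.2) x.1.
Local Notation lupset := (upset lshape lord).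

Lemma start_gt0 d t : 0 < t <= start d -> a1 + b0 < b1.
Proof. by rewrite /start; case: ifP; lia. Qed.

Lemma key_asc d i : b1 <= a1 + b0 -> key d i = i.
Proof. by move=> ab; rewrite /key /start ltnNge ab /= leqn0; case: i. Qed.

Lemma key_inj d : injective (key d).
Proof. by move=> i j; rewrite /key; repeat case: ifP; lia. Qed.

Lemma lshape_order d : level_order lshape lord d.
Proof.
have sumd (x : nat * nat) : x \in lshape d -> x.1 + x.2 = d.
  by case: x => i j; rewrite mem_lshape => /andP[/eqP].
have anti (i j i' j' : nat) : (i, j) \in lshape d -> (i', j') \in lshape d ->
    lord (i, j) (i', j') && lord (i', j') (i, j) -> (i, j) = (i', j').
  move=> /sumd/= ijd /sumd/= ijd'; rewrite /lord /= ijd ijd' => h.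
  have ii' : i = i' by apply: (@key_inj d); apply/eqP; rewrite eqn_leq andbC.
  by congr pair; lia.
split=> [x y|[i j] [i' j']|x y z] xd yd; [|exact: anti|]; rewrite /lord.
- by rewrite !sumd // leq_total.
- by move=> zd; rewrite !sumd // => h1 h2; apply: leq_trans h2 h1.
Qed.

Lemma upset_key d U : lupset d U ->
  exists t, forall i, row d i -> U (i, d - i) = (key d i < t).
Proof.
move=> upU; pose P t := all (fun x => U x ==> (key d x.1 < t)) (lshape d).
have exP : exists t, P t.
  exists (\max_(x <- lshape d) key d x.1).+1; apply/allP => x xd.
  by apply/implyP => _; rewrite ltnS; apply: leq_bigmax_seq.
case: (ex_minnP exP) => t /allP tP tmin; exists t => i ri.
have mem k : row d k -> (k, d - k) \in lshape d.
  by rewrite mem_lshape => /andP[kd ->]; rewrite subnKC ?eqxx.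
have id : i <= d by case/andP: ri.
apply/idP/idP => [Ui|it]; first by have := tP _ (mem i ri); rewrite Ui.
case: t tP tmin it => // t tP tmin it.
have /allPn[[k l] kld] : ~~ P t by apply/negP => /tmin; rewrite ltnn.
rewrite negb_imply -leqNgt /= => /andP[Ukl tk].
have kl : k + l = d by move: kld; rewrite mem_lshape => /andP[/eqP].
by apply: (upU _ _ kld (mem _ ri) Ukl); rewrite /lord /= kl; apply: leq_trans tk.
Qed.

Definition key_below d t : pred nat := fun i => row d i && (key d i < t).

Lemma slice_key d U t : (forall i, row d i -> U (i, d - i) = (key d i < t)) ->
  slice d U =1 key_below d t.
Proof. by move=> Ut i; rewrite /slice /key_below; apply: andb_id2l => /Ut. Qed.

Lemma step_key_asc d t i k : b1 <= a1 + b0 -> row d.+1 k -> k <= i ->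
  step (key_below d t) i ->
  step (key_below d t) k.
Proof.
move=> ab /row_pred rk ki; rewrite /step /key_below !key_asc //.
have [->//|ki'] : k = i \/ k < i by lia.
case/orP=> [/andP[_ it]|/andP[_ /andP[_ it]]].
  by case/orP: rk => [->|/andP[-> ->]]; rewrite ?orbT ?andTb; apply/orP; [left|right]; lia.
by case/orP: rk => [->|/andP[-> ->]]; apply/orP; [left|right]; lia.
Qed.

Lemma step_key_single d t k : a1 + b0 < b1 -> d.+1 < a1 + b0 -> row d.+1 k ->
  step (key_below d t) k = (0 < t) && (key d.+1 k <= t).
Proof.
move=> ab dab; rewrite row_single // => rk.
have startE e : e < a1 + b0 -> start e = e - a1 by rewrite /start ab; lia.
have rowE e : row d e = (e <= d) by rewrite row_single; lia.
have kd : k <= d.+1 by lia.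
rewrite /step /key_below /key !startE ?(ltnW dab) // !rowE => {rk ab startE rowE}.
case: (posnP k) => [->|k0]; first by rewrite /= !subn0 ?orbF; lia.
rewrite /= (_ : k.-1 <= d); last by lia.
have [kda|kda] := leqP k.-1 (d - a1); have [kda'|kda'] := leqP k (d - a1);
  have [kda''|kda''] := leqP k (d.+1 - a1); lia.
Qed.

Lemma step_key_left d t k : a1 + b0 < b1 -> a1 + b0 <= d.+1 -> row d.+1 k -> k < b0 ->
  step (key_below d t) k = (b0 - k <= t).
Proof.
move=> ab dab; rewrite row_split ?(leqW dab) // => rk kb.
have startE : start d = b0.-1 by rewrite /start ab; lia.
have rkd : row d k by rewrite row_split //; apply/orP; left; lia.
have [kE kE'] : k <= b0.-1 /\ k.-1 <= b0.-1 by lia.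
rewrite /step /key_below /key startE rkd kE kE' /= => {rk rkd}.
by case: (row _ _) => /=; lia.
Qed.

Lemma step_key_right d t k : a1 + b0 < b1 -> a1 + b0 <= d.+1 -> row d.+1 k -> b0 <= k ->
  b0 < k /\ step (key_below d t) k = (k <= t).
Proof.
move=> ab dab; rewrite row_split ?(leqW dab) // => rk kb.
have startE : start d = b0.-1 by rewrite /start ab; lia.
have kb' : b0 < k by lia.
have rkd : row d k.-1 by rewrite row_split //; apply/orP; right; lia.
have [kE kE'] : (k <= b0.-1) = false /\ (k.-1 <= b0.-1) = false by lia.
split=> //; rewrite /step /key_below /key startE rkd kE kE' /= => {rk rkd}.
by case: (row _ _) => /=; lia.
Qed.

(** Before the inner corner, and on either leg after it, the shadow of a set cut out by a bound on
    the key is cut out in the same way; the cases differ in how [start] moves with the degree. *)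
Lemma step_key_mono d t i k : row d.+1 i -> row d.+1 k -> key d.+1 k <= key d.+1 i ->
  step (key_below d t) i ->
  step (key_below d t) k.
Proof.
move=> ri rk; have [ab|ab] := ltnP (a1 + b0) b1; last first.
  by rewrite !(key_asc d.+1) // => ki; apply: step_key_asc ki.
have [dab|dab] := ltnP d.+1 (a1 + b0).
  by rewrite !step_key_single // => ki /andP[-> it]; apply: leq_trans it.
have startE : start d.+1 = b0.-1 by rewrite /start ab; lia.
rewrite /key startE; have [kb|kb] := ltnP k b0; have [ib|ib] := ltnP i b0.
- by rewrite !step_key_left // !ifT; lia.
- have [ib' ->] := step_key_right t ab dab ri ib.
  by rewrite step_key_left // ifT ?ifF; lia.
- have [kb' ->] := step_key_right t ab dab rk kb.
  by rewrite step_key_left // ifF ?ifT; lia.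
- have [ib' ->] := step_key_right t ab dab ri ib.
  have [kb' ->] := step_key_right t ab dab rk kb.
  by rewrite !ifF; lia.
Qed.

Lemma eq_step (S S' : pred nat) : S =1 S' -> step S =1 step S'.
Proof. by move=> SS' i; rewrite /step !SS'. Qed.

Lemma upset_shadow d U : lupset d U ->
  lupset d.+1 (lshadow d U).
Proof.
move=> /upset_key[t /slice_key/eq_step Ut] [i j] [k l].
rewrite !mem_lshape => /andP[/eqP ij in_ij] /andP[/eqP kl in_kl].
have [jE lE] : j = d.+1 - i /\ l = d.+1 - k by lia.
have ri : row d.+1 i by rewrite /row -jE in_ij; lia.
have rk : row d.+1 k by rewrite /row -lE in_kl; lia.
rewrite /lord /= ij jE lE !shadow_slice // !Ut => Si ki.
exact: step_key_mono ki Si.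
Qed.

Lemma key_ltE d i t : (key d i < t) =
  if 0 < t <= start d then start d - t < i <= start d else i < t.
Proof.
by rewrite /key; case: (leqP t (start d)) => ts; case: (leqP i (start d)) => si;
  case: (posnP t) => t0 /=; lia.
Qed.

Lemma start_lt d : start d < b0.
Proof. by rewrite /start; case: ifP; lia. Qed.

Lemma growth_upset_single d U : lupset d U -> d.+1 < a1 + b0 ->
  lcard d.+1 (lshadow d U) <=
  growth (b1 <= d.+1) (a0 <= d.+1) (minn a0 d.+1 - (d.+1 - b1)) (lcard d U).
Proof.
move=> /upset_key[t /slice_key Ut] dab.
rewrite card_shadow_single // card_single ?(ltnW dab) //.
have -> : d.+2 - b1 = d.+1 - b1 + (b1 <= d.+1) by lia.
have -> : minn a0 d.+2 = minn a0 d.+1 + ~~ (a0 <= d.+1) by lia.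
have inner i : d.+1 - b1 <= i < minn a0 d.+1 -> slice d U i = (key d i < t).
  by move=> hi; rewrite Ut /key_below row_single ?(ltnW dab) // hi.
have outer : (a0 <= d.+1) || ~~ slice d U (minn a0 d.+1).
  by case: leqP => //= ad; rewrite Ut /key_below /row ltnn.
have lo0 : (b1 <= d.+1) || (d.+1 - b1 == 0) by lia.
case ts: (0 < t <= start d).
  have ab := start_gt0 ts.
  have startE : start d = d - a1 by rewrite /start ab; lia.
  apply: (growth_itv (l := maxn (d.+1 - b1) (start d - t).+1) (h := (start d).+1)) => //.
  - by lia.
  - by lia.
  - by move=> i hi; rewrite inner // key_ltE ts; lia.
  - have [-> ->] : (b1 <= d.+1) = false /\ (a0 <= d.+1) = false by lia.
    by rewrite orbT.
apply: (growth_itv (l := d.+1 - b1) (h := maxn (d.+1 - b1) (minn t (minn a0 d.+1)))) => //.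
- by lia.
- by move=> i hi; rewrite inner // key_ltE ts; lia.
apply/orP; right; case: leqP => h; first by rewrite eqxx.
by have -> : (a0 <= d.+1) = false by lia.
Qed.

Lemma growth_upset_split d U : lupset d U -> a1 + b0 <= d.+1 ->
  let u := cnt (slice d U) (d.+1 - b1) b0 in
  let v := cnt (slice d U) (d.+1 - a1) (minn a0 d.+1) in
  (0 < v -> u = b0 - (d.+1 - b1)) /\
  lcard d.+1 (lshadow d U) <=
  growth (b1 <= d.+1) true (b0 - (d.+1 - b1)) u +
  growth true (a0 <= d.+1) (minn a0 d.+1 - (d.+1 - a1)) v.
Proof.
move=> /upset_key[t /slice_key Ut] dab u v; have sb := start_lt d.
have innerL i : d.+1 - b1 <= i < b0 -> slice d U i = (key d i < t).
  by move=> hi; rewrite Ut /key_below row_split // hi.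
have innerR i : d.+1 - a1 <= i < minn a0 d.+1 -> slice d U i = (key d i < t).
  by move=> hi; rewrite Ut /key_below row_split // hi orbT.
split.
  move=> /cnt_gt0[i hi]; rewrite innerR // key_ltE; case: ifP => ts; first by lia.
  move=> it; rewrite /u (@cnt_eq _ (fun i => d.+1 - b1 <= i < b0)) ?cnt_itv; first by lia.
  by move=> k hk; rewrite innerL // key_ltE ts; lia.
rewrite card_shadow_split //; apply: leq_add.
  have -> : d.+2 - b1 = d.+1 - b1 + (b1 <= d.+1) by lia.
  rewrite -{1}[b0]addn0 -[0]/(~~ true : nat); case ts: (0 < t <= start d).
    have ab := start_gt0 ts.
    have startE : start d = b0.-1 by rewrite /start ab; lia.
    apply: (growth_itv (l := maxn (d.+1 - b1) (start d - t).+1) (h := b0)) => //.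
    + by lia.
    + by lia.
    + by move=> i hi; rewrite innerL // key_ltE ts; lia.
    + by rewrite eqxx orbT; case: ifP; rewrite orbT.
  apply: (growth_itv (l := d.+1 - b1) (h := minn b0 (maxn (d.+1 - b1) t))) => //.
  - by lia.
  - by lia.
  - by move=> i hi; rewrite innerL // key_ltE ts; lia.
  case: (posnP t) => [t0|t0]; first by apply/orP; left; lia.
  apply/orP; right; case: leqP => h; first by rewrite eqxx.
  have startE : start d = b0.-1 by rewrite /start ifT; lia.
  by rewrite /=; move: ts; rewrite startE; lia.
have -> : d.+2 - a1 = d.+1 - a1 + true by lia.
have -> : minn a0 d.+2 = minn a0 d.+1 + ~~ (a0 <= d.+1) by lia.
have outer : (a0 <= d.+1) || ~~ slice d U (minn a0 d.+1).
  by case: leqP => //= ad; rewrite Ut /key_below /row ltnn.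
apply: (growth_itv (l := d.+1 - a1) (h := minn (minn a0 d.+1)
  (maxn (d.+1 - a1) (if 0 < t <= start d then 0 else t)))) => //.
- by lia.
- by move=> i hi; rewrite innerR // key_ltE; case: ifP; lia.
by rewrite eqxx orbT.
Qed.

(** The left part of a split level is filled first: its left end is lost no later than the right end
    of the other part, by [b1 <= a0], and once both parts shrink it is the shorter one. If
    [a1 + b0 < b1], the split occurs while that left end is still free, so segments must abut [b0].
    This is why they start at the lowest point outside the rectangle [a] and grow to the left. *)
Theorem lshape_macaulay : macaulay_levels lshape lcov.
Proof.
exists lord => d; split=> [|U upU]; first exact: lshape_order.
split=> [|A AU]; first exact: upset_shadow.
have [dab|dab] := ltnP d.+1 (a1 + b0).
  by apply: leq_trans (growth_upset_single upU dab) _; rewrite -AU; apply: growth_single.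
have [uv shU] := growth_upset_split upU dab; have shA := growth_split A dab.
apply: leq_trans shU (leq_trans _ shA); move: AU uv {shA}; rewrite !card_split; [|lia..].
have := cnt_size (slice d A) (d.+1 - b1) b0.
have := cnt_size (slice d A) (d.+1 - a1) (minn a0 d.+1).
have := cnt_size (slice d U) (d.+1 - b1) b0.
have := cnt_size (slice d U) (d.+1 - a1) (minn a0 d.+1).
move: (cnt _ _ _) (cnt _ _ _) (cnt _ _ _) (cnt _ _ _) => p q u v.
rewrite /growth; repeat case: ifP; lia.
Qed.

End Order.
Definition upper (x : nat * nat) := a1 <= x.2.

Lemma slice_upper d i : slice d upper i = (d.+1 - b1 <= i < minn (d.+1 - a1) b0).
Proof.
rewrite /slice /row /in_L /upper /= -!andbA.
by case: (leqP i d) => id; case: (leqP a1 (d - i)) => ai; rewrite ?andbT ?andbF /=; lia.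
Qed.

Lemma card_upper d : lcard d upper = minn (d.+1 - a1) b0 - (d.+1 - b1).
Proof.
rewrite card_lshape (@cnt_eq _ (fun i => d.+1 - b1 <= i < minn (d.+1 - a1) b0)).
  by rewrite cnt_itv; lia.
by move=> i _; apply: slice_upper.
Qed.

(** In degree at least [b1] the first exponent is positive, and lowering it keeps the second one. *)
Lemma shadow_upper d : b1 <= d.+1 ->
  {in lshape d.+1, lshadow d upper =1 upper}.
Proof.
move=> bd [i j]; rewrite mem_lshape => /andP[/eqP ij in_ij].
have jE : j = d.+1 - i by lia.
have ri : row d.+1 i by rewrite /row -jE in_ij; lia.
have -> : upper (i, j) = slice d.+1 upper i by rewrite /slice ri jE.
rewrite jE shadow_slice // /step !slice_upper.
by move: ri => /andP[id /orP[] /andP[h1 h2]]; apply/idP/idP; lia.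
Qed.

Section NotMacaulay.
Hypotheses (b1a0 : b1 < a0) (a_lt_b : a0 + a1 < b0 + b1).
Variable ord : rel (nat * nat).
Hypothesis ord_mac : macaulay_order lshape lcov ord.

(** [a0 - 2] is the last degree from which the right end still gains a place, while the left end
    already loses one. Before the split, a set of this size that leaves the upper part has a gap to
    the left of one of its elements and gains; after it, only the full left interval shrinks. So the
    optimal segment is [upper]. *)
Lemma upset_upper : upset lshape ord (a0 - 2) upper.
Proof.
case: (ord_mac (a0 - 2)) => od mac_d.
have d1 : (a0 - 2).+1 = a0.-1 by lia.
have [U upU cU] := exists_upset od (uniq_lshape _) (card_le_size _ _ upper).
have [_ /(_ _ (esym cU))] := mac_d U upU.
rewrite (eq_card (shadow_upper _)); last by lia.
move=> opt; apply: eq_upset upU => x xd; symmetry.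
apply: (sub_card_eq _ _ xd); last by rewrite cU.
have full i : slice (a0 - 2) upper i -> slice (a0 - 2) U i.
  move: opt cU; rewrite !card_upper slice_upper.
  have [dab|dab] := ltnP (a0 - 2).+1 (a1 + b0).
    rewrite card_shadow_single // card_single; last by lia.
    set S := slice _ _; set lo := (a0 - 2).+1 - b1.
    have -> : (a0 - 2).+2 - b1 = lo.+1 by lia.
    have -> : minn a0 (a0 - 2).+2 = (minn a0 (a0 - 2).+1).+1 by lia.
    set hi := minn a0 _; set m := minn ((a0 - 2).+1 - a1) b0 => opt cU hi_i.
    case Si: (S i) => //; have mhi : lo <= m <= hi by lia.
    have cS := @cnt_cat S lo m hi; have cSm := cnt_size S lo m.
    have [s hs Ss] : exists2 s, m <= s < hi & S s.
      apply: cnt_gt0; rewrite lt0n; apply/negP => /eqP c0.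
      have cSlo : cnt S lo m = m - lo by lia.
      by rewrite (cnt_all cSlo hi_i) in Si.
    have [li [is_ sh]] : lo <= i /\ i < s /\ s < hi by lia.
    have := step_left_gap li is_ sh (negbT Si) Ss; lia.
  move=> opt cU hi_i; have := growth_split U dab; have -> : b1 <= (a0 - 2).+1 by lia.
  have -> : (a0 <= (a0 - 2).+1) = false by lia.
  move: cU; rewrite card_split // => cU gU.
  have cL : cnt (slice (a0 - 2) U) ((a0 - 2).+1 - b1) b0 = b0 - ((a0 - 2).+1 - b1).
    have := cnt_size (slice (a0 - 2) U) ((a0 - 2).+1 - b1) b0.
    move: gU cU opt; rewrite /growth /=; repeat case: ifP; lia.
  by apply: (cnt_all cL); lia.
move=> {x xd} [i j]; rewrite mem_lshape => /andP[/eqP ij in_ij] Uij.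
have jE : j = a0 - 2 - i by lia.
have ri : row (a0 - 2) i by rewrite /row -jE in_ij; lia.
by have := full i; rewrite /slice ri -jE !andTb; apply.
Qed.

Lemma upset_upper_mono d : a0 - 2 <= d -> upset lshape ord d upper.
Proof.
elim: d => [|d IHd] ad; first by have := upset_upper; have -> : a0 - 2 = 0 by lia.
move: ad; rewrite leq_eqVlt => /orP[/eqP<-|ad]; first exact: upset_upper.
have [_ mac_d] := ord_mac d; have [up_d _] := mac_d _ (IHd ad).
by apply: eq_upset up_d; apply: shadow_upper; lia.
Qed.

(** In degree [d] both parts lose a place at both ends. The whole lower part shrinks by one in the
    next degree. It is smaller than [upper], so the segment of its size lies strictly inside [upper]
    and does not shrink. The maximum in [d] ensures that the level is split and the lower part still
    nonempty. *)
Lemma lshape_not_macaulay_order : b0 < a0 -> False.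
Proof.
move=> b0a0; pose d := maxn a0.-1 (a1 + b0).-1.
have dab : a1 + b0 <= d.+1 by lia.
have [od mac_d] := ord_mac d.
pose lower (x : nat * nat) := ~~ upper x.
have sliceR i : slice d lower i = (d.+1 - a1 <= i < a0).
  rewrite /slice row_split // /lower /upper /=.
  by case: (leqP a1 (d - i)) => ai; rewrite ?andbT ?andbF; lia.
have cR : lcard d lower = a0 + a1 - d.+1.
  rewrite card_lshape (cnt_eq (fun i _ => sliceR i)) cnt_itv; lia.
have [V upV cV] := exists_upset od (uniq_lshape _) (card_le_size _ _ lower).
have [_ /(_ _ (esym cV))] := mac_d V upV.
have upE : upset lshape ord d upper by apply: upset_upper_mono; lia.
have VE : {in lshape d, forall x, V x -> upper x}.
  by apply: (upset_nested od upV upE); rewrite cV cR card_upper; lia.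
have VR : cnt (slice d V) (d.+1 - a1) (minn a0 d.+1) = 0.
  apply: cnt0 => i hi; apply/negP => /andP[ri Vi].
  have id : i <= d by case/andP: ri.
  have := VE (i, d - i); rewrite mem_lshape subnKC // eqxx; case/andP: ri => _ -> /(_ isT Vi).
  by rewrite /upper /=; lia.
have := growth_split V dab; move: cV; rewrite card_split // VR addn0 => cV.
rewrite (card_shadow_split lower dab) cV cR.
have -> : cnt (step (slice d lower)) (d.+2 - b1) b0 = 0.
  by apply: cnt0 => i hi; rewrite /step !sliceR; lia.
have := cnt_size (step (slice d lower)) (d.+2 - a1) (minn a0 d.+2).
by rewrite /growth /=; repeat case: ifP; lia.
Qed.

End NotMacaulay.

Theorem lshape_not_macaulay : b0 < a0 -> b1 < a0 -> a0 + a1 < b0 + b1 ->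
  ~ macaulay_levels lshape lcov.
Proof. by move=> ba b1a0 lt_ab [ord mac]; apply: (lshape_not_macaulay_order b1a0 lt_ab mac). Qed.

End LShape.

(** * Transport along isomorphisms of levels *)

Section Isomorphism.
Variables (T T' : eqType) (lev : nat -> seq T) (cov : nat -> rel T).
Variables (lev' : nat -> seq T') (cov' : nat -> rel T') (phi : T -> T').
Hypothesis phi_inj : injective phi.
Hypothesis phi_lev : forall d, perm_eq [seq phi x | x <- lev d] (lev' d).
Hypothesis phi_cov : forall d x y, cov' d (phi x) (phi y) = cov d x y.

Let push d (A : pred T) : pred T' := fun t => has (fun x => (phi x == t) && A x) (lev d).

Let mem_phi d x : (phi x \in lev' d) = (x \in lev d).
Proof. by rewrite -(perm_mem (phi_lev d)) mem_map. Qed.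

Let push_phi d A x : x \in lev d -> push d A (phi x) = A x.
Proof.
move=> xd; apply/hasP/idP => [[y _ /andP[/eqP/phi_inj-> //]]|Ax].
by exists x; rewrite // eqxx.
Qed.

Let card_push d (A : pred T') : card lev' d A = card lev d (fun x => A (phi x)).
Proof. by rewrite /card -(permP (phi_lev d)) count_map. Qed.

Let lev'P d t : t \in lev' d -> exists2 x, x \in lev d & t = phi x.
Proof. by rewrite -(perm_mem (phi_lev d)) => /mapP. Qed.

Let shadow_push d A y :
  shadow lev' cov' d (push d A) (phi y) = shadow lev cov d A y.
Proof.
apply/shadowP/shadowP => [[t [/lev'P[x xd ->] Ax]]|[x [xd Ax xy]]].
  by rewrite phi_cov => xy; exists x; rewrite -(push_phi A xd).
by exists (phi x); rewrite mem_phi push_phi // phi_cov.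
Qed.

Lemma macaulay_iso : macaulay_levels lev' cov' -> macaulay_levels lev cov.
Proof.
move=> [ord' mac']; exists (fun x y => ord' (phi x) (phi y)) => d.
have [[tot anti trans] mac_d] := mac' d.
split=> [|U upU].
  split=> [x y xd yd|x y xd yd h|y x z yd xd zd].
  - by apply: tot; rewrite mem_phi.
  - by apply/phi_inj/anti; rewrite ?mem_phi.
  - by apply: trans; rewrite mem_phi.
have [|upS opt] := mac_d (push d U).
  move=> t t' /lev'P[x xd ->] /lev'P[y yd ->]; rewrite !push_phi //.
  exact: upU.
split=> [x y xd yd|A AU].
  rewrite -!shadow_push; apply: upS; by rewrite mem_phi.
have cE B : card lev d B = card lev' d (push d B).
  by rewrite card_push; apply: eq_card => x xd; rewrite push_phi.
have sE B : card lev d.+1 (shadow lev cov d B) =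
            card lev' d.+1 (shadow lev' cov' d (push d B)).
  by rewrite card_push; apply: eq_card => x xd; rewrite shadow_push.
by rewrite !sE; apply: opt; rewrite -!cE.
Qed.

End Isomorphism.

(** * Classification of L-shapes *)

Section LShapeClassification.

Lemma lshape_eq a0 a1 b0 b1 c0 c1 d0 d1 : in_L a0 a1 b0 b1 =2 in_L c0 c1 d0 d1 ->
  macaulay_levels (lshape a0 a1 b0 b1) lcov ->
  macaulay_levels (lshape c0 c1 d0 d1) lcov.
Proof.
move=> E; apply: (@macaulay_iso _ _ _ _ _ _ id) => // d.
by rewrite map_id /lshape (eq_filter (fun i => E i (d - i))) perm_refl.
Qed.

Lemma lshape_flip a0 a1 b0 b1 :
  macaulay_levels (lshape b1 b0 a1 a0) lcov ->
  macaulay_levels (lshape a0 a1 b0 b1) lcov.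
Proof.
have swap_inj : injective (fun x : nat * nat => (x.2, x.1)) by move=> [i j] [k l] [-> ->].
apply: (macaulay_iso swap_inj) => [d|d [i j] [k l]].
  apply: uniq_perm; [by rewrite map_inj_uniq ?uniq_lshape|exact: uniq_lshape|move=> [i j]].
  rewrite mem_lshape; apply/mapP/andP => [[[k l] kl [-> ->]]|[/eqP ij in_ij]].
    move: kl; rewrite mem_lshape addnC /in_L => /andP[-> /orP[]/andP[-> ->]];
    by rewrite ?orbT.
  exists (j, i); rewrite // mem_lshape addnC ij eqxx.
  by move: in_ij; rewrite /in_L => /orP[]/andP[-> ->]; rewrite ?orbT.
by rewrite /lcov /= orbC; congr (_ || _); rewrite andbC.
Qed.

Lemma lshape_swap a0 a1 b0 b1 :
  macaulay_levels (lshape b0 b1 a0 a1) lcov ->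
  macaulay_levels (lshape a0 a1 b0 b1) lcov.
Proof. by apply: lshape_eq => i j; rewrite /in_L orbC. Qed.

Lemma lshape_nested a0 a1 b0 b1 : 0 < a0 -> 0 < a1 -> b0 <= a0 -> b1 <= a1 ->
  macaulay_levels (lshape a0 a1 b0 b1) lcov.
Proof.
(* A contained rectangle adds nothing, so it may be replaced by a copy of the larger one, which
   satisfies the inequalities of [lshape_macaulay]. *)
move=> a00 a10 ba0 ba1; apply: (@lshape_eq a0 a1 a0 a1).
  by move=> i j; rewrite /in_L; lia.
have [a10'|a01'] := leqP a1 a0; first exact: lshape_macaulay.
by apply/lshape_flip/lshape_macaulay; lia.
Qed.

(** Reflection in the diagonal makes the longer leg horizontal. When the legs are equally long, the
    L or its reflection satisfies the condition on the sums. *)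
Lemma lshape_crossed a0 a1 b0 b1 : 0 < a1 -> 0 < b0 -> b0 < a0 -> a1 < b1 ->
  macaulay_levels (lshape a0 a1 b0 b1) lcov <->
  [\/ a0 = b1, b1 < a0 /\ b1 + b0 <= a0 + a1 | a0 < b1 /\ a0 + a1 <= b0 + b1].
Proof.
move=> a10 b00 ba ab.
have pos : b1 <= a0 -> b0 + b1 <= a0 + a1 -> macaulay_levels (lshape a0 a1 b0 b1) lcov.
  by move=> *; apply: lshape_macaulay => //; lia.
have pos' : a0 <= b1 -> a0 + a1 <= b0 + b1 -> macaulay_levels (lshape a0 a1 b0 b1) lcov.
  by move=> *; apply/lshape_flip/lshape_macaulay; lia.
split=> [mac|].
  have [lt|lt|->] := ltngtP b1 a0; last by constructor 1.
    constructor 2; split=> //; rewrite leqNgt; apply/negP => lt'.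
    by apply: (@lshape_not_macaulay a0 a1 b0 b1) mac => //; lia.
  constructor 3; split=> //; rewrite leqNgt; apply/negP => lt'.
  by apply: (@lshape_not_macaulay b1 b0 a1 a0) (lshape_flip mac) => //; lia.
case=> [E|[lt le]|[lt le]].
- by have [h|h] := leqP (b0 + b1) (a0 + a1); [apply: pos | apply: pos']; lia.
- by apply: pos; lia.
- by apply: pos'; lia.
Qed.

Theorem lshape_macaulayP a0 a1 b0 b1 : 0 < a0 -> 0 < a1 -> 0 < b0 -> 0 < b1 ->
  macaulay_levels (lshape a0 a1 b0 b1) lcov <->
  [\/ a0 <= b0 /\ a1 <= b1,
      b0 <= a0 /\ b1 <= a1,
      [/\ b0 < a0, a1 < b1 &
        [\/ a0 = b1, b1 < a0 /\ b1 + b0 <= a0 + a1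
          | a0 < b1 /\ a0 + a1 <= b0 + b1]]
    | [/\ a0 < b0, b1 < a1 &
        [\/ b0 = a1, a1 < b0 /\ a1 + a0 <= b0 + b1
          | b0 < a1 /\ b0 + b1 <= a0 + a1]]].
Proof.
move=> a00 a10 b00 b10; split=> [mac|].
  have [ab0|ba0] := leqP a0 b0; have [ab1|ba1] := leqP a1 b1.
  - by constructor 1.
  - have [ab0'|E] : a0 < b0 \/ a0 = b0 by lia.
      constructor 4; split=> //.
      by apply: (lshape_crossed b10 a00 ab0' ba1).1; apply: lshape_swap.
    by constructor 2; lia.
  - have [ab1'|E] : a1 < b1 \/ a1 = b1 by lia.
      by constructor 3; split=> //; apply: (lshape_crossed a10 b00 ba0 ab1').1.
    by constructor 2; lia.
  - by constructor 2; lia.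
case=> [[h1 h2]|[h1 h2]|[h1 h2 h3]|[h1 h2 h3]].
- exact/lshape_swap/lshape_nested.
- exact: lshape_nested.
- exact: (lshape_crossed a10 b00 h1 h2).2.
- exact/lshape_swap/(lshape_crossed b10 a00 h1 h2).2.
Qed.

End LShapeClassification.

(** * Hilbert functions *)

Import GRing.Theory Num.Theory.

Lemma count_leq2 a : all (leq 2) a -> count (leq 2) a = size a.
Proof. by rewrite all_count => /eqP. Qed.

Section HilbertFunction.
Local Open Scope ring_scope.

Definition box_poly (a : seq nat) : {poly int} := \prod_(c <- a) \sum_(k < c) 'X^k.
(** The numerator of the Hilbert series [box_poly] over the denominator [(1 - 'X) ^+ size a]. *)
Definition cap_poly (a : seq nat) : {poly int} := \prod_(c <- a) (1 - 'X^c).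

Lemma coef_box_poly a d : (box_poly a)`_d = (size (box a d))%:R.
Proof.
rewrite /box_poly; elim: a d => [|c a IHa] d.
  by rewrite big_nil coef1 /=; case: d.
rewrite big_cons coefM size_box_cons natr_sum big_mkord.
rewrite (big_ord_widen d.+1 (fun k => (size (box a (d - k)%N))%:R : int)); last exact: geq_minr.
rewrite [RHS]big_mkcond /=; apply: eq_bigr => j _; rewrite IHa.
rewrite leq_min ltn_ord andbT coef_sum.
under eq_bigr => k _ do rewrite coefXn.
case: ltnP => jc; last by rewrite big1 ?mul0r // => k _; rewrite gtn_eqF // (leq_trans (ltn_ord k)).
rewrite (bigD1 (Ordinal jc)) //= eqxx big1 ?addr0 ?mul1r // => k kj.
by case: eqP => // jk; case/eqP: kj; apply: val_inj; rewrite /= jk.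
Qed.

Lemma cap_polyE a : cap_poly a = (1 - 'X) ^+ size a * box_poly a.
Proof.
rewrite /cap_poly /box_poly; elim: a => [|c a IHa]; first by rewrite !big_nil mul1r.
rewrite !big_cons /= IHa exprS mulrACA; congr (_ * _).
by rewrite -opprB subrX1 -mulNr opprB.
Qed.

Lemma coef_cap_poly a c : (0 < c)%N -> all (leq c) a ->
  (cap_poly a)`_0 = 1 /\ (cap_poly a)`_c = - (count_mem c a)%:R.
Proof.
move=> c0; rewrite /cap_poly; elim: a => [|x a IHa] /=.
  by rewrite big_nil !coef1; case: c c0.
case/andP=> cx /IHa[IH0 IHc]; have x0 : (0 < x)%N by apply: leq_trans cx.
rewrite big_cons mulrBl mul1r !coefB !coefXnM x0 subr0; split=> //.
rewrite IHc; case: ltngtP cx => // [cx|->] _; first by rewrite subr0 add0n.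
by rewrite subnn IH0 natrD opprD addrC.
Qed.

(** The least cap and its multiplicity can be read from the first nonconstant term; cancelling the
    factor of one such cap lets the induction proceed. *)
Lemma cap_poly_perm a b : all (leq 1) a -> all (leq 1) b -> size a = size b ->
  cap_poly a = cap_poly b -> perm_eq a b.
Proof.
have [n] := ubnP (size a); elim: n a b => // n IHn a b; rewrite ltnS => an a1 b1 ab P.
have [a0|a0] := posnP (size a).
  by rewrite (size0nil a0) (size0nil (esym (etrans (esym a0) ab))).
have ex_c : exists c, (c \in a) || (c \in b).
  by exists (head 0%N a); case: (a) a0 => //= x s _; rewrite mem_head.
case: (ex_minnP ex_c) => c c_ab c_min.
have c0 : (0 < c)%N by case/orP: c_ab => h; [apply: (allP a1)|apply: (allP b1)].
have ca : all (leq c) a by apply/allP => x xa; apply: c_min; rewrite xa.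
have cb : all (leq c) b by apply/allP => x xb; apply: c_min; rewrite xb orbT.
have cnt_ab : count_mem c a = count_mem c b.
  have [_ Ea] := coef_cap_poly c0 ca; have [_ Eb] := coef_cap_poly c0 cb.
  by move: Ea; rewrite P Eb => /oppr_inj/eqP; rewrite eqr_nat => /eqP.
have [c_a c_b] : c \in a /\ c \in b.
  by move: c_ab; rewrite -!has_pred1 !has_count cnt_ab orbb.
have pa := perm_to_rem c_a; have pb := perm_to_rem c_b.
rewrite (permPl pa) (permPr pb) perm_cons.
have sizes x s : x \in s -> size (rem x s) = (size s).-1 by exact: size_rem.
apply: IHn; rewrite ?sizes ?ab //; [by lia| | |].
- by apply/allP => x /mem_rem; apply/allP.
- by apply/allP => x /mem_rem; apply/allP.
move: P; rewrite /cap_poly (perm_big _ pa) (perm_big _ pb) /= !big_cons.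
apply: mulfI; apply/eqP => /(congr1 (fun p : {poly int} => p`_0)).
by rewrite coefB coef1 coefXn coef0 (ltn_eqF c0) subr0 => /eqP; rewrite oner_eq0.
Qed.

Lemma hilbert_perm a b : all (leq 2) a -> all (leq 2) b ->
  (forall d, size (box a d) = size (box b d)) -> perm_eq a b.
Proof.
move=> a2 b2 ab; have a1 := all_leq2 a2; have b1 := all_leq2 b2.
have sab : size a = size b.
  by have := ab 1%N; rewrite !size_box1 // !count_leq2.
apply: cap_poly_perm => //; rewrite !cap_polyE sab; congr (_ * _).
by apply/polyP => d; rewrite !coef_box_poly ab.
Qed.

End HilbertFunction.

Lemma size_le_top_rank a : all (leq 2) a -> size a <= top_rank a.
Proof. by rewrite /top_rank; elim: a => //= c a IHa /andP[c2 /IHa]; lia. Qed.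

Lemma sorted_geq_eq a b : sorted geq a -> sorted geq b -> perm_eq a b -> a = b.
Proof.
apply: sorted_eq => [x y z xy yz|x y]; first exact: leq_trans yz xy.
by rewrite /geq /= => /andP[yx xy]; apply/eqP; rewrite eqn_leq yx xy.
Qed.

Theorem connected_sum_macaulay (ab : bool -> seq nat) N :
  (forall s, all (leq 2) (ab s)) -> (forall s, sorted geq (ab s)) ->
  (forall s, 0 < size (ab s)) -> (forall s, top_rank (ab s) = N) ->
  macaulay_levels (wlev ab true N) (wcov true N) ->
  ab true = ab false \/
  exists s, [/\ size (ab s) = 1, size (ab (~~ s)) = 2 & 2 \in ab (~~ s)].
Proof.
move=> ab2 ab_sorted ab_size abN [ord mac].
have [s le_s] : exists s, size (ab s) <= size (ab (~~ s)).
  by case/orP: (leq_total (size (ab true)) (size (ab false))) => h; [exists true|exists false].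
have finish : (forall d, size (box (ab s) d) = size (box (ab (~~ s)) d)) -> ab true = ab false.
  move=> w; have : ab s = ab (~~ s) by apply/sorted_geq_eq/hilbert_perm.
  by case: (s).
move: le_s; rewrite leq_eqVlt => /orP[/eqP nn|lt_s].
  have [N3|N2] := ltnP 2 N; last first.
    (* For [N <= 2] the number of variables in degree 1 and the single top monomial determine the
       whole Hilbert function. *)
    left; apply: finish => d.
    case: d => [|[|d]]; first by rewrite !size_box0 ?all_leq2.
      by rewrite !size_box1 ?all_leq2 // !count_leq2.
    move: N2; rewrite leq_eqVlt => /orP[/eqP NE|N2]; last by rewrite !box_gt_top ?abN; lia.
    case: d => [|d]; last by rewrite !box_gt_top ?abN; lia.
    have top2 r : size (box (ab r) 2) = 1 by rewrite -NE -(abN r) size_box_top ?all_leq2.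
    by rewrite !top2.
  left; have [[q up_q]|[n2 t1 t1']] := first_atoms_eq ab2 N3 mac nn.
    apply: finish => d; have [qs|qs] := eqVneq q s.
      by subst q; apply: (hilbert_le ab2 abN N3 mac).
    have qE : q = ~~ s by move: qs; case: (q); case: (s).
    have := hilbert_le ab2 abN N3 mac (q := q) _ up_q d.
    by rewrite qE negbK => /(_ (esym nn)).
  (* In the exceptional case the top degree [N] fixes the remaining cap, so both sides are equal
     after all. *)
  have shape r : size (ab r) = 2 -> count_mem 2 (ab r) = 1 -> ab r = [:: N; 2].
    move: (ab_sorted r) (ab2 r) (abN r); rewrite /top_rank.
    case: (ab r) => [|x [|y [|? ?]]] //=; rewrite ?andbT => yx /andP[x2 y2] xyN _ c1.
    suff [-> ->] : x = N /\ y = 2 by [].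
    by move: c1; case: eqP; case: eqP => /=; lia.
  have : ab s = ab (~~ s) by rewrite (shape s) // (shape (~~ s)) // -nn.
  by case: (s).
right; exists s; have s0 := ab_size s.
have [N3|N2] := ltnP 2 N.
  have [h1 h2 h3] := size_neq ab2 abN N3 mac s0 lt_s.
  by split=> //; move: h3; rewrite -has_count has_pred1.
(* Here [N <= 2] allows at most two variables, so the larger side has the caps 2 and 2. *)
have := size_le_top_rank (ab2 (~~ s)); rewrite abN => nN.
have n2 : size (ab (~~ s)) = 2 by lia.
split=> //; first by lia.
move: (ab2 (~~ s)) (abN (~~ s)) n2; rewrite /top_rank.
case: (ab (~~ s)) => [|x [|y [|? ?]]] //= /and3P[x2 y2 _] xyN _.
by rewrite !inE; apply/orP; left; lia.
Qed.

(** * From rings to levels *)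

Section Transfer.
Local Open Scope classical_set_scope.
Variables (T0 : choiceType) (le : T0 -> T0 -> Prop) (level : nat -> set T0).
Variables (T : eqType) (lev : nat -> seq T) (cov : nat -> rel T) (phi : T0 -> T).
Hypothesis phi_inj : injective phi.
Hypothesis lev_uniq : forall d, uniq (lev d).
Hypothesis phi_level : forall d x, level d x <-> phi x \in lev d.
Hypothesis phi_onto : forall d t, t \in lev d -> exists x, phi x = t.
Hypothesis level_ex : forall x, exists d, level d x.
Hypothesis lev_disjoint : forall d d' t, t \in lev d -> t \in lev d' -> d = d'.
Hypothesis covers_level : forall d x y, level d x -> covers le y x -> level d.+1 y.
Hypothesis covers_cov : forall d x y, level d x -> level d.+1 y ->
  covers le y x <-> cov d (phi x) (phi y).

Definition image_pred (A : set T0) : pred T := fun t => `[< exists2 x, A x & phi x = t >].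

Lemma image_predE A x : image_pred A (phi x) = `[< A x >].
Proof.
apply/asboolP/asboolP => [[y Ay /phi_inj<- //]|Ax]; by exists x.
Qed.

Lemma finite_level d : finite_set (level d).
Proof.
apply: (@sub_finite_set _ _ (phi @^-1` [set` lev d])) => [x /phi_level //|].
by apply: finite_preimage; [move=> x y _ _; apply: phi_inj|exact: finite_seq].
Qed.

Lemma ncardE d (A : set T0) : A `<=` level d -> ncard A = card lev d (image_pred A).
Proof.
move=> Ad; have finA : finite_set A by apply: sub_finite_set Ad (finite_level d).
rewrite /ncard /card -size_filter -(size_map phi); apply: perm_size.
apply: uniq_perm; rewrite ?filter_uniq ?map_inj_uniq ?fset_uniq //.
move=> t; rewrite mem_filter; apply/mapP/andP => [[x]|[tA td]].
  by rewrite in_fset_set // inE => Ax ->; 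
  rewrite image_predE; split; [apply/asboolP|apply/phi_level/Ad].
have [x xt] := phi_onto td; exists x => //; rewrite in_fset_set // inE.
by move: tA; rewrite -xt image_predE => /asboolP.
Qed.

Lemma card_set_of d (A : pred T) : ncard [set x | level d x /\ A (phi x)] = card lev d A.
Proof.
rewrite (@ncardE d) => [|x []//]; apply: eq_card => t td.
have [x xt] := phi_onto td; rewrite -xt image_predE.
by apply/asboolP/idP => [[] //|Ax]; split=> //; apply/phi_level; rewrite xt.
Qed.

Lemma upper_shadow_level d (A : set T0) : A `<=` level d -> upper_shadow le A `<=` level d.+1.
Proof. by move=> Ad y [x /Ad xd /(covers_level xd)]. Qed.

Lemma image_upper_shadow d (A : set T0) : A `<=` level d ->
  {in lev d.+1, image_pred (upper_shadow le A) =1 shadow lev cov d (image_pred A)}.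
Proof.
move=> Ad t td; have [y yt] := phi_onto td; rewrite -yt image_predE.
have yd : level d.+1 y by apply/phi_level; rewrite yt.
apply/asboolP/shadowP => [[x Ax xy]|[u [ud Au uy]]].
  exists (phi x); split; [exact/phi_level/Ad | by rewrite image_predE; apply/asboolP |].
  exact/(covers_cov (Ad _ Ax) yd).
have [x xu] := phi_onto ud; move: ud Au uy; rewrite -xu image_predE => xd /asboolP Ax xy.
by exists x => //; apply/(covers_cov _ yd) => //; apply/phi_level.
Qed.

Section Order.
Variables (ord : rel T0) (ord' : rel T) (d : nat).
Hypothesis ordE : forall x y, level d x -> level d y -> ord x y = ord' (phi x) (phi y).

Lemma segment_rank q x : segment level ord d q x <->
  level d x /\ (rank lev ord' d (phi x) < q)%N.
Proof.
split=> -[xd]; rewrite /rank => xq; split=> //; move: xq.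
all: set B := [set y | _].
all: suff -> : ncard B = card lev d (fun t => ord' (phi x) t && (t != phi x)) by [].
all: rewrite -(@card_set_of d); congr ncard; apply/seteqP; split=> y /=.
- by case=> yd xy yx; split=> //; rewrite -ordE ?xy //=; apply/eqP => /phi_inj.
- by case=> yd /andP[xy /eqP yx]; split=> //; [rewrite ordE|move=> E; apply: yx; rewrite E].
- by case=> yd xy yx; split=> //; rewrite -ordE ?xy //=; apply/eqP => /phi_inj.
- by case=> yd /andP[xy /eqP yx]; split=> //; [rewrite ordE|move=> E; apply: yx; rewrite E].
Qed.

Hypothesis ord_d : level_order lev ord' d.

Lemma segment_upset (A : set T0) : A `<=` level d ->
  A = segment level ord d (ncard A) <-> upset lev ord' d (image_pred A).
Proof.
move=> Ad; split=> [E|upA].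
  have [upR cR] := rank_seg ord_d (lev_uniq d) (card_le_size lev d (image_pred A)).
  apply: eq_upset upR => t td; have [x xt] := phi_onto td; rewrite -xt image_predE.
  rewrite -(ncardE Ad); apply/idP/asboolP => [h|].
    by rewrite E; apply/segment_rank; split=> //; apply/phi_level; rewrite xt.
  by rewrite {1}E => /segment_rank[].
apply/seteqP; split=> [x Ax|x /segment_rank[xd]].
  apply/segment_rank; split; first exact: Ad.
  rewrite (ncardE Ad) (rank_upset ord_d upA) ?image_predE; first exact/asboolP.
  exact/phi_level/Ad.
rewrite (ncardE Ad) (rank_upset ord_d upA) ?image_predE; first by move/asboolP.
exact/phi_level.
Qed.

End Order.

Lemma segment_card (ord : rel T0) (ord' : rel T) d q :
  (forall x y, level d x -> level d y -> ord x y = ord' (phi x) (phi y)) ->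
  level_order lev ord' d -> (q <= size (lev d))%N ->
  [/\ segment level ord d q `<=` level d,
      upset lev ord' d (image_pred (segment level ord d q)) &
      card lev d (image_pred (segment level ord d q)) = q].
Proof.
move=> ordE od qd; have [upR cR] := rank_seg od (lev_uniq d) qd.
have segd : segment level ord d q `<=` level d by move=> x [].
have E : {in lev d, (fun t => rank lev ord' d t < q)%N =1 image_pred (segment level ord d q)}.
  move=> t td; have [x xt] := phi_onto td; rewrite -xt image_predE.
  apply/idP/asboolP => [h|/(segment_rank ordE)[] //].
  by apply/(segment_rank ordE); split=> //; apply/phi_level; rewrite xt.
by split=> //; [exact: eq_upset E upR | rewrite -(eq_card E)].
Qed.

Lemma macaulay_transfer : macaulay_poset le level <-> macaulay_levels lev cov.
Proof.
split=> [[ord [tot anti trans mac]]|[ord' mac]].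
  pose ord' t u := `[< exists x y, [/\ phi x = t, phi y = u & ord x y] >].
  have ordE x y : ord x y = ord' (phi x) (phi y).
    apply/idP/asboolP => [xy|[x' [y' [/phi_inj<- /phi_inj<- //]]]]; by exists x, y.
  exists ord' => d; have od e : level_order lev ord' e.
    split=> [t u /phi_onto[x <-] /phi_onto[y <-]|t u /phi_onto[x <-] /phi_onto[y <-]|
             u t v /phi_onto[y <-] /phi_onto[x <-] /phi_onto[z <-]]; rewrite -!ordE.
    - exact: tot.
    - by move=> /anti ->.
    - exact: trans.
  split=> // U upU; pose AU := [set x | level d x /\ U (phi x)].
  have AUd : AU `<=` level d by move=> x [].
  have UE : {in lev d, image_pred AU =1 U}.
    move=> t td; have [x xt] := phi_onto td; rewrite -xt image_predE.
    by apply/asboolP/idP => [[] //|Ux]; split=> //; apply/phi_level; rewrite xt.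
  have segU : AU = segment level ord d (ncard AU).
    apply/(segment_upset (fun x y _ _ => ordE x y) (od d) AUd).
    by apply: eq_upset upU => t td; rewrite UE.
  have SU : {in lev d.+1, image_pred (upper_shadow le AU) =1 shadow lev cov d U}.
    by move=> t td; rewrite (image_upper_shadow AUd td); apply: eq_shadow.
  split.
    apply: eq_upset SU _; have [_ SE] := mac d AU AUd.
    rewrite -segU in SE.
    exact/(segment_upset (fun x y _ _ => ordE x y) (od d.+1) (upper_shadow_level AUd)).
  move=> A cA; pose B := [set x | level d x /\ A (phi x)].
  have Bd : B `<=` level d by move=> x [].
  have BE : {in lev d, image_pred B =1 A}.
    move=> t td; have [x xt] := phi_onto td; rewrite -xt image_predE.
    by apply/asboolP/idP => [[] //|Ax]; split=> //; apply/phi_level; rewrite xt.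
  have [+ _] := mac d B Bd; rewrite (_ : ncard B = ncard AU); last first.
    by rewrite !card_set_of.
  rewrite -segU !(@ncardE d.+1); try exact: upper_shadow_level.
  rewrite (eq_card SU) => /leq_trans; apply; rewrite leq_eqVlt; apply/orP; left.
  by apply/eqP/eq_card => t td; rewrite (image_upper_shadow Bd td); apply: eq_shadow.
have deg x : {d | level d x} by apply: cid; apply: level_ex.
have degE d x : level d x -> sval (deg x) = d.
  case: (deg x) => e /= /phi_level xe /phi_level xd; exact: lev_disjoint xe xd.
(* The orders of the levels are stacked by degree, which gives a total order of the whole poset. *)
pose ord x y := if sval (deg x) == sval (deg y) then ord' (phi x) (phi y)
  else (sval (deg x) <= sval (deg y))%N.
have ordE d x y : level d x -> level d y -> ord x y = ord' (phi x) (phi y).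
  by move=> /degE xd /degE yd; rewrite /ord xd yd eqxx.
have lvl x : phi x \in lev (sval (deg x)) by case: (deg x) => d /= /phi_level.
have lvl' x y : sval (deg x) = sval (deg y) -> phi y \in lev (sval (deg x)) by move=> ->.
exists ord; split=> [x y|x y|y x z|d A Ad].
- rewrite /ord [sval (deg y) == _]eq_sym; case: eqP => [E|_]; last exact: leq_total.
  by have [[t _ _] _] := mac (sval (deg x)); apply: t; rewrite ?lvl' // lvl.
- rewrite /ord [sval (deg y) == _]eq_sym; case: eqP => [E|nE]; last first.
    by move=> h; case: nE; apply/eqP; rewrite eqn_leq.
  have [[_ a _] _] := mac (sval (deg x)) => h; apply: phi_inj.
  by apply: a => //; rewrite ?lvl' // lvl.
- rewrite /ord; case: (eqVneq (sval (deg x)) (sval (deg y))) => [E|nE].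
    rewrite -E; case: eqP => [E'|_ _ //].
    have [[_ _ t] _] := mac (sval (deg x)); apply: t; rewrite ?lvl' // ?lvl //.
  case: (eqVneq (sval (deg y)) (sval (deg z))) => [E'|nE'].
    by rewrite -E' (negPf nE).
  move=> xy yz; have xz := leq_trans xy yz; case: eqP => // E.
  by case/eqP: nE; apply/eqP; rewrite eqn_leq xy E yz.
have [od mac_d] := mac d; have [od1 _] := mac d.+1.
have Aq : (ncard A <= size (lev d))%N by rewrite (ncardE Ad) card_le_size.
have [segd upS cS] := segment_card (ordE d) od Aq.
have [up_sh opt] := mac_d _ upS; have sh1 := upper_shadow_level segd.
split; last first.
  apply/(segment_upset (ordE d.+1) od1 sh1).
  by apply: eq_upset up_sh => t td; rewrite (image_upper_shadow segd td).
rewrite (ncardE sh1) (ncardE (upper_shadow_level Ad)).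
rewrite (eq_card (image_upper_shadow segd)) (eq_card (image_upper_shadow Ad)).
by apply: opt; rewrite cS (ncardE Ad).
Qed.

End Transfer.

Section CoefficientSum.
Local Open Scope ring_scope.
Variables (n : nat) (K : fieldType).

(* A linear form on polynomials, used to show that monomials outside an ideal
   or in different cosets are so. *)
Definition coef_sum_on (s : seq 'X_{1..n}) (p : {mpoly K[n]}) := \sum_(m <- s) p@_m.

Lemma coef_sum_onX s m : coef_sum_on s 'X_[m] = (count_mem m s)%:R.
Proof.
rewrite /coef_sum_on -sum1_count natr_sum [RHS]big_mkcond; apply: eq_bigr => k _ /=.
by rewrite mcoeffX eq_sym; case: eqP.
Qed.

Lemma coef_sum_onB s p q : coef_sum_on s (p - q) = coef_sum_on s p - coef_sum_on s q.
Proof. by rewrite /coef_sum_on -sumrB; apply: eq_bigr => m _; rewrite mcoeffB. Qed.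

Lemma coef_sum_on_sum s (J : Type) (r : seq J) (F : J -> {mpoly K[n]}) :
  coef_sum_on s (\sum_(j <- r) F j) = \sum_(j <- r) coef_sum_on s (F j).
Proof.
rewrite /coef_sum_on exchange_big; apply: eq_bigr => m _ /=.
by rewrite raddf_sum.
Qed.

Lemma coef_sum_onZ s c p : coef_sum_on s (c *: p) = c * coef_sum_on s p.
Proof. by rewrite /coef_sum_on mulr_sumr; apply: eq_bigr => m _; rewrite mcoeffZ. Qed.

(** By linearity it is enough to test monomial multiples of the generators. *)
Lemma coef_sum_ideal s (gs : seq {mpoly K[n]}) p :
  (forall g k, g \in gs -> coef_sum_on s ('X_[k] * g) = 0) ->
  ideal_gen gs p -> coef_sum_on s p = 0.
Proof.
move=> gs0 [c ->]; rewrite coef_sum_on_sum big1 // => i _.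
rewrite [c i]mpolyE mulr_suml coef_sum_on_sum big1 // => k _.
by rewrite -scalerAl coef_sum_onZ gs0 ?mulr0 // mem_nth.
Qed.

Lemma mem_ideal_gen (gs : seq {mpoly K[n]}) g h : g \in gs -> ideal_gen gs (h * g).
Proof.
move=> ggs; have ig : (index g gs < size gs)%N by rewrite index_mem.
exists (fun i => if i == Ordinal ig then h else 0).
rewrite (bigD1 (Ordinal ig)) //= eqxx nth_index // big1 ?addr0 // => i /negPf->.
by rewrite mul0r.
Qed.

End CoefficientSum.

(** * Cosets of monomials described by classes *)

Section RingLevels.
Local Open Scope ring_scope.
Local Open Scope classical_set_scope.
Local Open Scope quotient_scope.
Variables (n : nat) (K : fieldType) (I : idealr {mpoly K[n]}).
Variables (T : eqType) (t0 : T) (lev : nat -> seq T) (cov : nat -> rel T).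
(** [cls m] is [None] for monomials in [I] and names the coset otherwise; [reps t] is the finite
    list of monomials in the coset named [t]. *)
Variables (cls : 'X_{1..n} -> option T) (reps : T -> seq 'X_{1..n}).
Hypothesis cls_none : forall m, cls m = None -> 'X_[m] \in I.
Hypothesis cls_eq : forall m m' t, cls m = Some t -> cls m' = Some t ->
  'X_[m] - 'X_[m'] \in I.
Hypothesis repsP : forall t m, (m \in reps t) = (cls m == Some t).
Hypothesis reps_uniq : forall t, uniq (reps t).
Hypothesis reps0 : forall t p, p \in I -> coef_sum_on (reps t) p = 0.
Hypothesis cls_mdeg : forall m m' t, cls m = Some t -> cls m' = Some t -> mdeg m = mdeg m'.
Hypothesis lev_uniq : forall d, uniq (lev d).
Hypothesis levP : forall d t, t \in lev d <-> exists2 m, cls m = Some t & mdeg m = d.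
Hypothesis covP : forall d t u, t \in lev d -> u \in lev d.+1 ->
  cov d t u <-> exists m i, cls m = Some t /\ cls (m + U_(i))%MM = Some u.

Let coef_reps t m : coef_sum_on (reps t) ('X_[m] : {mpoly K[n]}) = (cls m == Some t)%:R.
Proof. by rewrite coef_sum_onX count_uniq_mem // repsP. Qed.

Let cls_notin m t : cls m = Some t -> 'X_[m] \notin I.
Proof.
move=> mt; apply/negP => /(reps0 t); rewrite coef_reps mt eqxx.
by move/eqP; rewrite oner_eq0.
Qed.

(** The sum of the coefficients over [reps t] vanishes on [I], is 1 on monomials of class [t] and 0
    on all others, so it separates the cosets. *)
Let pi_cls m m' t : cls m = Some t ->
  \pi_{ideal_quot I} 'X_[m] = \pi_{ideal_quot I} 'X_[m'] <-> cls m' = Some t.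
Proof.
move=> mt; split=> [/eqP|m't]; last by apply/eqP; rewrite -Quotient.idealrBE (cls_eq mt m't).
rewrite -Quotient.idealrBE => /(reps0 t); rewrite coef_sum_onB !coef_reps mt eqxx.
by case: (cls m' =P Some t) => // _ /eqP; rewrite subr0 oner_eq0.
Qed.

Let mon_rep (u : @monomial n K I) : 
  {m | exists2 t, cls m = Some t & val u = \pi_{ideal_quot I} 'X_[m]}.
Proof.
apply: cid; have [m mI um] := set_valP u; exists m.
case E: (cls m) => [t|]; first by exists t.
by rewrite cls_none in mI.
Qed.

Let phi (u : @monomial n K I) : T := odflt t0 (cls (sval (mon_rep u))).

Let phiP (u : @monomial n K I) m t :
  cls m = Some t -> val u = \pi_{ideal_quot I} 'X_[m] -> phi u = t.
Proof.
move=> mt um; rewrite /phi; case: (mon_rep u) => m' /= [t' m't' um'].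
by have /(pi_cls m' mt) -> : \pi_{ideal_quot I} 'X_[m] = \pi_{ideal_quot I} 'X_[m'] by rewrite -um.
Qed.

Let phi_rep (u : @monomial n K I) : 
  exists2 m, cls m = Some (phi u) & val u = \pi_{ideal_quot I} 'X_[m].
Proof.
have [m [t mt um]] := mon_rep u; exists m => //.
by rewrite (phiP mt um).
Qed.

Let mon_of m t (mt : cls m = Some t) : {u : @monomial n K I | val u = \pi_{ideal_quot I} 'X_[m]}.
Proof.
have h : @monomial n K I (\pi_{ideal_quot I} 'X_[m]) by exists m => //; apply: cls_notin mt.
by exists (SigSub (mem_set h)).
Qed.

Let phi_inj : injective phi.
Proof.
move=> u v uv; have [m mu um] := phi_rep u; have [m' mv vm] := phi_rep v.
by apply: val_inj; rewrite um vm; apply/(pi_cls _ mu); rewrite uv.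
Qed.

Let phi_level d u : monomial_level d u <-> phi u \in lev d.
Proof.
have [m mu um] := phi_rep u; split=> [[m' m'd um']|/levP[m' m'u m'd]].
  apply/levP; exists m' => //; apply/(pi_cls m' mu).
  by rewrite -um.
by exists m' => //; rewrite um; apply/(pi_cls m' mu).
Qed.

Let phi_onto d t : t \in lev d -> exists u, phi u = t.
Proof. by case/levP=> m mt _; have [u um] := mon_of mt; exists u; apply: phiP mt um. Qed.

Let level_ex (u : @monomial n K I) : exists d, monomial_level d u.
Proof. by have [m mu um] := phi_rep u; exists (mdeg m), m. Qed.

Let lev_disjoint d d' t : t \in lev d -> t \in lev d' -> d = d'.
Proof. by move=> /levP[m mt <-] /levP[m' m't <-]; apply: cls_mdeg mt m't. Qed.

Let dvdP (u v : @monomial n K I) m : cls m = Some (phi u) ->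
  monomial_dvd u v <-> exists k, cls (m + k)%MM = Some (phi v).
Proof.
move=> mu; have [m' m'u um'] := phi_rep u.
have um : val u = \pi_{ideal_quot I} 'X_[m] by rewrite um'; apply/(pi_cls m m'u).
split=> [[w vE]|[k mkv]].
  have [k kw wk] := phi_rep w; exists k; have [m'' m''v vm''] := phi_rep v.
  by apply/(pi_cls _ m''v); rewrite -vm'' vE um wk mpolyXD (rmorphM (\pi_{ideal_quot I})).
case k_cls: (cls k) => [t|]; last first.
  have := cls_notin mkv; rewrite mpolyXD idealMr //; exact: cls_none.
have [w wk] := mon_of k_cls; exists w; have [m'' m''v vm''] := phi_rep v.
rewrite um wk vm'' -(rmorphM (\pi_{ideal_quot I})) -mpolyXD.
exact/(pi_cls _ m''v).
Qed.

Let cls_ideal m k t : cls (m + k)%MM = Some t -> exists u, cls m = Some u.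
Proof.
move=> mkt; case E: (cls m) => [u|]; first by exists u.
by have := cls_notin mkt; rewrite mpolyXD mulrC idealMr ?cls_none.
Qed.

(** One variable of the cofactor gives an intermediate coset of larger degree than [u], which must
    be [v]. Conversely, degrees leave no room for anything strictly between. *)
Let coversP (u v : @monomial n K I) m : cls m = Some (phi u) ->
  covers (@monomial_dvd n K I) v u <-> exists i, cls (m + U_(i))%MM = Some (phi v).
Proof.
move=> mu; split=> [[/(dvdP _ mu)[k mkv] uv nobetween]|[i miv]].
  have [i ki] : exists i, (U_(i) + (k - U_(i)))%MM = k.
    have [k0|] := eqVneq k 0%MM.
      by case: uv; apply: phi_inj; move: mkv; rewrite k0 addm0 mu => -[].
    move=> k0; suff [i ki] : exists i, (U_(i) <= k)%MM.
      by exists i; rewrite addmC submK.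
    apply/existsP; apply: contraNT k0 => /existsPn h; apply/eqP/mnmP => i.
    by have := h i; rewrite lep1mP negbK mnm0E => /eqP.
  exists i; rewrite -ki addmA in mkv; have [t mit] := cls_ideal mkv.
  have [w wm] := mon_of mit; have wt := phiP mit wm.
  have [||wu|wv] := nobetween w.
  - by apply/(dvdP _ mu); exists U_(i)%MM; rewrite wt.
  - have mw : cls (m + U_(i))%MM = Some (phi w) by rewrite wt.
    by apply/(dvdP _ mw); exists (k - U_(i))%MM.
  - have := cls_mdeg mu (_ : cls (m + U_(i))%MM = Some (phi u)).
    by rewrite -wu wt mdegD mdeg1 => /(_ mit); lia.
  - by rewrite mit -wt wv.
have deg_v m' : cls m' = Some (phi v) -> mdeg (m + U_(i))%MM = mdeg m'.
  exact: cls_mdeg miv.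
split.
- by apply/(dvdP _ mu); exists U_(i)%MM.
- by move=> uv; have := deg_v m; rewrite -uv mdegD mdeg1 => /(_ mu); lia.
move=> w /(dvdP _ mu)[k mkw] /(dvdP _ mkw)[l mklv].
have := deg_v _ mklv; rewrite !mdegD mdeg1 => kl.
have [k0|l0] : mdeg k = 0%N \/ mdeg l = 0%N by lia.
  left; apply: phi_inj; move: mkw; have /eqP := k0; rewrite mdeg_eq0 => /eqP ->.
  by rewrite addm0 mu => -[].
right; apply: phi_inj; move: mklv; have /eqP := l0; rewrite mdeg_eq0 => /eqP ->.
by rewrite addm0 mkw => -[].
Qed.

Let level_mdeg d (u : @monomial n K I) m :
  monomial_level d u -> cls m = Some (phi u) -> mdeg m = d.
Proof. by move=> /phi_level/levP[m' m'u <-] mu; apply: cls_mdeg mu m'u. Qed.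

Theorem macaulay_ring_levels : macaulay_ring I <-> macaulay_levels lev cov.
Proof.
apply: (macaulay_transfer phi_inj lev_uniq phi_level phi_onto level_ex lev_disjoint).
  move=> d u v ud; have [m mu _] := phi_rep u => /(coversP _ mu)[i miv].
  apply/phi_level/levP; exists (m + U_(i))%MM => //.
  by rewrite mdegD mdeg1 (level_mdeg ud mu) addn1.
move=> d u v ud vd; split=> [|/covP].
  have [m mu _] := phi_rep u => /(coversP _ mu)[i miv].
  by apply/covP; [exact/phi_level..|exists m, i].
case=> [||m [i [mu miv]]]; [exact/phi_level..|].
by apply/(coversP _ mu); exists i.
Qed.

End RingLevels.

(** * Intersections of two rectangles *)

Section MonomialIdeals.
Local Open Scope ring_scope.
Variables (n : nat) (K : fieldType) (gs : seq {mpoly K[n]}).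

Lemma ideal_gen_pow i c (m : 'X_{1..n}) : 'X_i ^+ c \in gs -> (c <= m i)%N ->
  ideal_gen gs 'X_[m].
Proof.
move=> gi cm; have le : (U_(i) *+ c <= m)%MM.
  apply/mnm_lepP => j; rewrite mulmnE mnm1E; case: eqP => [<-|_]; last by rewrite mul0n.
  by rewrite mul1n.
by rewrite -(submK le) mpolyXD -mpolyXn; apply: mem_ideal_gen.
Qed.

Lemma ideal_gen_mul i j (m : 'X_{1..n}) : 'X_i * 'X_j \in gs -> i != j ->
  (0 < m i)%N -> (0 < m j)%N -> ideal_gen gs 'X_[m].
Proof.
move=> gij ij mi mj; have le : (U_(i) + U_(j) <= m)%MM.
  apply/mnm_lepP => k; rewrite mnmDE !mnm1E; case: eqP => [<-|_]; last by case: eqP => [<-|].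
  by rewrite eq_sym (negPf ij).
by rewrite -(submK le) mpolyXD [in X in _ * X]mpolyXD; apply: mem_ideal_gen.
Qed.

End MonomialIdeals.

Section RectangleIntersection.
Local Open Scope ring_scope.
Local Open Scope classical_set_scope.
Variables (K : fieldType) (a0 a1 b0 b1 : nat) (I : idealr {mpoly K[2]}).
Let i0 : 'I_2 := inord 0.
Let i1 : 'I_2 := inord 1.
Hypothesis IE : [set` I] = ideal_gen [:: 'X_i0 ^+ a0; 'X_i1 ^+ a1] `&`
                           ideal_gen [:: 'X_i0 ^+ b0; 'X_i1 ^+ b1].

Let ord2 (i : 'I_2) : i = i0 \/ i = i1.
Proof.
by case: i => [[|[|i]] // h]; [left|right]; apply: val_inj; rewrite /= inordK.
Qed.

Let i01 : i0 != i1.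
Proof. by rewrite -val_eqE /= !inordK. Qed.

Let i10 : (i1 == i0) = false. Proof. by rewrite eq_sym (negPf i01). Qed.

Let mnm2 (t : nat * nat) : 'X_{1..2} := [multinom if i == i0 then t.1 else t.2 | i < 2].

Let mnm2K (m : 'X_{1..2}) : mnm2 (m i0, m i1) = m.
Proof.
apply/mnmP => i; rewrite mnmE; have [->|->] := ord2 i; first by rewrite eqxx.
by rewrite eq_sym (negPf i01).
Qed.

Let mnm2_0 t : mnm2 t i0 = t.1. Proof. by rewrite mnmE eqxx. Qed.
Let mnm2_1 t : mnm2 t i1 = t.2. Proof. by rewrite mnmE eq_sym (negPf i01). Qed.

Let mdeg2 (m : 'X_{1..2}) : mdeg m = (m i0 + m i1)%N.
Proof.
rewrite mdegE (bigD1 i0) //= (bigD1 i1) 1?eq_sym //= big1 ?addn0 // => i.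
by case/andP; have [->|->] := ord2 i; rewrite eqxx.
Qed.

Let cls (m : 'X_{1..2}) : option (nat * nat) :=
  if in_L a0 a1 b0 b1 (m i0) (m i1) then Some (m i0, m i1) else None.

Let reps (t : nat * nat) := if in_L a0 a1 b0 b1 t.1 t.2 then [:: mnm2 t] else [::].

Let mcoeff_rectangle c d (m : 'X_{1..2}) p : (m i0 < c)%N -> (m i1 < d)%N ->
  ideal_gen [:: 'X_i0 ^+ c; 'X_i1 ^+ d] p -> p@_m = 0 :> K.
Proof.
move=> mc md Ip; have : coef_sum_on [:: m] p = 0; last by rewrite /coef_sum_on big_seq1.
apply: coef_sum_ideal Ip => g k; rewrite !inE => /orP[] /eqP ->.
all: rewrite mpolyXn -mpolyXD coef_sum_onX /= addn0; case: eqP => // E; exfalso.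
all: by move: mc md; rewrite E !mnmDE !mulmnE !mnm1E eqxx; lia.
Qed.

Lemma rectangle_intersection_macaulay :
  macaulay_ring I <-> macaulay_levels (lshape a0 a1 b0 b1) lcov.
Proof.
have clsP m t : cls m = Some t <-> in_L a0 a1 b0 b1 t.1 t.2 /\ m = mnm2 t.
  rewrite /cls; case: ifP => [h|h]; split=> //; first by case=> <-; rewrite mnm2K.
    by case=> _ ->; rewrite mnm2_0 mnm2_1 -surjective_pairing.
  by case=> + mt; rewrite -mnm2_0 -mnm2_1 -mt h.
have inI p : (p \in I) <-> [set` I] p by [].
apply: (@macaulay_ring_levels _ _ _ _ (0%N, 0%N) _ _ cls reps).
- move=> m; rewrite /cls; case: ifP => // /negbT; rewrite /in_L negb_or !negb_and -!leqNgt.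
  move=> /andP[mA mB] _; apply/inI; rewrite IE; split.
    by case/orP: mA; apply: ideal_gen_pow; rewrite !inE eqxx ?orbT.
  by case/orP: mB; apply: ideal_gen_pow; rewrite !inE eqxx ?orbT.
- by move=> m m' t /clsP[_ ->] /clsP[_ ->]; rewrite subrr rpred0.
- move=> t m; rewrite /reps; case: ifP => h; rewrite ?inE.
    by apply/eqP/eqP => [->|/clsP[]//]; apply/clsP.
  by apply/esym/eqP => /clsP[]; rewrite h.
- by move=> t; rewrite /reps; case: ifP.
- move=> t p /inI; rewrite IE /reps => -[pA pB]; case: ifP; last by rewrite /coef_sum_on big_nil.
  rewrite /coef_sum_on big_seq1 => /orP[] /andP[h1 h2].
    by apply: mcoeff_rectangle pA; rewrite ?mnm2_0 ?mnm2_1.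
  by apply: mcoeff_rectangle pB; rewrite ?mnm2_0 ?mnm2_1.
- by move=> m m' t /clsP[_ ->] /clsP[_ ->].
- exact: uniq_lshape.
- move=> d [i j]; rewrite mem_lshape; split=> [/andP[/eqP ij h]|[m /clsP[h ->] <-]].
    by exists (mnm2 (i, j)); [apply/clsP | rewrite mdeg2 mnm2_0 mnm2_1].
  by rewrite mdeg2 mnm2_0 mnm2_1 eqxx.
- move=> d [i j] [k l]; rewrite !mem_lshape /lcov /= => /andP[_ ht] /andP[_ hu].
  split=> [h|[m [e [/clsP[_ ->] /clsP[_ /mnmP E]]]]]; last first.
    move: (E i0) (E i1); rewrite !mnmDE !mnm1E !mnm2_0 !mnm2_1 /=.
    have [->|->] := ord2 e; rewrite eqxx ?i10 ?(negPf i01); lia.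
  exists (mnm2 (i, j)), (if k == i.+1 then i0 else i1); split; first exact/clsP.
  apply/clsP; split=> //; apply/mnmP => e; rewrite mnmDE mnm1E.
  have [->|->] := ord2 e; rewrite ?mnm2_0 ?mnm2_1 /=; case: (k =P i.+1) => ki.
  all: rewrite ?eqxx ?i10 ?(negPf i01); lia.
Qed.

End RectangleIntersection.

(** * Wedges and connected sums of monomial rings *)

Section WedgeRing.
Local Open Scope ring_scope.
Local Open Scope classical_set_scope.
Variables (n : nat) (K : fieldType) (I : idealr {mpoly K[n]}) (gs : seq {mpoly K[n]}).
Variables (vs : bool -> seq 'I_n) (cap : 'I_n -> nat) (glued : bool) (N : nat).

Implicit Types (s : bool) (m k : 'X_{1..n}).

Definition top_mnm s : 'X_{1..n} := [multinom if i \in vs s then (cap i).-1 else 0%N | i < n].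

Hypothesis IE : [set` I] = ideal_gen gs.
Hypothesis uniq_vs : forall s, uniq (vs s).
Hypothesis vsN : forall s i, (i \in vs (~~ s)) = (i \notin vs s).
Hypothesis cap_gt0 : forall i, (0 < cap i)%N.
Hypothesis pow_gs : forall i, 'X_i ^+ cap i \in gs.
Hypothesis mul_gs : forall i j, i \in vs true -> j \in vs false -> 'X_i * 'X_j \in gs.
Hypothesis top_gs : glued -> 'X_[top_mnm true] - 'X_[top_mnm false] \in gs.
Hypothesis gsP : forall g, g \in gs ->
  [\/ exists i, g = 'X_i ^+ cap i,
      exists i j, [/\ i \in vs true, j \in vs false & g = 'X_i * 'X_j]
    | glued /\ g = 'X_[top_mnm true] - 'X_[top_mnm false]].
Let ab s := [seq cap i | i <- vs s].
Hypothesis N_gt0 : glued -> (0 < N)%N.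
Hypothesis top_rank_ab : glued -> forall s, top_rank (ab s) = N.

(* [pure s m]: the monomial [m] only involves variables of the side [s] and
   divides the top monomial of that side. *)
Let pure s (m : 'X_{1..n}) :=
  all (fun i => m i == 0%N) (vs (~~ s)) && all (fun i => m i < cap i)%N (vs s).
Let exps s (m : 'X_{1..n}) : seq nat := [seq m i | i <- vs s].
(** In a connected sum the only pure monomials of degree [N] are the two tops, which receive a
    common name. *)
Let name s (m : 'X_{1..n}) : bool * seq nat :=
  if glued && (mdeg m == N) then (false, [::]) else (s, exps s m).
Let cls (m : 'X_{1..n}) : option (bool * seq nat) :=
  if m == 0%MM then Some (true, [::])
  else if pure true m then Some (name true m)
  else if pure false m then Some (name false m) else None.

Let pureP s m : reflect
  ((forall i, i \notin vs s -> m i = 0%N) /\ (forall i, i \in vs s -> m i < cap i)%N) (pure s m).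
Proof.
apply: (iffP andP) => [[/allP h1 /allP h2]|[h1 h2]]; split=> //.
- by move=> i; rewrite -vsN => /h1/eqP.
- by apply/allP => i; rewrite vsN => /h1/eqP.
- exact/allP.
Qed.

Let mdeg_exps s m : pure s m -> mdeg m = sumn (exps s m).
Proof.
move=> /pureP[m0 _]; rewrite mdegE (bigID (mem (vs s))) /= [X in (_ + X)%N]big1 // addn0.
by rewrite -big_uniq //= sumnE big_map.
Qed.

Let pure_inj s m m' : pure s m -> pure s m' -> exps s m = exps s m' -> m = m'.
Proof.
move=> /pureP[m0 _] /pureP[m'0 _] /eq_in_map E; apply/mnmP => i.
have [/E //|iv] := boolP (i \in vs s); by rewrite m0 ?m'0.
Qed.

Let exps_nil s m : pure s m -> exps s m = [::] -> m = 0%MM.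
Proof. by move=> pm E; apply/eqP; rewrite -mdeg_eq0 (mdeg_exps pm) E. Qed.

Let pure_side s s' (m k : 'X_{1..n}) : m != 0%MM -> pure s m -> pure s' (m + k)%MM -> s = s'.
Proof.
move=> m0 /pureP[ms _] /pureP[ms' _]; apply/eqP; case: eqVneq => // ss'.
have {ss'} E : s' = ~~ s by case: s s' ss' {ms ms'} => [] [].
rewrite {}E in ms'; case/eqP: m0; apply/mnmP => i; rewrite mnm0E.
have [iv|/ms //] := boolP (i \in vs s).
have := ms' i; rewrite -vsN negbK mnmDE => /(_ iv) /eqP; rewrite addn_eq0.
by case/andP=> /eqP.
Qed.

Let pureW s (m k : 'X_{1..n}) : pure s (m + k)%MM -> pure s m.
Proof.
move=> /pureP[h1 h2]; apply/pureP; split=> i iv.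
  by have /eqP := h1 i iv; rewrite mnmDE addn_eq0 => /andP[/eqP].
by apply: leq_trans (h2 i iv); rewrite ltnS mnmDE leq_addr.
Qed.

Let cls_pure s m : m != 0%MM -> pure s m -> cls m = Some (name s m).
Proof.
move=> m0 ms; rewrite /cls (negPf m0).
have sideE s' : pure s' m -> s = s'.
  by move=> ms'; apply: (pure_side (k := 0%MM) m0 ms); rewrite addm0.
case: ifP => [/sideE <- //|mt]; case: ifP => [/sideE <- //|mf].
by case: s ms {sideE}; rewrite ?mt ?mf.
Qed.

Let clsP m t : cls m = Some t -> m = 0%MM /\ t = (true, [::]) \/
  m != 0%MM /\ exists2 s, pure s m & t = name s m.
Proof.
rewrite /cls; case: eqVneq => [->|m0]; first by case=> <-; left.
by do 2! [case: ifP => [ms [<-]|_]; first by right; split=> //; eexists; last reflexivity].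
Qed.

Let top_exps s : exps s (top_mnm s) = [seq c.-1 | c <- ab s].
Proof. by rewrite -map_comp; apply/eq_in_map => i iv; rewrite mnmE iv. Qed.

Let pure_top s : pure s (top_mnm s).
Proof.
apply/pureP; split=> i iv; rewrite mnmE ?iv ?(negPf iv) //.
by rewrite prednK.
Qed.

Let mdeg_top s : glued -> mdeg (top_mnm s) = N.
Proof. by move=> g; rewrite (mdeg_exps (pure_top s)) top_exps -(top_rank_ab g s). Qed.

Let top_neq0 s : glued -> top_mnm s != 0%MM.
Proof. by move=> g; rewrite -mdeg_eq0 mdeg_top // -lt0n N_gt0. Qed.

Let pure_le_top s m : pure s m -> (m <= top_mnm s)%MM.
Proof.
move=> /pureP[h1 h2]; apply/mnm_lepP => i; rewrite mnmE.
by case: ifP => [/h2|/negbT/h1 -> //]; have := cap_gt0 i; lia.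
Qed.

Let mdeg_pure s m : glued -> pure s m -> (mdeg m <= N)%N.
Proof.
move=> g /pure_le_top/submK mE; rewrite -(mdeg_top s g) -mE mdegD leq_addl //.
Qed.

Let pure_eq_top s m : glued -> pure s m -> mdeg m = N -> m = top_mnm s.
Proof.
move=> g ms mN; have mE := submK (pure_le_top ms).
have := mdeg_top s g; rewrite -{1}mE mdegD mN => k0.
have /eqP : mdeg (top_mnm s - m)%MM = 0%N by lia.
by rewrite mdeg_eq0 => /eqP kE; rewrite -mE kE addmC addm0.
Qed.

Let name_exps s m t u : pure s m -> m != 0%MM -> name s m = (t, u) -> u != [::] ->
  [/\ t = s, exps s m = u & ~~ (glued && (mdeg m == N))].
Proof. by move=> ms m0; rewrite /name; case: ifP => [_ [_ <-] //|_ [<- <-] _]. Qed.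

Let name_nil s m t : pure s m -> m != 0%MM -> name s m = (t, [::]) ->
  [/\ t = false, glued & mdeg m = N].
Proof.
move=> ms /eqP m0; rewrite /name; case: ifP => [/andP[? /eqP ?] [<-] //|_ [_]].
by move/(exps_nil ms).
Qed.

Let cls_none m : cls m = None -> 'X_[m] \in I.
Proof.
have inI p : (p \in I) <-> [set` I] p by [].
rewrite /cls; case: eqP => // _; case: ifP => // /negP pt; case: ifP => // /negP pf _.
apply/inI; rewrite IE; case: (pickP (fun i => (cap i <= m i)%N)) => [i ci|small].
  exact: ideal_gen_pow (pow_gs i) ci.
have side s : ~ pure s m -> exists2 i, i \in vs (~~ s) & (0 < m i)%N.
  move=> nps; apply/hasP; apply/negPn/negP => /hasPn h; apply: nps; apply/pureP; split=> i.
    by rewrite -vsN => /h; rewrite lt0n negbK => /eqP.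
  by rewrite ltnNge small.
have [j jf mj] := side _ pt; have [i it mi] := side _ pf.
apply: ideal_gen_mul (mul_gs it jf) _ mi mj.
by apply: contraTneq it => ->; rewrite -vsN.
Qed.

Let cls_eq m m' t : cls m = Some t -> cls m' = Some t ->
  m = m' \/ glued /\ exists2 s, m = top_mnm s & m' = top_mnm (~~ s).
Proof.
move=> /clsP[[-> ->]|[m0 [s ms ->]]] /clsP[[-> tE]|[m0' [s' ms' tE]]].
- by left.
- by have [] := name_nil ms' m0' (esym tE).
- by have [] := name_nil ms m0 tE.
case nE: (name s m) tE => [r [|k u]] /esym nE'.
  have [_ g mN] := name_nil ms m0 nE; have [_ _ mN'] := name_nil ms' m0' nE'.
  rewrite (pure_eq_top g ms mN) (pure_eq_top g ms' mN').
  have [->|ss'] := eqVneq s s'; [by left|right; split=> //; exists s => //].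
  by case: s s' ss' {ms ms' nE nE'} => [] [].
have [rs su _] := name_exps ms m0 nE isT; have [rs' su' _] := name_exps ms' m0' nE' isT.
by left; apply: (@pure_inj s) => //; rewrite ?su -rs rs' ?su'.
Qed.

Let cls_mdeg m m' t : cls m = Some t -> cls m' = Some t -> mdeg m = mdeg m'.
Proof.
by move=> mt /(cls_eq mt)[-> //|[g [s -> ->]]]; rewrite !mdeg_top.
Qed.

Let mdeg_cls m t : cls m = Some t -> (mdeg m < (\sum_i cap i).+1)%N.
Proof.
move=> /clsP[[-> _]|[_ [s /pureP[h1 h2] _]]]; first by rewrite mdeg0.
rewrite ltnS mdegE; apply: leq_sum => i _.
by have [/h2/ltnW //|/h1 ->] := boolP (i \in vs s).
Qed.

(** Monomials with a class have degree at most the sum of the caps, which makes the list finite. *)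
Let reps t := [seq bmnm w | w <- enum {: 'X_{1..n < (\sum_i cap i).+1}} & cls (bmnm w) == Some t].

Let reps_uniq t : uniq (reps t).
Proof.
rewrite map_inj_uniq => [|u v]; [exact/filter_uniq/enum_uniq | exact: val_inj].
Qed.

Let repsP t m : (m \in reps t) = (cls m == Some t).
Proof.
apply/mapP/eqP => [[m' + ->]|mt]; first by rewrite mem_filter => /andP[/eqP].
by exists (BMultinom (mdeg_cls mt)) => //; rewrite mem_filter mem_enum inE /= mt eqxx.
Qed.

(** Covers the monomial generators: a multiple of a mixed product or of a power reaching its cap has
    no class, so no coefficient sum sees it. *)
Let cls_big s (k m : 'X_{1..n}) i : i \in vs s -> m i != 0%N ->
  (exists2 j, j \in vs (~~ s) & m j != 0%N) \/ (cap i <= m i)%N -> cls (k + m)%MM = None.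
Proof.
move=> iv mi big; case kmE: (cls _) => [t|] //; exfalso.
case/clsP: kmE => [[/mnmP kE _]|[_ [r /pureP[h1 h2] _]]].
  by have /eqP := kE i; rewrite mnmDE mnm0E addn_eq0 (negPf mi) andbF.
have [rs|] := boolP (i \in vs r); last first.
  by move/h1/eqP; rewrite mnmDE addn_eq0 (negPf mi) andbF.
have rE : r = s by apply: contraTeq iv => rs'; rewrite (_ : s = ~~ r) ?vsN ?rs //;
  case: r s rs' {rs h1 h2 big} => [] [].
subst r; case: big => [[j jv mj]|ci].
  rewrite vsN in jv; by have /eqP := h1 j jv; rewrite mnmDE addn_eq0 (negPf mj) andbF.
by have := h2 i iv; rewrite mnmDE; lia.
Qed.

Let cls_top k s : glued -> k != 0%MM -> cls (k + top_mnm s)%MM = None.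
Proof.
move=> g k0; case kE: (cls _) => [t|] //; exfalso.
case/clsP: kE => [[/eqP + _]|[_ [r kr _]]].
  by rewrite mnmD_eq0 (negPf k0).
have := mdeg_pure g kr; rewrite mdegD mdeg_top //.
by move: k0; rewrite -mdeg_eq0; lia.
Qed.

Let reps0 t p : p \in I -> coef_sum_on (reps t) p = 0.
Proof.
have inI q : (q \in I) <-> [set` I] q by [].
move/inI; rewrite IE; apply: coef_sum_ideal => g k /gsP.
have cntE m : count_mem m (reps t) = (cls m == Some t) by rewrite count_uniq_mem ?repsP.
case=> [[i ->]|[i [j [it jf ->]]]|[g_ ->]].
- rewrite mpolyXn -mpolyXD coef_sum_onX cntE.
  have Ui : (U_(i) *+ cap i)%MM i = cap i by rewrite mulmnE mnm1E eqxx mul1n.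
  case: (boolP (i \in vs true)) => iv; last rewrite -vsN in iv.
    by rewrite (cls_big (i := i) k iv) ?Ui -?lt0n //; right.
  by rewrite (cls_big (i := i) k iv) ?Ui -?lt0n //; right.
- rewrite -!mpolyXD coef_sum_onX cntE (cls_big (i := i) k it) //.
    by rewrite mnmDE !mnm1E eqxx.
  by left; exists j => //; rewrite mnmDE !mnm1E eqxx addn_eq0 andbF.
rewrite mulrBr -!mpolyXD coef_sum_onB !coef_sum_onX !cntE.
(* The two tops share a class and cancel in the binomial generator; their proper multiples have no
   class. *)
have [->|k0] := eqVneq k 0%MM; last by rewrite !cls_top // subrr.
rewrite !(addmC 0%MM) !addm0 !(cls_pure (top_neq0 _ g_) (pure_top _))
  /name g_ !mdeg_top // eqxx subrr //.
Qed.

Let exps_lt s m : pure s m -> all2 ltn (exps s m) (ab s).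
Proof.
move=> /pureP[_ h]; rewrite /exps /ab; move: h; elim: (vs s) => //= i v IHv h.
by rewrite h ?mem_head // IHv // => j jv; rewrite h // inE jv orbT.
Qed.

Let mnm_of s (u : seq nat) : 'X_{1..n} :=
  [multinom if i \in vs s then nth 0%N u (index i (vs s)) else 0%N | i < n].

Let exps_mnm s u : size u = size (vs s) -> exps s (mnm_of s u) = u.
Proof.
move=> su; apply: (@eq_from_nth _ 0%N) => [|k]; rewrite size_map // => kv.
have [i0 _] : exists i : 'I_n, True by case: (vs s) kv => // i; exists i.
by rewrite (nth_map i0) // mnmE mem_nth // index_uniq.
Qed.

Let pure_mnm s u : all2 ltn u (ab s) -> pure s (mnm_of s u).
Proof.
move=> /all2_ltnP[su ult]; apply/pureP; split=> i iv; rewrite mnmE ?iv ?(negPf iv) //.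
have := ult (index i (vs s)); rewrite size_map index_mem iv => /(_ isT).
by rewrite (nth_map i) ?index_mem // nth_index.
Qed.

Let levP d t : t \in wlev ab glued N d <-> exists2 m, cls m = Some t & mdeg m = d.
Proof.
split.
  have [rd|] := boolP (regular glued N d); last first.
    rewrite /regular /wlev; case: d => [|d] /=.
      by rewrite inE => _ /eqP ->; exists 0%MM; [rewrite /cls eqxx|rewrite mdeg0].
    rewrite negbK => gN; rewrite gN; case: eqP => // dN; rewrite inE => /eqP ->.
    case/andP: gN => g _; exists (top_mnm true); last by rewrite mdeg_top.
    by rewrite (cls_pure (top_neq0 _ g) (pure_top _)) /name g mdeg_top // eqxx.
  case: t => s u; rewrite mem_wlev // mem_box => /andP[ult /eqP ud].
  have pu := pure_mnm ult; have su := all2_size ult; rewrite size_map in su.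
  have md : mdeg (mnm_of s u) = d by rewrite (mdeg_exps pu) exps_mnm.
  exists (mnm_of s u) => //; rewrite (cls_pure (s := s)) //.
    rewrite /name md exps_mnm //; case: ifP => // /andP[g /eqP dN].
    by move: rd; rewrite /regular g dN leqnn andbF.
  by rewrite -mdeg_eq0 md -lt0n; case/andP: rd.
case=> m /clsP[[-> ->] <-|[m0 [s ms ->]] md]; first by rewrite mdeg0 inE.
have d0 : (0 < d)%N by rewrite -md lt0n mdeg_eq0.
rewrite /name md; case: ifP => [/andP[g /eqP dN]|gN].
  by rewrite /wlev -dN gtn_eqF // g leqnn eqxx inE.
rewrite mem_wlev ?mem_box ?exps_lt -?mdeg_exps ?md ?eqxx // /regular d0 /=.
apply/negP => /andP[g Nd]; move: gN (mdeg_pure g ms); rewrite g md /= => /eqP; lia.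
Qed.

Let exps_add s (m : 'X_{1..n}) i : i \in vs s ->
  exps s (m + U_(i))%MM = incr_nth (exps s m) (index i (vs s)).
Proof.
move=> iv; have ilt : (index i (vs s) < size (exps s m))%N by rewrite size_map index_mem.
apply: (@eq_from_nth _ 0%N) => [|k]; first by rewrite size_incr_nth ilt !size_map.
rewrite size_map => kv; rewrite nth_incr_nth !(nth_map i) // mnmDE mnm1E addnC; congr (_ + _)%N.
by rewrite -{1}(nth_index i iv) nth_uniq ?index_mem.
Qed.

Let covP d t u : t \in wlev ab glued N d -> u \in wlev ab glued N d.+1 ->
  wcov glued N d t u <-> exists m i, cls m = Some t /\ cls (m + U_(i))%MM = Some u.
Proof.
move=> td ud; have [m mt md] := (levP d t).1 td; have [m' mu md'] := (levP d.+1 u).1 ud.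
have [d0|d0] := posnP d.
  rewrite /wcov d0 /=; split=> // _.
  have /mdeg1P[i /eqP m'E] : mdeg m' == 1%N by rewrite md' d0.
  exists m, i; split=> //; move/eqP: md; rewrite d0 mdeg_eq0 => /eqP ->.
  by rewrite (addmC 0%MM) addm0 -m'E.
have nz k : mdeg k = d \/ mdeg k = d.+1 -> k != 0%MM by rewrite -mdeg_eq0; lia.
have m0 := nz m (or_introl md); have m0' := nz m' (or_intror md').
have [[? _]|[_ [s ms tE]]] := clsP mt; first by subst m; rewrite eqxx in m0.
have [[? _]|[_ [s' ms' uE]]] := clsP mu; first by subst m'; rewrite eqxx in m0'.
have [/andP[g /eqP dN]|gN] := boolP (glued && (d.+1 == N)).
  rewrite /wcov g dN eqxx orbT; split=> // _; have mtop := pure_le_top ms.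
  have /mdeg1P[i /eqP kE] : mdeg (top_mnm s - m)%MM == 1%N.
    by have := mdeg_top s g; rewrite -{1}(submK mtop) mdegD; lia.
  exists m, i; split=> //; rewrite addmC -kE (submK mtop) uE.
  by rewrite (cls_pure (top_neq0 _ g) (pure_top _)) /name g mdeg_top // md' dN eqxx.
have Nd : ~~ (glued && (mdeg m == N)).
  apply/negP => /andP[g /eqP mN]; have := mdeg_pure g ms'; lia.
rewrite /wcov gtn_eqF // (negPf gN) /= tE uE /name (negPf Nd) md' (negPf gN) /=.
split=> [/andP[/eqP ss' /cov_incrP[k kw vE]]|[m1 [i [m1t m1u]]]].
  subst s'; rewrite size_map in kw.
  have [i0 _] : exists i : 'I_n, True by case: (vs s) kw => // i; exists i.
  pose i := nth i0 (vs s) k; have iv : i \in vs s by apply: mem_nth.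
  have mi : exps s (m + U_(i))%MM = exps s m' by rewrite exps_add // index_uniq.
  exists m, i; split; first by rewrite (cls_pure m0 ms) /name (negPf Nd).
  suff -> : (m + U_(i))%MM = m' by rewrite (cls_pure m0' ms') /name md' (negPf gN).
  apply: (pure_inj _ ms' mi); have [h1 h2] := pureP s _ ms; have [_ h3] := pureP s _ ms'.
  apply/pureP; split=> j jv; last by have /eq_in_map -> := mi; [exact: h3|].
  by rewrite mnmDE h1 // mnm1E; case: eqP jv => // <-; rewrite iv.
move: mt mu; rewrite tE uE /name (negPf Nd) md' (negPf gN) => mt mu.
(* Away from degree [N] a class contains a single monomial. *)
have E1 : m1 = m.
  have [//|[g [r _ mE]]] := cls_eq m1t mt.
  by move: Nd; rewrite g mE mdeg_top // eqxx.
have E2 : m' = (m + U_(i))%MM.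
  have [//|[g [r mE _]]] := cls_eq mu m1u; first by rewrite E1.
  by move: gN; rewrite -md' g mE mdeg_top // eqxx.
subst m'; have ss' := pure_side m0 ms ms'; subst s'; rewrite eqxx /=.
have iv : i \in vs s.
  apply: contraT => /(proj1 (pureP s _ ms') i)/eqP.
  by rewrite mnmDE mnm1E eqxx addn_eq0 andbF.
by apply/cov_incrP; exists (index i (vs s)); rewrite ?exps_add // size_map index_mem.
Qed.

Theorem wedge_ring_macaulay :
  macaulay_ring I <-> macaulay_levels (wlev ab glued N) (wcov glued N).
Proof.
have inI p : (p \in I) <-> [set` I] p by [].
apply: (@macaulay_ring_levels _ _ _ _ (true, [::]) _ _ cls reps) => //.
  move=> m m' t mt mt'; have [->|[g [s -> ->]]] := cls_eq mt mt'; first by rewrite subrr rpred0.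
  have top : 'X_[top_mnm true] - 'X_[top_mnm false] \in I.
    by apply/inI; rewrite IE -[X in ideal_gen _ X]mul1r; apply: mem_ideal_gen (top_gs g).
  by case: s {mt mt'} => //; rewrite -opprB rpredN.
exact: uniq_wlev.
Qed.

End WedgeRing.

(** * Connected sums in terms of the given caps *)

Section ConnectedSumLevels.
Variables (n m : nat) (a : n.-tuple nat) (b : m.-tuple nat) (ab : bool -> seq nat) (N : nat).
Hypothesis abE : forall s, ab s = sort geq (if s then a : seq nat else b : seq nat).
Hypothesis n_gt0 : 0 < n.
Hypothesis m_gt0 : 0 < m.
Hypothesis a_ge2 : all (leq 2) a.
Hypothesis b_ge2 : all (leq 2) b.
Hypothesis top_rank_ab : forall s, top_rank (ab s) = N.

Lemma minn2 x y : 1 < x -> 1 < y -> (minn x y == 2) = (2 \in [:: x; y]).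
Proof. by rewrite !inE; lia. Qed.

Lemma sort_geq2 x y : 1 < x -> 1 < y -> minn x y = 2 -> sort geq [:: x; y] = [:: maxn x y; 2].
Proof.
move=> x2 y2 xy; rewrite /sort /=; case: (leqP y x) => yx; congr [:: _; _]; lia.
Qed.

Let geq_total : total geq. Proof. by move=> x y; apply: leq_total. Qed.
Let geq_trans : transitive geq. Proof. by move=> x y z xy yz; apply: leq_trans yz xy. Qed.
Let geq_anti : antisymmetric geq. Proof. by move=> x y; rewrite andbC => /anti_leq. Qed.

Lemma connected_sum_levels : macaulay_levels (wlev ab true N) (wcov true N) <->
  [\/ [/\ n = 1, m = 2 & minn (nth 0 b 0) (nth 0 b 1) = 2],
      [/\ n = 2, m = 1 & minn (nth 0 a 0) (nth 0 a 1) = 2]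
    | n = m /\ perm_eq a b].
Proof.
have ab2 s : all (leq 2) (ab s) by rewrite abE all_sort; case: s.
have size_ab s : size (ab s) = if s then n else m.
  by rewrite abE size_sort; case: s; rewrite size_tuple.
split=> [mac|].
  have [||E|[s [s1 s2 in2]]] := connected_sum_macaulay ab2 _ _ top_rank_ab mac.
  - by move=> s; rewrite abE; apply: sort_sorted.
  - by move=> s; rewrite size_ab; case: s.
  - constructor 3; split; first by have := size_ab true; rewrite E size_ab.
    by apply/(perm_sortP geq_total geq_trans geq_anti); move: E; rewrite !abE.
  rewrite !size_ab in s1 s2; rewrite abE mem_sort in in2.
  have pair k (c : k.-tuple nat) : k = 2 -> all (leq 2) c -> 2 \in (c : seq nat) ->
      minn (nth 0 c 0) (nth 0 c 1) = 2.
    move=> k2; subst k; case: c => [[|x [|y [|? ?]]]] //= _ /and3P[x2 y2 _] c2.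
    by apply/eqP; rewrite minn2.
  case: s s1 s2 in2 => /= k1 k2 in2.
    by constructor 1; split=> //; apply: pair.
  by constructor 2; split=> //; apply: pair.
have chain f (x y c : nat) : ab f = [:: c] -> ab (~~ f) = sort geq [:: x; y] ->
    minn x y = 2 -> macaulay_levels (wlev ab true N) (wcov true N).
  move=> abf abf' xy; have := ab2 (~~ f); rewrite abf' all_sort => /and3P[x2 y2 _].
  rewrite sort_geq2 // in abf'; have := top_rank_ab f; have := top_rank_ab (~~ f).
  have := ab2 f; rewrite abf abf' /top_rank /= !addn0 => /andP[c2 _] Nxy Nc.
  (* Equal top degrees give [c = N + 1] and [maxn x y = N]. *)
  by apply: (chain_rectangle_macaulay abf abf'); lia.
case=> [[n1 m2 b2]|[n2 m1 a2]|[nm ab_perm]].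
- have := abE false; have := abE true; move: b2.
  subst n m; case: (a) => [[|c []]] //= _; case: (b) => [[|x [|y []]]] //= _ xy abt abf.
  exact: (chain true x y c).
- have := abE false; have := abE true; move: a2.
  subst n m; case: (b) => [[|c []]] //= _; case: (a) => [[|x [|y []]]] //= _ xy abt abf.
  exact: (chain false x y c).
have abc s : ab s = ab true.
  by case: s => //; rewrite !abE; apply/esym/(perm_sortP geq_total geq_trans geq_anti).
have -> : ab = fun=> ab true by apply/funext.
by apply: twins_macaulay; rewrite // abE; apply: sort_sorted.
Qed.

End ConnectedSumLevels.

(** * The first two families of rings *)

Section Instances.
Local Open Scope ring_scope.
Local Open Scope classical_set_scope.
Variable K : fieldType.

Lemma connected_sum_ring (n m : nat) (a : n.-tuple nat) (b : m.-tuple nat)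
    (I : idealr {mpoly K[n + m]}) :
  (1 <= n)%N -> (1 <= m)%N ->
  (forall i, 2 <= tnth a i)%N -> (forall j, 2 <= tnth b j)%N ->
  (\sum_i tnth a i - n = \sum_j tnth b j - m)%N ->
  let x (i : 'I_n) : {mpoly K[n + m]} := 'X_(lshift m i) in
  let y (j : 'I_m) : {mpoly K[n + m]} := 'X_(rshift n j) in
  [set` I] = ideal_gen
    ([seq x i ^+ tnth a i | i : 'I_n] ++ [seq y j ^+ tnth b j | j : 'I_m]
     ++ [seq x i * y j | i <- enum 'I_n, j <- enum 'I_m]
     ++ [:: \prod_i x i ^+ (tnth a i - 1) - \prod_j y j ^+ (tnth b j - 1)]) ->
  macaulay_ring I <->
   [\/ [/\ n = 1%N, m = 2%N & minn (nth 0%N b 0) (nth 0%N b 1) = 2%N],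
       [/\ n = 2%N, m = 1%N & minn (nth 0%N a 0) (nth 0%N a 1) = 2%N]
     | n = m /\ perm_eq a b].
Proof.
move=> n0 m0 a2 b2 Nab x y; set gs := (X in ideal_gen X) => IE.
(* The variables of each side are listed by decreasing cap, as the theorem on boxes requires. *)
pose order k (c : k.-tuple nat) : seq 'I_k := sort (relpre (tnth c) geq) (enum 'I_k).
have order_uniq k (c : k.-tuple nat) : uniq (order k c) by rewrite sort_uniq enum_uniq.
have mem_order k (c : k.-tuple nat) i : i \in order k c by rewrite mem_sort mem_enum.
have orderE k (c : k.-tuple nat) : [seq tnth c i | i <- order k c] = sort geq c.
  by rewrite -sort_map map_tnth_enum.
pose vs s : seq 'I_(n + m) :=
  if s then map (lshift m) (order n a) else map (@rshift n m) (order m b).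
pose cap (i : 'I_(n + m)) := match fintype.split i with inl i => tnth a i | inr j => tnth b j end.
have capl i : cap (lshift m i) = tnth a i by rewrite /cap -[lshift m i]/(unsplit (inl i)) unsplitK.
have capr j : cap (rshift n j) = tnth b j by rewrite /cap -[rshift n j]/(unsplit (inr j)) unsplitK.
have vst i : (lshift m i \in vs true) * (lshift m i \notin vs false).
  split; first exact/map_f.
  by apply/mapP => -[j _ /eqP]; rewrite eq_lrshift.
have vsf j : (rshift n j \in vs false) * (rshift n j \notin vs true).
  split; first exact/map_f.
  by apply/mapP => -[i _ /eqP]; rewrite eq_rlshift.
pose ab s := [seq cap i | i <- vs s].
have abE s : ab s = sort geq (if s then a : seq nat else b : seq nat).
  by case: s; rewrite /ab -?orderE -map_comp; apply/eq_map => i /=.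
pose N := (\sum_i tnth a i - n)%N.
have top_rank_tuple k (c : k.-tuple nat) : (forall i, 2 <= tnth c i)%N ->
    top_rank (sort geq c) = (\sum_i tnth c i - k)%N.
  move=> c2; rewrite /top_rank (perm_sumn (perm_map _ (permEl (perm_sort geq c)))).
  have kE : k = (\sum_(i < k) 1)%N by rewrite sum1_card card_ord.
  rewrite sumnE big_map big_tuple [X in (_ - X)%N]kE -sumnB => [|i _]; last exact: ltnW.
  by apply: eq_bigr => i _; rewrite subn1.
have top_rank_ab s : top_rank (ab s) = N by rewrite abE; case: s; rewrite top_rank_tuple.
have all2t k (c : k.-tuple nat) : (forall i, 2 <= tnth c i)%N -> all (leq 2) c.
  by move=> c2; apply/all_tnthP.
have topx s : 'X_[top_mnm vs cap s] =
    if s then \prod_i x i ^+ (tnth a i - 1) else \prod_j y j ^+ (tnth b j - 1) :> {mpoly K[n + m]}.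
  rewrite mpolyXE_id big_split_ord /=; case: s.
    rewrite [X in _ * X]big1 ?mulr1 => [|j _]; last by rewrite mnmE (negPf (vsf j).2).
    by apply: eq_bigr => i _; rewrite mnmE (vst i).1 capl subn1.
  rewrite [X in X * _]big1 ?mul1r => [|i _]; last by rewrite mnmE (negPf (vst i).2).
  by apply: eq_bigr => j _; rewrite mnmE (vsf j).1 capr subn1.
have topE : 'X_[top_mnm vs cap true] - 'X_[top_mnm vs cap false] =
    \prod_i x i ^+ (tnth a i - 1) - \prod_j y j ^+ (tnth b j - 1) by rewrite !topx.
rewrite -(connected_sum_levels abE) //; [|exact: all2t..].
apply: (wedge_ring_macaulay (gs := gs)) => //.
- by case; rewrite map_inj_uniq //; [exact: lshift_inj|exact: rshift_inj].
- move=> s i; case: (split_ordP i) => j ->; case: s => /=;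
    by rewrite ?(vst j).1 ?(vsf j).1 ?(negPf (vst j).2) ?(negPf (vsf j).2).
- by move=> i; rewrite /cap; case: fintype.split => j; exact: ltnW.
- move=> i; case: (split_ordP i) => j ->; rewrite ?capl ?capr !mem_cat.
    by apply/orP; left; apply/mapP; exists j; rewrite ?mem_enum.
  by apply/orP; right; apply/orP; left; apply/mapP; exists j; rewrite ?mem_enum.
- move=> i j /mapP[k _ ->] /mapP[l _ ->]; rewrite !mem_cat; apply/or4P; constructor 3.
  by apply/allpairsP; exists (k, l); rewrite !mem_enum.
- by move=> _; rewrite topE !mem_cat mem_head !orbT.
- move=> g; rewrite !mem_cat topE => /or4P[/mapP[i _ ->]|/mapP[j _ ->]|/allpairsP[[i j] [_ _ ->]]|].
  + by constructor 1; exists (lshift m i); rewrite capl.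
  + by constructor 1; exists (rshift n j); rewrite capr.
  + by constructor 2; exists (lshift m i), (rshift n j); rewrite (vst i).1 (vsf j).1.
  by rewrite inE => /eqP ->; constructor 3.
move=> _; rewrite -(top_rank_ab true) abE top_rank_tuple // subn_gt0.
have : (\sum_(i < n) 2 <= \sum_i tnth a i)%N by apply: leq_sum => i _.
by rewrite sum_nat_const card_ord; lia.
Qed.

Lemma rectangle_wedge_ring (a1 a2 b1 b2 : nat) (I : idealr {mpoly K[4]}) :
  (2 <= a1)%N -> (2 <= a2)%N -> (2 <= b1)%N -> (2 <= b2)%N ->
  (a1 <= a2)%N -> (b1 <= b2)%N ->
  let x1 : {mpoly K[4]} := 'X_(inord 0) in
  let x2 : {mpoly K[4]} := 'X_(inord 1) in
  let y1 : {mpoly K[4]} := 'X_(inord 2) in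
  let y2 : {mpoly K[4]} := 'X_(inord 3) in
  [set` I] = ideal_gen
    [:: x1 ^+ a1; x2 ^+ a2; y1 ^+ b1; y2 ^+ b2;
        x1 * y1; x1 * y2; x2 * y1; x2 * y2] ->
  macaulay_ring I <->
  (a1 <= b1)%N /\ (a2 <= b2)%N \/ (b1 <= a1)%N /\ (b2 <= a2)%N.
Proof.
move=> a1_2 a2_2 b1_2 b2_2 a12 b12 x1 x2 y1 y2; set gs := (X in ideal_gen X) => IE.
(* The variable with the larger cap is listed first, so that the box of each side is [[:: c; b]]
   with [b <= c]. *)
pose vs s : seq 'I_4 := if s then [:: inord 1; inord 0] else [:: inord 3; inord 2].
pose cap (i : 'I_4) := nth 0%N [:: a1; a2; b1; b2] i.
have ord4 (P : 'I_4 -> Prop) :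
    P (inord 0) -> P (inord 1) -> P (inord 2) -> P (inord 3) -> forall i, P i.
  move=> P0 P1 P2 P3 i; rewrite -(inord_val i).
  by case: i => [[|[|[|[|i]]]]].
have capE : ((cap (inord 0) = a1) * (cap (inord 1) = a2) *
             (cap (inord 2) = b1) * (cap (inord 3) = b2))%type by rewrite /cap !inordK.
pose ab s := [seq cap i | i <- vs s].
have abt : ab true = [:: a2; a1] by rewrite /ab /= !capE.
have abf : ab false = [:: b2; b1] by rewrite /ab /= !capE.
have -> : macaulay_ring I <-> macaulay_levels (wlev ab false 0) (wcov false 0).
  apply: (wedge_ring_macaulay (gs := gs)) => //.
  - by case; rewrite /= inE -val_eqE /= !inordK.
  - by case; apply: ord4; rewrite /= !inE -!val_eqE /= !inordK.
  - by apply: ord4; rewrite capE ltnW.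
  - by apply: ord4; rewrite capE !inE eqxx ?orbT.
  - by move=> i j; rewrite !inE => /orP[] /eqP-> /orP[] /eqP->; rewrite eqxx ?orbT.
  by move=> g; rewrite !inE => /or4P[|||/or4P[|||/orP[]]] /eqP ->;
    first [by constructor 1; eexists; rewrite -?capE; reflexivity
          |by constructor 2; do 2 eexists; split; [| |reflexivity]; rewrite !inE eqxx ?orbT].
split=> [mac|[[ab1 ab2]|[ab1 ab2]]].
- have [[ab1 ba2]|[[ba1 ab2]|//]] : (a1 < b1 /\ b2 < a2)%N \/
      (b1 < a1 /\ a2 < b2)%N \/ ((a1 <= b1)%N /\ (a2 <= b2)%N \/ (b1 <= a1)%N /\ (b2 <= a2)%N).
    by lia.
  + by case: (rectangles_not_macaulay abt abf a1_2 ab1 b12 ba2 mac).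
  by case: (rectangles_not_macaulay abf abt b1_2 ba1 a12 ab2 mac).
- by apply: (rectangles_macaulay (f := true) _ abt abf); lia.
- by apply: (rectangles_macaulay (f := false) _ abf abt); lia.
Qed.

End Instances.

Local Open Scope classical_set_scope.
Local Open Scope ring_scope.

Theorem theorem4 (K : fieldType) :
  [/\
  forall (n m : nat) (a : n.-tuple nat) (b : m.-tuple nat)
         (I : idealr {mpoly K[n + m]}),
    (1 <= n)%N -> (1 <= m)%N ->
    (forall i, 2 <= tnth a i)%N -> (forall j, 2 <= tnth b j)%N ->
    (\sum_i tnth a i - n = \sum_j tnth b j - m)%N ->
    let x (i : 'I_n) : {mpoly K[n + m]} := 'X_(lshift m i) in
    let y (j : 'I_m) : {mpoly K[n + m]} := 'X_(rshift n j) in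
    [set` I] = ideal_gen
      ([seq x i ^+ tnth a i | i : 'I_n] ++ [seq y j ^+ tnth b j | j : 'I_m]
       ++ [seq x i * y j | i <- enum 'I_n, j <- enum 'I_m]
       ++ [:: \prod_i x i ^+ (tnth a i - 1) - \prod_j y j ^+ (tnth b j - 1)]) ->
    (macaulay_ring I <->
     [\/ [/\ n = 1%N, m = 2%N & minn (nth 0%N b 0) (nth 0%N b 1) = 2%N],
         [/\ n = 2%N, m = 1%N & minn (nth 0%N a 0) (nth 0%N a 1) = 2%N]
       | n = m /\ perm_eq a b]),
  forall (a1 a2 b1 b2 : nat) (I : idealr {mpoly K[4]}),
    (2 <= a1)%N -> (2 <= a2)%N -> (2 <= b1)%N -> (2 <= b2)%N ->
    (a1 <= a2)%N -> (b1 <= b2)%N ->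
    let x1 : {mpoly K[4]} := 'X_(inord 0) in
    let x2 : {mpoly K[4]} := 'X_(inord 1) in
    let y1 : {mpoly K[4]} := 'X_(inord 2) in
    let y2 : {mpoly K[4]} := 'X_(inord 3) in
    [set` I] = ideal_gen
      [:: x1 ^+ a1; x2 ^+ a2; y1 ^+ b1; y2 ^+ b2;
          x1 * y1; x1 * y2; x2 * y1; x2 * y2] ->
    (macaulay_ring I <->
     (a1 <= b1)%N /\ (a2 <= b2)%N \/ (b1 <= a1)%N /\ (b2 <= a2)%N)
  & forall (a0 a1 b0 b1 : nat) (I : idealr {mpoly K[2]}),
    (1 <= a0)%N -> (1 <= a1)%N -> (1 <= b0)%N -> (1 <= b1)%N ->
    let x : {mpoly K[2]} := 'X_(inord 0) in
    let y : {mpoly K[2]} := 'X_(inord 1) in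
    [set` I] = ideal_gen [:: x ^+ a0; y ^+ a1] `&`
               ideal_gen [:: x ^+ b0; y ^+ b1] ->
    (macaulay_ring I <->
     [\/ (a0 <= b0)%N /\ (a1 <= b1)%N,
         (b0 <= a0)%N /\ (b1 <= a1)%N,
         [/\ (b0 < a0)%N, (a1 < b1)%N &
           [\/ a0 = b1,
               (b1 < a0)%N /\ (b1 + b0 <= a0 + a1)%N
             | (a0 < b1)%N /\ (a0 + a1 <= b0 + b1)%N]]
       | [/\ (a0 < b0)%N, (b1 < a1)%N &
           [\/ b0 = a1,
               (a1 < b0)%N /\ (a1 + a0 <= b0 + b1)%N
             | (b0 < a1)%N /\ (b0 + b1 <= a0 + a1)%N]]])].
Proof.
by split=> *; [apply: connected_sum_ring | apply: rectangle_wedge_ring |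
  apply: iff_trans (rectangle_intersection_macaulay _) (lshape_macaulayP _ _ _ _)].
Qed.
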